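(* Let $\Gamma$ be a hyperbolic group, $P$ a closed, $\Gamma$-invariant subset of $\partial^{(2)}\Gamma$, and $\rho:\Gamma\to\mathrm{GL}(d,\mathbb{R})$ a representation that is $k$-dominated on $\Gamma_P^+$ ($1\leqslant k\leqslant d-1$), with pair of limit maps $(\xi^k,\xi_{d-k})$. (1) Let $(\gamma_n)$ be a sequence in $\Gamma$ with $\gamma_n\to x\in\Pi_1(P)$ as $n\to\infty$. If there are constants $\lambda\geqslant1$, $\epsilon,b\geqslant0$ such that $\gamma_n\in\Gamma^+_{P,(\lambda,\epsilon,b)}$ for all $n\in\mathbb{N}$, then $$\xi^k(x)=\lim_{n\to+\infty}U_k(\rho(\gamma_n)).$$ (2) For any constants $\lambda\geqslant1$ and $\epsilon,b\geqslant0$, $\xi^k$ is Hölder continuous on $Q^{+\infty}_{P,(\lambda,\epsilon,b)}$, and hence $(\xi^k,\xi_{d-k})$ is Hölder continuous on any compact subset of $P$.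
   Context: $\Gamma$ is a hyperbolic group with a fixed finite symmetric generating set $S$, $\mathrm{Cay}(\Gamma,S)$ its Cayley graph with word metric $d$, $|\gamma|=d(\gamma,\mathrm{id})$, $\partial\Gamma$ its Gromov boundary, $\partial^{(2)}\Gamma=\{(x,y)\in\partial\Gamma^2:x\neq y\}$; $\mathbb{R}_+$ denotes the positive reals. A $(\lambda,\epsilon)$-quasi-geodesic ($\lambda\geqslant1,\epsilon\geqslant0$) is a map $l:\mathbb{R}\to\mathrm{Cay}(\Gamma,S)$ with $\lambda^{-1}|s-t|-\epsilon\leqslant d(l(s),l(t))\leqslant\lambda|s-t|+\epsilon$; $l(\pm\infty)\in\partial\Gamma$ are its endpoints. For $b\geqslant0$, $$Q_{P,(\lambda,\epsilon,b)}=\{l : l\text{ a }(\lambda,\epsilon)\text{-quasi-geodesic},\ d(l(0),\mathrm{id})\leqslant b,\ (l(+\infty),l(-\infty))\in P\},$$ $$\Gamma^+_{P,(\lambda,\epsilon,b)}=\{l(t):l\in Q_{P,(\lambda,\epsilon,b)},\ t\in\mathbb{R}_+,\ l(t)\in\Gamma\},\quad \Gamma_P^+=\Gamma^+_{P,(1,0,0)},\quad Q^{+\infty}_{P,(\lambda,\epsilon,b)}=\{l(+\infty):l\in Q_{P,(\lambda,\epsilon,b)}\}.$$ $\Pi_1(P),\Pi_2(P)\subset\partial\Gamma$ are the projections of $P$ to the first and second coordinates. $\sigma_1\geqslant\dots\geqslant\sigma_d$ denote singular values of matrices with respect to the standard inner product. $\rho$ is $k$-dominated on $M\subset\Gamma$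 if there are $C,\lambda>0$ with $\sigma_{k+1}(\rho(\gamma))/\sigma_k(\rho(\gamma))\leqslant Ce^{-\lambda|\gamma|}$ for all $\gamma\in M$. If $\sigma_k(A)>\sigma_{k+1}(A)$, $U_k(A)\in\mathrm{Gr}_k(\mathbb{R}^d)$ is the sum of the eigenspaces of $(AA^* )^{1/2}$ for its $k$ largest eigenvalues (in (1), $U_k(\rho(\gamma_n))$ is defined for all large $n$). Limit maps: when $\rho$ is $k$-dominated on $\Gamma_P^+$ there is a unique pair of $\rho$-equivariant maps $\xi^k:\Pi_1(P)\to\mathrm{Gr}_k(\mathbb{R}^d)$, $\xi_{d-k}:\Pi_2(P)\to\mathrm{Gr}_{d-k}(\mathbb{R}^d)$ such that $(x,y)\mapsto(\xi^k(x),\xi_{d-k}(y))$ is continuous on $P$, transverse ($\xi^k(x)\oplus\xi_{d-k}(y)=\mathbb{R}^d$ for $(x,y)\in P$), and strongly dynamics preserving of index $k$: for all $\lambda\geqslant1$, $\epsilon,b\geqslant0$, $x,y\in\partial\Gamma$ and every sequence $(\gamma_n)$ in $\Gamma^+_{P,(\lambda,\epsilon,b)}$ with $\gamma_n\to x$, $\gamma_n^{-1}\to y$, one has $\rho(\gamma_n)V\to\xi^k(x)$ for every $V\in\mathrm{Gr}_k(\mathbb{R}^d)$ transverse to $\xi_{d-k}(y)$. This pair is the pair of limit maps of $\rho$. Metrics for Hölder continuity: on $\partial\Gamma$, a visual metric $d_\kappa$ with base point $\mathrm{id}$, $\kappa>0$ small, satisfying $\nu e^{-\kappa(x\cdot y)_{\mathrm{id}}}\leqslant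 d_\kappa(x,y)\leqslant e^{-\kappa(x\cdot y)_{\mathrm{id}}}$ for some $0<\nu\leqslant1$, where $(x\cdot y)_{\mathrm{id}}$ is the Gromov product; on Grassmannians, $d(V,W)=\max\{\max_{0\ne v\in V}\min_{0\neq w\in W}\sin\angle(v,w),\max_{0\neq w\in W}\min_{0\neq v\in V}\sin\angle(v,w)\}$; product metrics on products. *)

(* Defs.v *)
From HB Require Import structures.
From mathcomp Require Import all_boot all_order all_algebra.
From mathcomp Require Import all_classical all_reals all_analysis.
From mathcomp Require Import lra.

Set Implicit Arguments.
Unset Strict Implicit.
Unset Printing Implicit Defensive.

Import Order.TTheory GRing.Theory Num.Theory.
Import numFieldNormedType.Exports.

Local Open Scope classical_set_scope.
Local Open Scope ring_scope.

(** * Word metric *)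

Record gen_set (Gam : groupType) := GenSet {
  gens :> seq Gam;
  gens_sym : forall s : Gam, s \in gens -> (s^-1)%g \in gens;
  gens_gen : forall g : Gam, exists2 w : seq Gam,
    all [in gens] w & g = (\prod_(x <- w) x)%g }.

Section WordMetric.
Context (Gam : groupType) (S : gen_set Gam).

Definition is_word_of_length (g : Gam) (n : nat) : Prop :=
  exists w : seq Gam,
    [/\ size w = n, all [in gens S] w & g = (\prod_(x <- w) x)%g].

Lemma word_length_exists (g : Gam) : exists n, `[< is_word_of_length g n >].
Proof.
have [w wS gE] := gens_gen S g.
by exists (size w); apply/asboolP; exists w.
Qed.

Definition word_length (g : Gam) : nat := ex_minn (word_length_exists g).

Definition word_dist (g h : Gam) : nat := word_length (g^-1 * h)%g.

Lemma word_length1 : word_length 1%g = 0%N.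
Proof.
rewrite /word_length; case: ex_minnP => m _ /(_ 0%N) H.
apply/eqP; rewrite -leqn0; apply: H; apply/asboolP; exists [::].
by split=> //; rewrite big_nil.
Qed.

Lemma word_lengthM (g h : Gam) :
  (word_length (g * h)%g <= word_length g + word_length h)%N.
Proof.
rewrite /word_length; case: ex_minnP => m _ mmin.
case: ex_minnP => a /asboolP[u [<- uS gE]] _.
case: ex_minnP => b /asboolP[v [<- vS hE]] _.
apply: mmin; apply/asboolP; exists (u ++ v).
by rewrite size_cat all_cat uS vS big_cat gE hE.
Qed.

Lemma word_distxx (g : Gam) : word_dist g g = 0%N.
Proof. by rewrite /word_dist mulVg word_length1. Qed.

Lemma word_dist_triangle (g h k : Gam) :
  (word_dist g k <= word_dist g h + word_dist h k)%N.
Proof.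
have -> : word_dist g k = word_length ((g^-1 * h) * (h^-1 * k))%g.
  by rewrite /word_dist -mulgA mulVKg.
exact: word_lengthM.
Qed.

Lemma word_dist_translate (a g h : Gam) :
  word_dist (a * g)%g (a * h)%g = word_dist g h.
Proof. by rewrite /word_dist invgM -mulgA mulKg. Qed.

End WordMetric.

(** * The Cayley graph as a metric graph *)

Section Cayley.
Context (R : realType) (Gam : groupType) (S : gen_set Gam).

(* [Cay g s t] is the point at distance t from g on the unit edge from g to
   g s; vertices are the points [Cay g 1 0].  Loops (s = 1) carry no edge.  A
   point of the geometric realization may have several representatives, namely
   (g, s, t) and (g s, s^-1, 1 - t) and the various endpoints of edges at a
   vertex; two representatives denote the same point iff their distance is 0. *)
Record cayley := Cay {
  src : Gam;
  dir : Gam;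
  pos : R;
  _ : ((dir == 1%g) && (pos == 0)) ||
      [&& dir \in gens S, dir != 1%g & 0 <= pos <= 1] }.

Lemma vert_subproof : ((1%g == 1%g :> Gam) && ((0 : R) == 0)) ||
  [&& 1%g \in gens S, 1%g != 1%g :> Gam & 0 <= (0 : R) <= 1].
Proof. by rewrite !eqxx. Qed.

Definition vert (g : Gam) : cayley := @Cay g 1%g 0 vert_subproof.

Definition tgt (p : cayley) : Gam := (src p * dir p)%g.

Definition cay_dist (p q : cayley) : R :=
  let wd g h := (word_dist S g h)%:R in
  let t := pos p in
  let u := pos q in
  if (src p == src q) && (dir p == dir q) then `|t - u|
  else if (src p == tgt q) && (tgt p == src q) then `|t - (1 - u)|
  else Num.min
    (Num.min (t + wd (src p) (src q) + u)
             (t + wd (src p) (tgt q) + (1 - u)))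
    (Num.min (1 - t + wd (tgt p) (src q) + u)
             (1 - t + wd (tgt p) (tgt q) + (1 - u))).

Definition gromov_product (o p q : cayley) : R :=
  (cay_dist p o + cay_dist q o - cay_dist p q) / 2.

Definition translate (g : Gam) (p : cayley) : cayley :=
  let: Cay a s t h := p in @Cay (g * a)%g s t h.

Lemma cayley_eq (p q : cayley) :
  src p = src q -> dir p = dir q -> pos p = pos q -> p = q.
Proof.
case: p q => [a s t hp] [b r u hq] /= ab sr tu; subst b r u.
by rewrite (bool_irrelevance hp hq).
Qed.

Lemma translateK (g : Gam) : cancel (translate g) (translate g^-1%g).
Proof.
by case=> a s t h; apply: cayley_eq => //=; rewrite mulKg.
Qed.

Lemma translateVK (g : Gam) : cancel (translate g^-1%g) (translate g).
Proof. by move=> p; rewrite -[X in translate X _ = _]invgK translateK. Qed.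

Lemma cay_dist_translate (g : Gam) (p q : cayley) :
  cay_dist (translate g p) (translate g q) = cay_dist p q.
Proof.
case: p q => [a s t hp] [b r u hq]; rewrite /cay_dist /tgt /=.
by rewrite -!mulgA !(inj_eq (mulgI _)) !word_dist_translate.
Qed.

Lemma cay_dist_vert (p : cayley) (a : Gam) :
  cay_dist p (vert a) = Num.min (pos p + (word_dist S (src p) a)%:R)
                                (1 - pos p + (word_dist S (tgt p) a)%:R).
Proof.
case: p => b s t h; rewrite /cay_dist /tgt /= mulg1.
case: (eqVneq b a) => [->|ba] /=.
  rewrite word_distxx !addr0.
  case: (eqVneq s 1%g) h => [->|s1] /= h.
    have -> : t = 0 by apply/eqP; move: h; rewrite /= andbF orbF.
    rewrite mulg1 word_distxx subr0 normr0 addr0; apply/esym/min_idPl; lra.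
  have /andP[t0 t1] : 0 <= t <= 1 by move: h => /= /andP[].
  have sne : (a * s == a)%g = false.
    by apply/negbTE/eqP => e; move/eqP: s1; apply; apply: (mulgI a); rewrite mulg1.
  rewrite sne; rewrite !minEle; repeat case: ifP; lra.
rewrite !addr0 !subr0 !minEle; repeat case: ifP; lra.
Qed.

Lemma cay_dist_vert_lip (p : cayley) (a b : Gam) :
  cay_dist p (vert b) <= cay_dist p (vert a) + (word_dist S a b)%:R.
Proof.
rewrite !cay_dist_vert.
have H c : (word_dist S c b)%:R <= (word_dist S c a)%:R + (word_dist S a b)%:R :> R.
  by rewrite -natrD ler_nat word_dist_triangle.
have := H (src p); have := H (tgt p).
rewrite !minEle; repeat case: ifP; lra.
Qed.

Lemma gromov_product_translate (g : Gam) (p q : cayley) :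
  gromov_product (vert 1%g) p q - (word_length S g)%:R <=
  gromov_product (vert 1%g) (translate g p) (translate g q).
Proof.
have H r : cay_dist r (vert 1%g) <=
    cay_dist (translate g r) (vert 1%g) + (word_length S g)%:R.
  have e : vert 1%g = translate g (vert g^-1%g).
    by apply: cayley_eq => //=; rewrite mulgV.
  rewrite [X in _ <= cay_dist _ X + _]e cay_dist_translate.
  have -> : word_length S g = word_dist S g^-1%g 1%g.
    by rewrite /word_dist invgK mulg1.
  exact: cay_dist_vert_lip.
have := H p; have := H q; rewrite /gromov_product cay_dist_translate.
lra.
Qed.

(* Gromov's four-point condition. *)
Definition hyperbolic : Prop :=
  exists delta : R, forall o p q r : cayley,
    Num.min (gromov_product o p q) (gromov_product o q r) - delta <=
    gromov_product o p r.

End Cayley.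

Arguments vert {R Gam S} g.

(** * The Gromov boundary *)

Section Boundary.
Context (R : realType) (Gam : groupType) (S : gen_set Gam).
Local Notation cay := (cayley R S).
Local Notation o := (vert 1%g : cay).

Definition asymptotic (u v : nat -> cay) : Prop :=
  gromov_product o (u ij.1) (v ij.2) @[ij --> filter_prod \oo \oo] --> +oo.

Definition converges_at_infinity (u : nat -> cay) : Prop := asymptotic u u.

Definition asymptotic_class (u : nat -> cay) : set (nat -> cay) :=
  [set v | converges_at_infinity v /\ asymptotic u v].

(* A boundary point is an equivalence class of sequences converging at
   infinity; [bclass x u] thus says that u converges to x in the
   compactification of the Cayley graph by its boundary. *)
Record boundary := Boundary {
  bclass : set (nat -> cay);
  _ : exists2 u, converges_at_infinity u & bclass = asymptotic_class u }.

HB.instance Definition _ := gen_eqMixin boundary.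
HB.instance Definition _ := gen_choiceMixin boundary.

Lemma asymptotic_translate (g : Gam) (u v : nat -> cay) :
  asymptotic u v -> asymptotic (translate g \o u) (translate g \o v).
Proof.
move=> /cvgryPge uv; apply/cvgryPge => A.
apply: filterS (uv (A + (word_length S g)%:R)) => ij /= H.
by apply: le_trans (gromov_product_translate _ _ _); rewrite lerBrDr.
Qed.

Lemma asymptotic_class_translate (g : Gam) (u : nat -> cay) :
  [set translate g \o v | v in asymptotic_class u] =
  asymptotic_class (translate g \o u).
Proof.
apply/seteqP; split=> [_ [v [vi uv] <-]|v [vi uv]].
  by split; exact: asymptotic_translate.
exists (translate g^-1%g \o v).
  split; first exact: asymptotic_translate.
  have -> : u = translate g^-1%g \o (translate g \o u).
    by apply/funext => n /=; rewrite translateK.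
  exact: asymptotic_translate.
by apply/funext => n /=; rewrite translateVK.
Qed.

Lemma act_subproof (g : Gam) (x : boundary) :
  exists2 u, converges_at_infinity u &
    [set translate g \o v | v in bclass x] = asymptotic_class u.
Proof.
case: x => c [u ui cE] /=; exists (translate g \o u).
  exact: asymptotic_translate.
by rewrite cE asymptotic_class_translate.
Qed.

Definition act (g : Gam) (x : boundary) : boundary :=
  Boundary (act_subproof g x).

Definition boundary_gromov_product (x y : boundary) : \bar R :=
  ereal_sup [set limf_einf
      (fun ij : nat * nat => (gromov_product o (uv.1 ij.1) (uv.2 ij.2))%:E)
      (filter_prod \oo \oo)
    | uv in bclass x `*` bclass y].

(* U is open iff it contains, with each x, some {y | r < (x.y)}. *)
Definition boundary_open (U : set boundary) : Prop :=
  forall x, U x ->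
    exists r : R, forall y, (r%:E < boundary_gromov_product x y)%E -> U y.

Lemma boundary_openT : boundary_open setT.
Proof. by move=> x _; exists 0. Qed.

Lemma boundary_openI : setI_closed boundary_open.
Proof.
move=> A B oA oB x [/oA [r rA] /oB [t tB]]; exists (Num.max r t) => y.
by rewrite EFin_max gt_max => /andP[? ?]; split; [exact: rA|exact: tB].
Qed.

Lemma boundary_open_bigU (I : Type) (f : I -> set boundary) :
  (forall i, boundary_open (f i)) -> boundary_open (\bigcup_i f i).
Proof.
by move=> fo x [i _ /fo [r rf]]; exists r => y /rf fy; exists i.
Qed.

HB.instance Definition _ := isOpenTopological.Build boundary
  boundary_openT boundary_openI boundary_open_bigU.

Definition boundary2 : set (boundary * boundary) := [set z | z.1 != z.2].

Definition closed_in_boundary2 (P : set (boundary * boundary)) : Prop :=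
  exists2 C, closed C & P = C `&` boundary2.

Definition group_invariant (P : set (boundary * boundary)) : Prop :=
  forall (g : Gam) x y, P (x, y) -> P (act g x, act g y).

Definition proj1_set (P : set (boundary * boundary)) : set boundary :=
  [set x | exists y, P (x, y)].

Definition proj2_set (P : set (boundary * boundary)) : set boundary :=
  [set y | exists x, P (x, y)].

(* In the inequalities, expeR (-oo) = 0 for x = y. *)
Definition visual_metric (kappa nu : R) (D : boundary -> boundary -> R) : Prop :=
  [/\ forall x y, D x y = 0 <-> x = y,
      forall x y, D x y = D y x,
      forall x y z, D x z <= D x y + D y z &
      forall x y,
        let e := expeR (- (kappa%:E * boundary_gromov_product x y))%E in
        (nu%:E * e <= (D x y)%:E /\ (D x y)%:E <= e)%E].

(** * Quasi-geodesics *)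

Definition quasi_geodesic (lambda eps : R) (l : R -> cay) : Prop :=
  forall s t : R,
    lambda^-1 * `|s - t| - eps <= cay_dist (l s) (l t) /\
    cay_dist (l s) (l t) <= lambda * `|s - t| + eps.

Definition endpoint_pinfty (l : R -> cay) (x : boundary) : Prop :=
  forall t : nat -> R, t @ \oo --> +oo -> bclass x (l \o t).

Definition endpoint_ninfty (l : R -> cay) (x : boundary) : Prop :=
  forall t : nat -> R, t @ \oo --> -oo -> bclass x (l \o t).

Definition QP (P : set (boundary * boundary)) (lambda eps b : R) :
    set (R -> cay) :=
  [set l | [/\ quasi_geodesic lambda eps l, cay_dist (l 0) o <= b &
    exists x y, [/\ endpoint_pinfty l x, endpoint_ninfty l y & P (x, y)]]].

(* Being at distance 0 from a vertex means being that vertex, see [cayley]. *)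
Definition Gamma_plus (P : set (boundary * boundary)) (lambda eps b : R) :
    set Gam :=
  [set g | exists l t,
    [/\ QP P lambda eps b l, 0 < t & cay_dist (l t) (vert g) = 0]].

Definition QP_pinfty (P : set (boundary * boundary)) (lambda eps b : R) :
    set boundary :=
  [set x | exists2 l, QP P lambda eps b l & endpoint_pinfty l x].

End Boundary.

(** * Singular values and Grassmannians *)

Section Linear.
Context (R : realType) (d : nat).
Local Notation vec := 'cV[R]_d.

Definition dot (v w : vec) : R := (v^T *m w) 0 0.

Definition euclid_norm (v : vec) : R := Num.sqrt (dot v v).

(* (A A^* )^(1/2), the positive semidefinite square root of A A^T *)
Definition abs_mx (A : 'M[R]_d) : 'M[R]_d :=
  xget 0 [set B | [/\ B^T = B, forall v : vec, 0 <= dot v (B *m v) &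
                      B *m B = A *m A^T]].

Definition singular_values (A : 'M[R]_d) : seq R :=
  xget [::] [set s | sorted >=%R s /\
    char_poly (abs_mx A) = \prod_(x <- s) ('X - x%:P)].

(* The k-th largest singular value, with 1 <= k <= d. *)
Definition sigma (k : nat) (A : 'M[R]_d) : R := (singular_values A)`_k.-1.

Definition mxlin (A : 'M[R]_d) : 'End(vec) := linfun (mulmx A : vec -> vec).

Definition Uk (k : nat) (A : 'M[R]_d) : {vspace vec} :=
  (\sum_(1 <= i < k.+1) passmx.leigenspace (mxlin (abs_mx A)) (sigma i A))%VS.

Definition Grass (k : nat) : set {vspace vec} := [set V | \dim V = k].

Definition transverse (V W : {vspace vec}) : Prop :=
  (V + W)%VS = fullv /\ (V :&: W)%VS = 0%VS.

Definition angle (v w : vec) : R :=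
  acos (dot v w / (euclid_norm v * euclid_norm w)).

Definition nonzero_vectors (V : {vspace vec}) : set vec :=
  [set v | v \in V /\ v != 0].

Definition grass_excess (V W : {vspace vec}) : R :=
  sup [set inf [set sin (angle v w) | w in nonzero_vectors W]
      | v in nonzero_vectors V].

Definition grass_dist (V W : {vspace vec}) : R :=
  Num.max (grass_excess V W) (grass_excess W V).

Definition grass_cvg (U : nat -> {vspace vec}) (V : {vspace vec}) : Prop :=
  grass_dist (U n) V @[n --> \oo] --> 0.

End Linear.

(** * Representations, domination and limit maps *)

Section Representations.
Context (R : realType) (Gam : groupType) (S : gen_set Gam) (d : nat).
Local Notation bd := (boundary R S).
Local Notation subsp := {vspace 'cV[R]_d}.

Definition is_representation (rho : Gam -> 'M[R]_d) : Prop :=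
  [/\ forall g, rho g \in unitmx, rho 1%g = 1%:M &
      forall g h, rho (g * h)%g = rho g *m rho h].

Definition dominated (k : nat) (rho : Gam -> 'M[R]_d) (M : set Gam) : Prop :=
  exists C lambda : R, [/\ 0 < C, 0 < lambda & forall g, M g ->
    sigma k.+1 (rho g) / sigma k (rho g) <=
    C * expR (- lambda * (word_length S g)%:R)].

Definition limit_maps (k : nat) (P : set (bd * bd)) (rho : Gam -> 'M[R]_d)
    (xi1 xi2 : bd -> subsp) : Prop :=
  [/\ (forall x, proj1_set P x -> Grass k (xi1 x)) /\
      (forall y, proj2_set P y -> Grass (d - k) (xi2 y)),
      (forall g x, proj1_set P x ->
         xi1 (act g x) = (mxlin (rho g) @: xi1 x)%VS) /\
      (forall g y, proj2_set P y ->
         xi2 (act g y) = (mxlin (rho g) @: xi2 y)%VS),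
      forall z, P z ->
        Num.max (grass_dist (xi1 w.1) (xi1 z.1))
                (grass_dist (xi2 w.2) (xi2 z.2))
          @[w --> within P (nbhs z)] --> 0,
      forall x y, P (x, y) -> transverse (xi1 x) (xi2 y) &
      forall (lambda eps b : R), 1 <= lambda -> 0 <= eps -> 0 <= b ->
      forall (x y : bd) (gam : nat -> Gam),
        (forall n, Gamma_plus P lambda eps b (gam n)) ->
        bclass x (fun n => vert (gam n)) ->
        bclass y (fun n => vert (gam n)^-1%g) ->
        forall V, Grass k V -> transverse V (xi2 y) ->
          grass_cvg (fun n => mxlin (rho (gam n)) @: V)%VS (xi1 x)].

End Representations.

Definition holder_on (R : realType) (T : Type) (A : set T)
    (D D' : T -> T -> R) : Prop :=
  exists C alpha : R, [/\ 0 < C, 0 < alpha, alpha <= 1 &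
    forall x y, A x -> A y -> D' x y <= C * D x y `^ alpha].

(* Main.v *)
(* A bi-infinite quasi-geodesic with endpoints (x, y) in P carries the splitting
   xi1 x (+) xi2 y, transported equivariantly.  Quasi-geodesics through the
   identity form a compact family, so the dynamics-preserving property of the
   limit maps forces rho(l t) to contract xi2 relatively to xi1 by a definite
   factor after a uniform time T; submultiplicativity along l turns this into
   an exponential rate, and the minimax principle turns the rate into a gap
   between sigma_k and sigma_{k+1} together with the exponential convergence of
   U_k(rho(l t)) to xi1 x.  This gives (1).  For (2), two quasi-geodesics whose
   endpoints have Gromov product A fellow-travel for a time proportional to A,
   so both limit subspaces are exponentially close in A to a common U_k. *)
Require Import Defs.
From mathcomp Require Import all_boot all_order all_algebra.
From mathcomp Require Import all_classical all_reals all_analysis.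
From mathcomp Require Import lra ring zify.

Set Implicit Arguments.
Unset Strict Implicit.
Unset Printing Implicit Defensive.

Import Order.TTheory GRing.Theory Num.Theory.
Import numFieldNormedType.Exports.

Local Open Scope classical_set_scope.
Local Open Scope ring_scope.

(** * Euclidean geometry of subspaces *)

(** Two features of the setting shape the proof. A quasi-geodesic is an arbitrary map on the real
    line, possibly discontinuous, and a point of the graph has several representatives. Lines are
    therefore rounded to vertex-valued maps, which enlarges eps by 6 and b by 1, and compactness
    comes from pointwise limits along a non-principal ultrafilter, which exist because balls of the
    word metric are finite. Moreover, continuity is given for the pair of limit maps on P, so both
    endpoints of a line are carried along throughout. The dynamics concern a fixed subspace V,
    whereas contraction compares vectors in fibres that vary with the line; tilting a limit fibre
    turns a failure of contraction into a single bad V. Rates are stated for rho(l t)^-1 on the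
    fibres at the identity, because U_k(A) is spanned by the directions that A^-1 stretches least.
    Finally, xi2 plays the part of xi1 once the coordinates of P are exchanged, the lines reversed
    and k replaced by d - k. *)

Section Euclid.
Context (R : realType) (d : nat).
Local Notation vec := 'cV[R]_d.
Implicit Types (u v w : vec) (A B : 'M[R]_d) (V W U : {vspace vec}).
Local Notation N := (@euclid_norm R d).

Lemma dotE v w : dot v w = \sum_i v i 0 * w i 0.
Proof. by rewrite /dot mxE; apply: eq_bigr => i _; rewrite mxE. Qed.

Lemma dotC v w : dot v w = dot w v.
Proof. by rewrite !dotE; apply: eq_bigr => i _; rewrite mulrC. Qed.

Lemma dotDl u v w : dot (u + v) w = dot u w + dot v w.
Proof. by rewrite /dot linearD mulmxDl mxE. Qed.

Lemma dotZl a v w : dot (a *: v) w = a * dot v w.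
Proof. by rewrite /dot linearZ -scalemxAl mxE. Qed.

Lemma dotDr u v w : dot u (v + w) = dot u v + dot u w.
Proof. by rewrite dotC dotDl !(dotC u). Qed.

Lemma dotZr a v w : dot v (a *: w) = a * dot v w.
Proof. by rewrite dotC dotZl dotC. Qed.

Lemma dotNl v w : dot (- v) w = - dot v w.
Proof. by rewrite -scaleN1r dotZl mulN1r. Qed.

Lemma dotNr v w : dot v (- w) = - dot v w.
Proof. by rewrite dotC dotNl dotC. Qed.

Lemma dot0l v : dot 0 v = 0.
Proof. by rewrite -(scale0r v) dotZl mul0r. Qed.

Lemma dot0r v : dot v 0 = 0.
Proof. by rewrite dotC dot0l. Qed.

Lemma dot_sumr v n (F : 'I_n -> vec) :
  dot v (\sum_i F i) = \sum_i dot v (F i).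
Proof.
by elim/big_rec2: _ => [|i x y _ <-]; rewrite ?dot0r // dotDr.
Qed.

Lemma dot_mulmxr A v w : dot v (A *m w) = dot (A^T *m v) w.
Proof. by rewrite /dot trmx_mul trmxK mulmxA. Qed.

Lemma dotvv_ge0 v : 0 <= dot v v.
Proof. by rewrite dotE sumr_ge0// => i _; rewrite -expr2 sqr_ge0. Qed.

Lemma dotvv_eq0 v : (dot v v == 0) = (v == 0).
Proof.
apply/idP/eqP => [|->]; last by rewrite dot0l.
rewrite dotE psumr_eq0 => [/allP v0|i _]; last by rewrite -expr2 sqr_ge0.
apply/matrixP => i j; rewrite ord1 mxE; apply/eqP.
by have := v0 i (mem_index_enum i); rewrite /= mulf_eq0 orbb.
Qed.

Lemma euclid_norm_ge0 v : 0 <= N v. Proof. exact: sqrtr_ge0. Qed.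

Lemma sqr_euclid_norm v : N v ^+ 2 = dot v v.
Proof. by rewrite sqr_sqrtr// dotvv_ge0. Qed.

Lemma euclid_norm_eq0 v : (N v == 0) = (v == 0).
Proof. by rewrite -sqrf_eq0 sqr_euclid_norm dotvv_eq0. Qed.

Lemma euclid_norm0 : N 0 = 0.
Proof. by apply/eqP; rewrite euclid_norm_eq0. Qed.

Lemma euclid_norm_gt0 v : (0 < N v) = (v != 0).
Proof. by rewrite lt_def euclid_norm_eq0 euclid_norm_ge0 andbT. Qed.

Lemma euclid_normZ a v : N (a *: v) = `|a| * N v.
Proof.
apply/eqP; rewrite -(@eqrXn2 _ 2%N)// ?euclid_norm_ge0 ?mulr_ge0//.
  by rewrite exprMn !sqr_euclid_norm dotZl dotZr mulrA -expr2 (real_normK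
    (num_real _)).
exact: euclid_norm_ge0.
Qed.

Lemma euclid_normN v : N (- v) = N v.
Proof. by rewrite -scaleN1r euclid_normZ normrN normr1 mul1r. Qed.

Lemma euclid_distC v w : N (v - w) = N (w - v).
Proof. by rewrite -euclid_normN opprB. Qed.

Lemma cauchy_schwarz v w : `|dot v w| <= N v * N w.
Proof.
have [->|w0] := eqVneq w 0; first by rewrite dot0r normr0 euclid_norm0 mulr0.
have ww : 0 < dot w w by rewrite lt_def dotvv_eq0 w0 dotvv_ge0.
rewrite -(@ler_pXn2r _ 2%N)// ?nnegrE ?mulr_ge0 ?euclid_norm_ge0//.
rewrite exprMn !sqr_euclid_norm (real_normK (num_real _)).
have := dotvv_ge0 (dot w w *: v - dot v w *: w).
rewrite !(dotDl, dotDr, dotNl, dotNr, dotZl, dotZr) (dotC w v) => H.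
rewrite -(ler_pM2l ww) -subr_ge0; nra.
Qed.

Lemma euclid_norm_triangle v w : N (v + w) <= N v + N w.
Proof.
rewrite -(@ler_pXn2r _ 2%N)// ?nnegrE ?addr_ge0 ?euclid_norm_ge0//.
rewrite sqrrD !sqr_euclid_norm dotDl !dotDr (dotC w v).
have := le_trans (ler_norm _) (cauchy_schwarz v w); lra.
Qed.

Lemma euclid_dist_triangle u v w : N (u - w) <= N (u - v) + N (v - w).
Proof. by rewrite -(subrKA v) euclid_norm_triangle. Qed.

Lemma ler_euclid_norm v w : N v <= N w + N (v - w).
Proof. by rewrite -{1}(subrK w v) addrC euclid_norm_triangle. Qed.

Lemma norm_coord_le v i : `|v i 0| <= N v.
Proof.
rewrite -(@ler_pXn2r _ 2%N)// ?nnegrE ?euclid_norm_ge0// sqr_euclid_norm.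
rewrite dotE (bigD1 i)//= (real_normK (num_real _)) -expr2 lerDl sumr_ge0// =>
  j _.
by rewrite -expr2 sqr_ge0.
Qed.

Lemma euclid_norm_sum n (F : 'I_n -> vec) : N (\sum_i F i) <= \sum_i N (F i).
Proof.
elim/big_rec2: _ => [|i x y _ H]; first by rewrite euclid_norm0.
by apply: le_trans (euclid_norm_triangle _ _) _; rewrite lerD2l.
Qed.

Lemma euclid_norm_le_sum v : N v <= \sum_i `|v i 0|.
Proof.
have {1}-> : v = \sum_i v i 0 *: delta_mx i 0.
  by rewrite [LHS]matrix_sum_delta; apply: eq_bigr => i _; rewrite big_ord1.
apply: le_trans (euclid_norm_sum _) _; apply: ler_sum => i _.
rewrite euclid_normZ ler_piMr// /euclid_norm -[leRHS]sqrtr1 ler_sqrt//.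
rewrite dotE (bigD1 i)//= big1 => [|j ji]; rewrite !mxE ?eqxx ?mulr1 ?addr0//.
by rewrite (negbTE ji) mul0r.
Qed.

Lemma mulmx_bounded A : exists2 C, 1 <= C & forall v, N (A *m v) <= C * N v.
Proof.
exists (1 + \sum_i \sum_j `|A i j|).
  by rewrite lerDl sumr_ge0// => i _; rewrite sumr_ge0.
move=> v; apply: le_trans (euclid_norm_le_sum _) _.
rewrite mulrDl mul1r -[leLHS]add0r lerD ?euclid_norm_ge0// mulr_suml.
apply: ler_sum => i _; rewrite mxE mulr_suml.
apply: le_trans (ler_norm_sum _ _ _) _; apply: ler_sum => j _.
by rewrite normrM ler_wpM2l// norm_coord_le.
Qed.

Lemma hom_bounded (f : 'End(vec)) :
  exists2 C, 1 <= C & forall v, N (f v) <= C * N v.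
Proof.
have [C C1 HC] := mulmx_bounded (\matrix_(i, j) f (delta_mx j 0) i 0).
exists C => // v; suff -> : f v = (\matrix_(i, j) f (delta_mx j 0) i 0) *m v.
  exact: HC.
rewrite {1}[v]matrix_sum_delta linear_sum; apply/matrixP => i j.
rewrite ord1 summxE mxE; apply: eq_bigr => k _.
by rewrite big_ord1 linearZ !mxE mulrC.
Qed.

Section Angle.
Variables v w : vec.
Hypotheses (v0 : v != 0) (w0 : w != 0).

Lemma sqr_sin_angle :
  0 <= sin (angle v w) /\
  (sin (angle v w) * N v) ^+ 2 * N w ^+ 2 = (N v * N w) ^+ 2 - dot v w ^+ 2.
Proof.
have nv : 0 < N v by rewrite euclid_norm_gt0.
have nw : 0 < N w by rewrite euclid_norm_gt0.
have nvw := mulr_gt0 nv nw.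
have c1 : -1 <= dot v w / (N v * N w) <= 1.
  rewrite -ler_norml normrM normfV (gtr0_norm nvw) ler_pdivrMr// mul1r.
  exact: cauchy_schwarz.
rewrite /angle sin_acos// sqrtr_ge0 exprMn sqr_sqrtr; last first.
  by rewrite subr_ge0 -(real_normK (num_real _)) expr_le1// ler_norml.
split=> //; field.
by rewrite !gt_eqF.
Qed.

Lemma sin_angle_le_dist a : sin (angle v w) * N v <= N (v - a *: w).
Proof.
have [s0 sE] := sqr_sin_angle.
rewrite -(@ler_pXn2r _ 2%N)// ?nnegrE ?mulr_ge0 ?euclid_norm_ge0//.
have nw : 0 < N w ^+ 2 by rewrite exprn_gt0// euclid_norm_gt0.
rewrite -(ler_pM2r nw) sE exprMn !sqr_euclid_norm.
rewrite !(dotDl, dotDr, dotNl, dotNr, dotZl, dotZr) (dotC w v).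
have := sqr_ge0 (dot v w - a * dot w w); nra.
Qed.

Lemma sin_angle_dist : exists a, N (v - a *: w) = sin (angle v w) * N v.
Proof.
have [s0 sE] := sqr_sin_angle.
exists (dot v w / dot w w); apply/eqP.
rewrite -(@eqrXn2 _ 2%N)// ?mulr_ge0 ?euclid_norm_ge0//.
have nw : dot w w != 0 by rewrite dotvv_eq0.
apply/eqP/(mulIf nw); move: sE; rewrite (exprMn _ (N v)).
rewrite !sqr_euclid_norm => ->.
rewrite !(dotDl, dotDr, dotNl, dotNr, dotZl, dotZr) (dotC w v).
by field.
Qed.

Lemma sin_angle_le1 : sin (angle v w) <= 1.
Proof.
have := sin_angle_le_dist 0; rewrite scale0r subr0 ger_pMl//.
by rewrite euclid_norm_gt0.
Qed.

End Angle.

(* [grass_excess V W <= e], without trigonometry *)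
Definition subspace_within (e : R) (V W : {vspace vec}) :=
  forall v, v \in V -> exists2 w, w \in W & N (v - w) <= e * N v.

Lemma subspace_within_le e e' V W :
  e <= e' -> subspace_within e V W -> subspace_within e' V W.
Proof.
move=> ee' H v /H[w wW vw]; exists w => //; apply: le_trans vw _.
by rewrite ler_wpM2r ?euclid_norm_ge0.
Qed.

Lemma sin_angle_lb v (W : {vspace vec}) : v != 0 ->
  lbound [set sin (angle v w) | w in nonzero_vectors W] 0.
Proof. by move=> v0 _ [w [_ w0] <-]; have [] := sqr_sin_angle v0 w0. Qed.

Lemma grass_excess_le e V W :
  0 <= e -> subspace_within e V W -> grass_excess V W <= e.
Proof.
move=> e0 VW; rewrite /grass_excess.
(* If V = 0 the supremum is over the empty set, hence 0; likewise for the infimum below when W =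
   0. *)
have [->|/set0P V0] := eqVneq (nonzero_vectors V) set0.
  by rewrite image_set0 sup0.
apply: ge_sup; first by case: V0 => v Vv; eexists; exists v.
move=> _ [v [vV v0] <-].
have nv : 0 < N v by rewrite euclid_norm_gt0.
have [->|/set0P[w' [w'W w'0]]] := eqVneq (nonzero_vectors W) set0.
  by rewrite image_set0 inf0.
have [w wW vw] := VW v vV.
(* For w = 0 the bound reads N v <= e * N v, so e >= 1, and every sine is at most 1. *)
have [w0|w0] := eqVneq w 0.
  apply: (@le_trans _ _ (sin (angle v w'))).
    by apply: ge_inf; [exists 0; exact: sin_angle_lb|exists w'].
  apply: le_trans (sin_angle_le1 v0 w'0) _.
  by move: vw; rewrite w0 subr0 ler_pMl.
apply: (@le_trans _ _ (sin (angle v w))).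
  by apply: ge_inf; [exists 0; exact: sin_angle_lb|exists w].
rewrite -(ler_pM2r nv); apply: le_trans (sin_angle_le_dist v0 w0 1) _.
by rewrite scale1r.
Qed.

(** For W = 0 the infimum over the empty set is 0 and a small excess says nothing, whence the
    condition on the dimension. The strict inequality provides a near-minimiser, so that no infimum
    has to be attained. *)
Lemma grass_excess_lt e V W : (0 < \dim W)%N ->
  grass_excess V W < e -> subspace_within e V W.
Proof.
move=> W0 VW v vV; have [->|v0] := eqVneq v 0.
  by exists 0; rewrite ?mem0v// subr0 euclid_norm0 mulr0.
have [w' w'W w'0] : exists2 w', w' \in W & w' != 0.
  by exists (vpick W); rewrite ?memv_pick ?vpick0 -?dimv_eq0 -?lt0n.
have : inf [set sin (angle v w) | w in nonzero_vectors W] < e.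
  apply: le_lt_trans VW; apply: ub_le_sup; last by exists v.
  exists 1 => _ [u [uV u0] <-]; apply: le_trans (sin_angle_le1 u0 w'0).
  by apply: ge_inf; [exists 0; exact: sin_angle_lb|exists w'].
move=> /inf_lt[|_ [w [wW w0] <-] we].
  by exists (sin (angle v w')), w'.
have [a aE] := sin_angle_dist v0 w0.
exists (a *: w); first exact: memvZ.
by rewrite aE ler_wpM2r ?euclid_norm_ge0// ltW.
Qed.

Lemma grass_dist_ge0 V W : 0 <= grass_dist V W.
Proof.
have excess_ge0 V' W' : 0 <= @grass_excess R d V' W'.
  rewrite /grass_excess.
  have [->|/set0P[v Vv]] := eqVneq (nonzero_vectors V') set0.
    by rewrite image_set0 sup0.
  have inf_ge0 u : u != 0 ->
      0 <= inf [set sin (angle u w) | w in nonzero_vectors W'].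
    move=> u0; have [->|/set0P[w W'w]] := eqVneq (nonzero_vectors W') set0.
      by rewrite image_set0 inf0.
    apply: lb_le_inf; first by eexists; exists w.
    exact: sin_angle_lb.
  apply: le_trans (inf_ge0 _ Vv.2) _; apply: ub_le_sup; last by exists v.
  exists 1 => _ [u [uV u0] <-].
  have [->|/set0P[w [wW w0]]] := eqVneq (nonzero_vectors W') set0.
    by rewrite image_set0 inf0.
  apply: le_trans (sin_angle_le1 u0 w0).
  by apply: ge_inf; [exists 0; exact: sin_angle_lb|exists w].
by rewrite /grass_dist le_max excess_ge0.
Qed.

Lemma grass_dist_le e V W : 0 <= e ->
  subspace_within e V W -> subspace_within e W V -> grass_dist V W <= e.
Proof. by move=> e0 VW WV; rewrite /grass_dist ge_max !grass_excess_le. Qed.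

Lemma grass_dist_lt e V W : (0 < \dim V)%N -> (0 < \dim W)%N ->
  grass_dist V W < e -> subspace_within e V W /\ subspace_within e W V.
Proof.
by move=> V0 W0; rewrite /grass_dist gt_max => /andP[? ?];
   split; exact: grass_excess_lt.
Qed.

Lemma grass_distxx V : @grass_dist R d V V = 0.
Proof.
apply/eqP; rewrite eq_le grass_dist_ge0 andbT.
by apply: grass_dist_le => // v vV; exists v;
  rewrite // subrr euclid_norm0 mul0r.
Qed.

Lemma grass_dist_le1 V W : @grass_dist R d V W <= 1.
Proof.
by apply: grass_dist_le => // v _; exists 0; rewrite ?mem0v// subr0 mul1r.
Qed.

Lemma subspace_within_trans e e' V W U : 0 <= e -> 0 <= e' ->
  subspace_within e V W -> subspace_within e' W U ->
  subspace_within (e + e' * (1 + e)) V U.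
Proof.
move=> e0 e'0 VW WU v /VW[w wW vw]; have [u uU wu] := WU w wW.
exists u => //; apply: le_trans (euclid_dist_triangle _ w _) _.
rewrite mulrDl lerD//; apply: le_trans wu _; rewrite -mulrA ler_wpM2l//.
apply: le_trans (ler_euclid_norm w v) _.
by rewrite euclid_distC mulrDl mul1r lerD2l.
Qed.

End Euclid.

(** * Limits of vectors along ultrafilters, and eigenvectors of symmetric matrices *)

Section Orthonormal.
Context (R : realType) (d : nat).
Local Notation vec := 'cV[R]_d.
Implicit Types (u v w : vec) (A B : 'M[R]_d) (V W U : {vspace vec}).
Local Notation N := (@euclid_norm R d).

(** W is the kernel of [L], one minus a projection onto W, and [L] is bounded. *)
Lemma mem_closed_subspace W v :
  (forall e, 0 < e -> exists2 w, w \in W & N (v - w) <= e) -> v \in W.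
Proof.
move=> H; pose L := (\1 - projv W)%VF.
have [C C1 HC] := hom_bounded L.
have LE u : L u = u - projv W u by rewrite add_lfunE opp_lfunE id_lfunE.
suff : L v = 0.
  by rewrite LE => /eqP; rewrite subr_eq0 => /eqP ->; exact: memv_proj.
apply/eqP; rewrite -euclid_norm_eq0 eq_le euclid_norm_ge0 andbT.
apply/ler_addgt0Pl => e e0; rewrite addr0.
have C0 : 0 < C by apply: lt_le_trans C1.
have [w wW vw] := H (e / C) (divr_gt0 e0 C0).
have <- : L (v - w) = L v by rewrite linearB/= (LE w) projv_id// subrr subr0.
by apply: le_trans (HC _) _; rewrite mulrC -ler_pdivlMr.
Qed.

Lemma exists_orthogonal V m (q : nat -> vec) : (m < \dim V)%N ->
  exists v, [/\ v \in V, v != 0 & forall i, (i < m)%N -> dot (q i) v = 0].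
Proof.
move=> mV; pose M := \matrix_(i < m, j < d) q i j 0.
pose f : 'Hom(vec, 'cV[R]_m) := linfun (mulmx M : vec -> 'cV[R]_m).
have fE v i : f v i 0 = dot (q i) v.
  by rewrite lfunE/= mxE dotE; apply: eq_bigr => j _; rewrite mxE.
have : (V :&: lker f)%VS != 0%VS.
  rewrite -dimv_eq0 -lt0n -(ltn_add2r (\dim (f @: V))) limg_ker_dim add0n.
  apply: leq_trans mV; rewrite ltnS; apply: leq_trans (dimvS (subvf _)) _.
  by rewrite dimvf dim_matrix mulr1.
rewrite -vpick0; set v := vpick _ => v0.
have /memv_capP[vV vf] : v \in (V :&: lker f)%VS by rewrite memv_pick.
exists v; split=> // i im; rewrite -(fE v (Ordinal im)).
by move: vf; rewrite memv_ker => /eqP ->; rewrite mxE.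
Qed.

Section Limits.
Context (I : Type) (F : set_system I).

Definition vec_cvg (v : I -> vec) w :=
  forall e, 0 < e -> F [set i | N (v i - w) <= e].

(** Compactness of the segment gives a cluster point, and it is a limit because an ultrafilter
    contains every set or its complement. *)
Lemma ultra_real_cvg (FU : UltraFilter F) (f : I -> R) (B : R) :
  F [set i | `|f i| <= B] ->
  exists l, forall e, 0 < e -> F [set i | `|f i - l| <= e].
Proof.
move=> fB; have FF : ProperFilter F by exact: ultra_proper.
have [l [_ cl]] : exists l, (`[-B, B]%classic `&` cluster (f @ F)) l.
  apply: (@segment_compact R (- B) B (f @ F) _).
  by apply: (@filterS _ F _ _ _ _ fB) => i /=; rewrite in_itv/= -ler_norml.
exists l => e e0; case: (in_ultra_setVsetC [set i | `|f i - l| <= e] FU) => //.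
move=> H; have : (f @ F) [set y | e < `|y - l|].
  by apply: (@filterS _ F _ _ _ _ H) => i /= /negP; rewrite -ltNge.
move=> /cl/(_ (nbhsx_ballx l e e0))[y [/=]].
by rewrite /ball/= distrC => /lt_trans h /h; rewrite ltxx.
Qed.

Lemma ultra_vec_cvg (FU : UltraFilter F) (v : I -> vec) (B : R) :
  F [set i | N (v i) <= B] -> exists w, vec_cvg v w.
Proof.
move=> vB; have FF : ProperFilter F by exact: ultra_proper.
have H (j : 'I_d) : exists l, forall e,
  0 < e -> F [set i | `|v i j 0 - l| <= e].
  apply: (@ultra_real_cvg FU _ B); apply: filterS vB => i /=.
  exact: le_trans (norm_coord_le _ _).
have [w wP] := choice H; exists (\col_j w j) => e e0.
have e1 : 0 < e / d.+1%:R by rewrite divr_gt0.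
have : F [set i | forall j, `|v i j 0 - w j| <= e / d.+1%:R].
  exact: (@filter_forall _ _
    (fun j i => `|v i j 0 - w j| <= e / d.+1%:R) F _ (fun j => wP j _ e1)).
apply: filterS => i /= Hi; apply: le_trans (euclid_norm_le_sum _) _.
apply: (@le_trans _ _ (\sum_(j < d) (e / d.+1%:R))).
  by apply: ler_sum => j _; rewrite !mxE.
rewrite sumr_const card_ord -[leLHS]mulr_natr -mulrA ger_pMr//.
by rewrite ler_pdivrMl// mulr1 ler_nat.
Qed.

Context {FF : ProperFilter F}.

Lemma vec_cvg_le (v v' : I -> vec) w :
  vec_cvg v w -> (forall e, 0 < e -> F [set i | N (v' i - v i) <= e]) ->
  vec_cvg v' w.
Proof.
move=> vw vv e e0; have e2 : 0 < e / 2 by rewrite divr_gt0.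
apply: filterS2 (vw _ e2) (vv _ e2) => i /= h1 h2.
apply: le_trans (euclid_dist_triangle _ (v i) _) _.
by rewrite [leRHS]splitr lerD.
Qed.

Lemma vec_cvgD (v v' : I -> vec) w w' :
  vec_cvg v w -> vec_cvg v' w' -> vec_cvg (fun i => v i + v' i) (w + w').
Proof.
move=> vw vw' e e0; have e2 : 0 < e / 2 by rewrite divr_gt0.
apply: filterS2 (vw _ e2) (vw' _ e2) => i /= h1 h2.
rewrite opprD addrACA [leRHS]splitr.
by apply: le_trans (euclid_norm_triangle _ _) (lerD h1 h2).
Qed.

Lemma vec_cvgN (v : I -> vec) w : vec_cvg v w -> vec_cvg (fun i => - v i) (- w).
Proof.
move=> vw e e0; apply: filterS (vw _ e0) => i /=.
by rewrite -opprD euclid_normN.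
Qed.

Lemma vec_cvg_norm (v : I -> vec) w a :
  vec_cvg v w -> F [set i | N (v i) = a] -> N w = a.
Proof.
move=> vw va; apply/eqP; rewrite -subr_eq0 -normr_eq0 eq_le normr_ge0 andbT.
apply/ler_addgt0Pl => e e0; rewrite addr0.
have [i /= [h <-]] := filter_ex (filterI (vw _ e0) va).
have := ler_euclid_norm (v i) w; have := ler_euclid_norm w (v i).
by rewrite (euclid_distC w) ler_norml => *; apply/andP; split; lra.
Qed.

(** The bound B turns the relative error of [subspace_within] into an absolute one, so membership
    survives although the subspace varies. *)
Lemma vec_cvg_mem (v : I -> vec) w (V : I -> {vspace vec}) W (B : R) :
  vec_cvg v w -> F [set i | v i \in V i] -> F [set i | N (v i) <= B] ->
  (forall e, 0 < e -> F [set i | subspace_within e (V i) W]) -> w \in W.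
Proof.
move=> vw vV vB VW; apply: mem_closed_subspace => e e0.
have e2 : 0 < e / 2 by rewrite divr_gt0.
have B1 : 0 < `|B| + 1 by rewrite ltr_wpDl.
have [i /= [[[h1 h2] h3] h4]] := filter_ex (filterI (filterI (filterI
  (vw _ e2) vV) vB) (VW _ (divr_gt0 e2 B1))).
have [u uW vu] := h4 _ h2; exists u => //.
apply: le_trans (euclid_dist_triangle _ (v i) _) _.
rewrite [leRHS]splitr lerD//; first by rewrite euclid_distC.
apply: le_trans vu _; rewrite mulrAC ler_pdivrMr// ler_pM2l//.
by apply: le_trans h3 _; apply: le_trans (ler_norm _) _; rewrite lerDl.
Qed.

End Limits.

(** Variational construction: an ultralimit of near-maximisers of the quadratic form on the unit
    sphere of W attains the supremum, and a maximiser is an eigenvector. *)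
Lemma sym_max_eigenvector (S : 'M[R]_d) W :
  S^T = S -> (0 < \dim W)%N -> (forall v, v \in W -> S *m v \in W) ->
  exists v l, [/\ v \in W, dot v v = 1, S *m v = l *: v &
    forall u, u \in W -> dot u (S *m u) <= l * dot u u].
Proof.
move=> St W0 SW; pose f u := dot u (S *m u).
have [C C1 HC] := mulmx_bounded S.
pose E := [set f u | u in [set u | u \in W /\ N u = 1]].
have supE : has_sup E.
  split.
    pose u := vpick W; have u0 : u != 0 by rewrite vpick0 -dimv_eq0 -lt0n.
    exists (f ((N u)^-1 *: u)); exists ((N u)^-1 *: u) => //; split.
      by rewrite memvZ ?memv_pick.
    rewrite euclid_normZ ger0_norm ?invr_ge0 ?euclid_norm_ge0//.
    by rewrite mulVf// euclid_norm_eq0.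
  exists C => _ [u [_ u1] <-]; apply: le_trans (ler_norm _) _.
  apply: le_trans (cauchy_schwarz _ _) _; rewrite u1 mul1r.
  by apply: le_trans (HC _) _; rewrite u1 mulr1.
pose l := sup E.
have Hl u : u \in W -> f u <= l * dot u u.
  move=> uW; have [->|u0] := eqVneq u 0; first by rewrite /f !dot0l mulr0.
  have nu : 0 < N u by rewrite euclid_norm_gt0.
  have : f ((N u)^-1 *: u) <= l.
    apply: ub_le_sup; first exact: supE.2.
    exists ((N u)^-1 *: u) => //; split; first by rewrite memvZ.
    by rewrite euclid_normZ gtr0_norm ?invr_gt0// mulVf// gt_eqF.
  rewrite /f -scalemxAr dotZl dotZr mulrA -expr2 exprVn sqr_euclid_norm.
  by rewrite ler_pdivrMl -?sqr_euclid_norm ?exprn_gt0// mulrC.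
have Hn n : exists u, [/\ u \in W, N u = 1 & l - n.+1%:R^-1 < f u].
  have [|_ [u [uW u1] <-] h] := @sup_adherent R E n.+1%:R^-1 _ supE.
    by rewrite invr_gt0.
  by exists u.
have [u uP] := choice Hn.
have [F [FU oF]] := ultraFilterLemma eventually_filter.
have FF : ProperFilter F by exact: ultra_proper.
have [v uv] : exists v, vec_cvg F u v.
  apply: (@ultra_vec_cvg _ _ _ _ 1); apply: filterS filterT => n _ /=.
  by have [_ ->] := uP n.
have vW : v \in W.
  apply: (@vec_cvg_mem _ F _ u v (fun=> W) W 1 uv).
  - by apply: filterS filterT => n _ /=; have [] := uP n.
  - by apply: filterS filterT => n _ /=; have [_ ->] := uP n.
  - move=> e e0; apply: filterS filterT => n _ w wW; exists w => //.
    by rewrite subrr euclid_norm0 mulr_ge0 ?euclid_norm_ge0// ltW.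
have v1 : N v = 1.
  apply: (vec_cvg_norm uv); apply: filterS filterT => n _ /=.
  by have [_ ->] := uP n.
have vv : dot v v = 1 by rewrite -sqr_euclid_norm v1 expr1n.
have fv : f v = l.
  apply/eqP; rewrite eq_le; apply/andP; split.
    by have := Hl v vW; rewrite vv mulr1.
  suff H (e : R) : 0 < e -> l <= e + f v by apply/ler_addgt0Pl.
  move=> e0.
  have e1 : 0 < e / (4 * C) by rewrite divr_gt0// mulr_gt0// (lt_le_trans _ C1).
  have : F [set n | n.+1%:R^-1 < e / 2].
    apply: oF; have := near_infty_natSinv_lt (PosNum (divr_gt0 e0 (ltr0Sn R
      1))).
    by [].
  move=> /(filterI (uv _ e1)) /filter_ex[n /= [h1 h2]].
  have [_ un1 /ltW h] := uP n.
  have -> : f v = f (u n) + (dot (v - u n) (S *m v) + dot (u n) (S *m (v - u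
    n))).
    by rewrite /f mulmxBr !(dotDl, dotDr, dotNl, dotNr); ring.
  have : `|dot (v - u n) (S *m v)| <= e / 4.
    apply: le_trans (cauchy_schwarz _ _) _.
    apply: (@le_trans _ _ (e / (4 * C) * C)).
      rewrite ler_pM ?euclid_norm_ge0// 1?euclid_distC//.
      by apply: le_trans (HC _) _; rewrite v1 mulr1.
    by rewrite invfM mulrA -mulrA mulVf ?mulr1// gt_eqF// (lt_le_trans _ C1).
  have : `|dot (u n) (S *m (v - u n))| <= e / 4.
    apply: le_trans (cauchy_schwarz _ _) _; rewrite un1 mul1r.
    apply: le_trans (HC _) _.
    apply: (@le_trans _ _ (C * (e / (4 * C)))).
      by rewrite ler_pM2l ?(lt_le_trans _ C1)// euclid_distC.
    by rewrite invfM mulrCA (mulrC C) mulfVK// gt_eqF// (lt_le_trans _ C1).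
  rewrite !ler_norml => /andP[k1 _] /andP[k2 _]. 
  by move: (n.+1%:R^-1) h h2 => ? ? ?; lra.
(* First variation: along v + t u' the form stays below l times the squared norm, with equality at t
   = 0, so the term linear in t vanishes. *)
have Sv u' : u' \in W -> dot u' v = 0 -> dot u' (S *m v) = 0.
  move=> u'W u'v; set a := dot u' _.
  have key t : 2 * t * a <= t ^+ 2 * (l * dot u' u' - f u').
    have := Hl (v + t *: u') (memvD vW (memvZ t u'W)).
    rewrite /f mulmxDr -scalemxAr !(dotDl, dotDr, dotZl,
      dotZr) -/(f v) -/(f u').
    rewrite fv vv (dotC v u') u'v.
    have -> : dot v (S *m u') = a by rewrite dot_mulmxr St dotC.
    rewrite -/a; nra.
  set c := l * _ - _ in key.
  have c0 : 0 <= c by rewrite subr_ge0; exact: Hl.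
  apply/eqP/negP => /negP a0.
  (* This value of t reduces [key] to 2 (c + 1) <= c; the summand 1 covers c = 0. *)
  have := key (a / (c + 1)).
  have c1 : c + 1 != 0 by rewrite gt_eqF// ltr_wpDl.
  have -> : 2 * (a / (c + 1)) * a = (a / (c + 1)) ^+ 2 * (2 * (c + 1)) by field.
  have : 0 < (a / (c + 1)) ^+ 2.
    by rewrite exprn_even_gt0//= mulf_neq0// invr_eq0.
  nra.
(* The residue S v - l v lies in W and is orthogonal to v, hence by [Sv] to S v, hence to itself. *)
exists v, l; split=> //; apply/eqP; rewrite -subr_eq0 -dotvv_eq0.
have xW : S *m v - l *: v \in W by rewrite memvB ?SW// memvZ.
have xv : dot (S *m v - l *: v) v = 0.
  by rewrite dotDl dotNl dotZl vv mulr1 dotC -/(f v) fv subrr.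
rewrite [X in dot _ X]/GRing.add/= dotDr (Sv _ xW xv) dotNr dotZr xv.
by rewrite mulr0 subr0.
Qed.

End Orthonormal.

(** * Singular values *)

Section SVD.
Context (R : realType) (d : nat).
Local Notation vec := 'cV[R]_d.
Implicit Types (u v w : vec) (A B : 'M[R]_d) (V W U : {vspace vec}).
Local Notation N := (@euclid_norm R d).

Definition orthonormal m (q : nat -> vec) :=
  forall i j, (i < m)%N -> (j < m)%N -> dot (q i) (q j) = (i == j)%:R.

Lemma orthonormal_expand q v : orthonormal d q ->
  v = \sum_(i < d) dot (q i) v *: q i.
Proof.
move=> qo; pose Q := \matrix_(i < d, j < d) q j i 0.
have QQ : Q^T *m Q = 1%:M.
  apply/matrixP => i j; rewrite !mxE -(qo i j)// dotE.
  by apply: eq_bigr => k _; rewrite !mxE.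
rewrite -[LHS]mul1mx -(mulmx1C QQ) -mulmxA; apply/matrixP => i j.
rewrite ord1 mxE summxE; apply: eq_bigr => k _.
by rewrite !mxE mulrC dotE; congr (_ * _); apply: eq_bigr => l _; rewrite !mxE.
Qed.

Lemma orthonormal_dot q v w : orthonormal d q ->
  dot v w = \sum_(i < d) dot (q i) v * dot (q i) w.
Proof.
move=> qo; rewrite {1}(orthonormal_expand w qo) dot_sumr.
by apply: eq_bigr => i _; rewrite dotZr mulrC (dotC v).
Qed.

Lemma orthonormal_norm q v : orthonormal d q ->
  N v ^+ 2 = \sum_(i < d) dot (q i) v ^+ 2.
Proof. by move=> qo; rewrite sqr_euclid_norm (orthonormal_dot _ _ qo). Qed.

(** Induction on m: the next eigenvector maximises the form on the orthogonal complement of the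
    previous ones, which S preserves by symmetry. The third clause later yields the monotonicity of
    the eigenvalues. *)
Lemma spectral_family (S : 'M[R]_d) : S^T = S -> forall m, (m <= d)%N ->
  exists (q : nat -> vec) (l : nat -> R),
  [/\ orthonormal m q, forall i, (i < m)%N -> S *m q i = l i *: q i &
      forall i u, (i < m)%N -> (forall j, (j < i)%N -> dot (q j) u = 0) ->
        dot u (S *m u) <= l i * dot u u].
Proof.
move=> St; elim=> [_|m IH md]; first by exists (fun=> 0), (fun=> 0); split.
have [q [l [qo Sq lmax]]] := IH (ltnW md).
pose M := \matrix_(i < m, j < d) q i j 0.
pose W := lker (linfun (mulmx M : vec -> 'cV[R]_m)).
have memW v : (v \in W) = [forall i : 'I_m, dot (q i) v == 0].
  rewrite memv_ker lfunE/=; apply/eqP/forallP => [Mv i|H].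
    have := congr1 (fun x : 'cV_m => x i 0) Mv; rewrite !mxE => Mvi.
    rewrite dotE -[X in _ == X]Mvi; apply/eqP/eq_bigr => j _.
    by rewrite !mxE.
  apply/matrixP => i j; rewrite ord1 [RHS]mxE -[RHS](eqP (H i)) mxE dotE.
  by apply: eq_bigr => k _; rewrite !mxE.
have W0 : (0 < \dim W)%N.
  have [|v [_ v0 vq]] := @exists_orthogonal R d fullv m q.
    by rewrite dimvf dim_matrix mulr1.
  rewrite lt0n dimv_eq0; apply: contra_neq v0 => W0.
  by apply/eqP; rewrite -memv0 -W0 memW; apply/forallP => i; rewrite vq.
have SW v : v \in W -> S *m v \in W.
  rewrite !memW => /forallP vW; apply/forallP => i.
  by rewrite dot_mulmxr St Sq// dotZl (eqP (vW i)) mulr0.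
have [v [c [vW vv Sv cmax]]] := sym_max_eigenvector St W0 SW.
have qv i : (i < m)%N -> dot (q i) v = 0.
  by move=> im; move: vW; rewrite memW => /forallP/(_ (Ordinal im))/eqP.
exists (fun i => if (i < m)%N then q i else v).
exists (fun i => if (i < m)%N then l i else c); split.
- move=> i j; rewrite !ltnS; case: ltnP => im; case: ltnP => jm ile jle.
  + exact: qo.
  + by rewrite qv// ltn_eqF// (leq_trans im).
  + by rewrite dotC qv// gtn_eqF// (leq_trans jm).
  + have -> : i = j by apply/eqP;
    rewrite eqn_leq (leq_trans ile)// (leq_trans jle).
    by rewrite eqxx.
- by move=> i _; case: ltnP => // im; exact: Sq.
- move=> i u im1; case: ltnP => im uq.
    apply: lmax => // j ji; have := uq j ji.
    by rewrite (ltn_trans ji im).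
  apply: cmax; rewrite memW; apply/forallP => j.
  by have := uq j (leq_trans (ltn_ord j) im); rewrite ltn_ord => ->.
Qed.

Lemma char_poly_orthonormal (B : 'M[R]_d) q (s : nat -> R) :
  orthonormal d q -> (forall i, (i < d)%N -> B *m q i = s i *: q i) ->
  char_poly B = \prod_(i < d) ('X - (s i)%:P).
Proof.
move=> qo Bq; pose Q := \matrix_(i < d, j < d) q j i 0.
pose D := diag_mx (\row_(i < d) s i).
have QQ : Q^T *m Q = 1%:M.
  apply/matrixP => i j; rewrite !mxE -(qo i j)// dotE.
  by apply: eq_bigr => k _; rewrite !mxE.
have BQ : B *m Q = Q *m D.
  apply/matrixP => i j; have := congr1 (fun x : vec => x i 0) (Bq j (ltn_ord
    j)).
  rewrite mul_mx_diag !mxE mulrC => <-.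
  by apply: eq_bigr => k _; rewrite !mxE.
have -> : char_poly B = char_poly D.
  have dQ : \det (map_mx polyC Q) != 0 :> {poly R}.
    have := congr1 determinant QQ.
    rewrite det_mulmx det1 det_tr det_map_mx polyC_eq0 => h.
    by apply: contra_eq_neq h => ->; rewrite mulr0 eq_sym oner_eq0.
  apply: (mulIf dQ); rewrite /char_poly [RHS]mulrC -!det_mulmx.
  congr (\det _).
  by rewrite /char_poly_mx mulmxBl mulmxBr -!map_mxM BQ scalar_mxC.
rewrite char_poly_trig ?diag_mx_is_trig//.
by apply: eq_bigr => i _; rewrite !mxE eqxx mulr1n.
Qed.

(** [abs_mx] and [singular_values] are chosen by [xget]: a square root and a sorted spectrum must be
    exhibited, and every admissible choice shown to have the eigenbasis q with eigenvalues s. *)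
Lemma svd A : A \in unitmx -> exists (q : nat -> vec) (s : nat -> R),
  [/\ orthonormal d q,
      forall i, (i < d)%N -> 0 < s i,
      forall i j, (i <= j < d)%N -> s j <= s i,
      forall i, (i < d)%N -> abs_mx A *m q i = s i *: q i /\
        forall v, dot (q i) (abs_mx A *m v) = s i * dot (q i) v &
      (forall i, (i < d)%N -> sigma i.+1 A = s i) /\
      forall v, N (invmx A *m v) ^+ 2 = \sum_(i < d) (dot (q i) v / s i) ^+ 2].
Proof.
move=> Au; have St : (A *m A^T)^T = A *m A^T by rewrite trmx_mul trmxK.
have [q [l [qo Sq lmax]]] := spectral_family St (leqnn d).
pose s i := Num.sqrt (l i).
have q0 i : (i < d)%N -> q i != 0.
  by move=> ltid; rewrite -dotvv_eq0 qo// eqxx oner_eq0.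
have l0 i : (i < d)%N -> 0 < l i.
  move=> ltid; have : dot (q i) (A *m A^T *m q i) = l i.
    by rewrite Sq// dotZr qo// eqxx mulr1.
  rewrite -mulmxA dot_mulmxr => <-; rewrite lt_def dotvv_ge0 dotvv_eq0 andbT.
  apply: contra_neq (q0 i ltid) => Aq.
  by rewrite -[LHS](@mulKmx _ _ _ A^T) ?unitmx_tr// Aq mulmx0.
have s0 i : (i < d)%N -> 0 < s i by move=> ltid; rewrite sqrtr_gt0 l0.
have sE i : (i < d)%N -> s i ^+ 2 = l i by move=> ltid;
  rewrite sqr_sqrtr// ltW// l0.
have sdec i j : (i <= j < d)%N -> s j <= s i.
  move=> /andP[ij jd]; have ltid := leq_ltn_trans ij jd.
  rewrite ler_wsqrtr//.
  have := @lmax i (q j) ltid; rewrite Sq// dotZr qo// eqxx !mulr1; apply.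
  by move=> k ki; rewrite qo ?(ltn_eqF (leq_trans ki ij))// (ltn_trans ki).
(* B multiplies [u] by the negative number - s i, which positivity allows only for u = 0. *)
have sqrtP (B : 'M[R]_d) : B^T = B -> (forall v, 0 <= dot v (B *m v)) ->
    B *m B = A *m A^T -> forall i, (i < d)%N -> B *m q i = s i *: q i.
  move=> Bt B0 BB i ltid; pose u := B *m q i - s i *: q i.
  have Bu : B *m u = - s i *: u.
    rewrite /u mulmxBr mulmxA BB Sq// -scalemxAr -sE// expr2 -scalerA.
    by rewrite -scalerBr scaleNr -scalerN opprB.
  have := B0 u; rewrite Bu dotZr mulNr oppr_ge0 pmulr_rle0 ?s0// => u0.
  apply/eqP; rewrite -subr_eq0 -/u -dotvv_eq0.
  by rewrite eq_le u0 dotvv_ge0.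
have absP : [/\ (abs_mx A)^T = abs_mx A, forall v, 0 <= dot v (abs_mx A *m v) &
    abs_mx A *m abs_mx A = A *m A^T].
  suff : exists B : 'M[R]_d, [/\ B^T = B, forall v, 0 <= dot v (B *m v) &
    B *m B = A *m A^T] by exact: (@xgetPex _ (0 : 'M[R]_d)).
  pose Q := \matrix_(i < d, j < d) q j i 0.
  pose D := diag_mx (\row_(i < d) s i).
  have QQ : Q^T *m Q = 1%:M.
    apply/matrixP => i j; rewrite !mxE -(qo i j)// dotE.
    by apply: eq_bigr => k _; rewrite !mxE.
  have Bq i : (i < d)%N -> (Q *m D *m Q^T) *m q i = s i *: q i.
    move=> ltid; pose i' := Ordinal ltid.
    have -> : q i = Q *m delta_mx i' 0.
      by rewrite -colE; apply/matrixP => k j; rewrite ord1 !mxE.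
    rewrite -!mulmxA (mulmxA Q^T) QQ mul1mx scalemxAr; congr (_ *m _).
    apply/matrixP => k j; rewrite mul_diag_mx !mxE.
    by have [->|ki] := eqVneq k i'; rewrite //= !mulr0.
  have Bt : (Q *m D *m Q^T)^T = Q *m D *m Q^T.
    by rewrite !trmx_mul trmxK tr_diag_mx mulmxA.
  exists (Q *m D *m Q^T); split=> //.
    move=> v; rewrite (orthonormal_dot _ _ qo) sumr_ge0// => i _.
    rewrite (dot_mulmxr _ (q i)) Bt Bq// dotZl mulrCA mulr_ge0 ?(ltW (s0 _
      _))//.
    by rewrite -expr2 sqr_ge0.
  have ext (B B' : 'M[R]_d) : (forall v, B *m v = B' *m v) -> B = B'.
    move=> H; apply/matrixP => i j.
    have := congr1 (fun x : vec => x i 0) (H (delta_mx j 0)).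
    by rewrite -!colE !mxE.
  apply: ext => v; rewrite (orthonormal_expand v qo) !mulmx_sumr.
  apply: eq_bigr => i _; rewrite -!scalemxAr Sq// -sE//; congr (_ *: _).
  by rewrite -[_ *m _ *m q i]mulmxA Bq// -scalemxAr Bq// scalerA -expr2.
have absq i : (i < d)%N -> abs_mx A *m q i = s i *: q i.
  by case: absP => ? ? ?; exact: sqrtP.
have absT : (abs_mx A)^T = abs_mx A by case: absP.
exists q, s; split=> //.
  by move=> i ltid; split=> [|v]; rewrite ?dot_mulmxr ?absT ?absq// dotZl.
split=> [i ltid|v].
  rewrite /sigma; have -> : singular_values A = mkseq s d.
    have sS : sorted >=%R (mkseq s d).
      apply/(sortedP 0) => j; rewrite size_mkseq => jd.
      by rewrite !nth_mkseq ?(ltnW jd)//=; apply: sdec; rewrite leqnSn.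
    have cS : char_poly (abs_mx A) = \prod_(x <- mkseq s d) ('X - x%:P).
      rewrite (char_poly_orthonormal qo absq) big_map.
      by rewrite -(big_mkord xpredT (fun i => 'X - (s i)%:P)) /index_iota subn0.
    apply: xget_unique => // t [ts tE]; apply: (@sorted_eq _ >=%R) => //.
    - by move=> x y z /= yx xz; exact: le_trans xz yx.
    - by move=> x y /= /andP[? ?]; apply/eqP; rewrite eq_le; apply/andP.
    - by apply: prod_XsubC_eq; rewrite -tE cS.
  by rewrite nth_mkseq.
(* The [p i] are the right singular vectors; A^-1 v has coordinate dot (q i) v / s i along [p i]. *)
set z := invmx A *m v; pose p i := (s i)^-1 *: (A^T *m q i).
have po : orthonormal d p.
  move=> i j ltid jd; rewrite dotZl dotZr -dot_mulmxr mulmxA Sq// dotZr qo//.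
  have [->|ij] := eqVneq i j; last by rewrite !mulr0.
  by rewrite -sE//; field; rewrite gt_eqF ?s0.
rewrite (orthonormal_norm _ po); apply: eq_bigr => i _.
by rewrite dotZl -dot_mulmxr mulKVmx// mulrC.
Qed.

(* The minimax principle for the quadratic form [v |-> |A^-1 v|^2], whose
   eigenvalues are the inverse squares of the singular values of A. *)
Lemma singular_gap A k (E F : {vspace vec}) (eta : R) :
  A \in unitmx -> (1 <= k <= d.-1)%N -> \dim E = k -> \dim F = (d - k)%N ->
  0 <= eta <= 2^-1 ->
  (forall e f, e \in E -> f \in F ->
     N (invmx A *m e) * N f <= eta * (N (invmx A *m f) * N e)) ->
  [/\ sigma k.+1 A < sigma k A, subspace_within eta E (Uk k A) &
      subspace_within (2 * eta) (Uk k A) E].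
Proof.
move=> Au kd dE dF eta01 EF.
have [q [s [qo s0 sdec absq [sigE qE]]]] := svd Au.
have kltd : (k < d)%N by lia.
have k1d : (k.-1 < d)%N by lia.
have sk1 : sigma k A = s k.-1 by rewrite -sigE//; congr (sigma _ A); lia.
have sk : sigma k.+1 A = s k by rewrite sigE.
pose c v i := dot (q i) v.
have cs v m i : (m < d)%N -> (i < d)%N -> (c v i / s m) ^+ 2 = c v i ^+ 2 / s m
  ^+ 2.
  by move=> *; rewrite exprMn exprVn.
have sV i j : (i <= j < d)%N -> (s i ^+ 2)^-1 <= (s j ^+ 2)^-1.
  move=> ij; have := sdec _ _ ij; move: ij => /andP[ij jd] sij.
  have id := leq_ltn_trans ij jd.
  by rewrite lef_pV2 ?posrE ?exprn_gt0 ?s0// lerXn2r// nnegrE ltW ?s0.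
have normE v m : (m < d)%N -> (N v / s m) ^+ 2 = \sum_(i < d) (c v i / s m) ^+
  2.
  move=> md; rewrite exprMn (orthonormal_norm _ qo) mulr_suml.
  by apply: eq_bigr => i _; rewrite exprMn.
have qlb m v : (m < d)%N -> (forall i, (i < m)%N -> dot (q i) v = 0) ->
    N v / s m <= N (invmx A *m v).
  move=> md vq; rewrite -(@ler_pXn2r _ 2%N)// ?nnegrE ?euclid_norm_ge0//;
    last first.
    by rewrite divr_ge0 ?euclid_norm_ge0// ltW ?s0.
  rewrite normE// qE; apply: ler_sum => i _; rewrite -/(c v i) !cs//.
  have [im|mi] := ltnP i m; first by rewrite /c vq// expr0n/= !mul0r.
  by rewrite ler_wpM2l ?sqr_ge0// sV// mi/=.
have qub m v : (m < d)%N -> (forall i, (m < i < d)%N -> dot (q i) v = 0) ->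
    N (invmx A *m v) <= N v / s m.
  move=> md vq; rewrite -(@ler_pXn2r _ 2%N)// ?nnegrE ?euclid_norm_ge0//;
    last first.
    by rewrite divr_ge0 ?euclid_norm_ge0// ltW ?s0.
  rewrite normE// qE; apply: ler_sum => i _; rewrite -/(c v i) !cs//.
  have [mi|im] := ltnP m i.
    by rewrite /c vq ?expr0n/= ?mul0r// mi/=.
  by rewrite ler_wpM2l ?sqr_ge0// sV// im.
have sk0 : 0 < s k by rewrite s0.
(* By dimension, E meets the span of q_(k-1), ..., q_(d-1), where A^-1 stretches at least by 1 /
   s_(k-1), and F meets the span of q_0, ..., q_k, where it stretches at most by 1 / s_k. Comparing
   the two gives the gap. *)
have [e0 [e0E e0n0 e0q]] : exists v, [/\ v \in E, v != 0 &
    forall i, (i < k.-1)%N -> dot (q i) v = 0].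
  by apply: exists_orthogonal; rewrite dE; lia.
have [f0 [f0F f0n0 f0q]] : exists v, [/\ v \in F, v != 0 &
    forall i, (i < d - k.+1)%N -> dot (q (k.+1 + i)%N) v = 0].
  by apply: exists_orthogonal; rewrite dF; lia.
have nf0 : 0 < N f0 by rewrite euclid_norm_gt0.
have Af0 : N (invmx A *m f0) <= N f0 / s k.
  apply: qub => // i /andP[ki id]; have := f0q (i - k.+1)%N; rewrite subnKC//.
  by apply; rewrite ltn_sub2r// (leq_ltn_trans ki).
have Ae e : e \in E -> N (invmx A *m e) <= eta * (N e / s k).
  move=> eE; rewrite -(ler_pM2r nf0); apply: le_trans (EF _ _ eE f0F) _.
  rewrite -[leRHS]mulrA ler_wpM2l ?(andP eta01).1// [leRHS]mulrAC -[leRHS]mulrA.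
  by rewrite [leRHS]mulrC ler_wpM2r ?euclid_norm_ge0.
have gap : s k <= eta * s k.-1.
  have := le_trans (qlb _ _ k1d e0q) (Ae _ e0E).
  have ne0 : 0 < N e0 by rewrite euclid_norm_gt0.
  rewrite mulrCA ler_pM2l// ler_pdivlMr// mulrC ler_pdivrMr ?s0//.
have gap1 : s k < s k.-1.
  apply: le_lt_trans gap _; rewrite -[ltRHS]mul1r ltr_pM2r ?s0//.
  by case/andP: eta01 => _ /le_lt_trans; apply; lra.
(* By the gap, none of the k largest eigenvalues recurs among s_k, ..., s_(d-1), so their
   eigenspaces are orthogonal to the remaining q_i. *)
have memUk v : (v \in Uk k A) <-> (forall i, (k <= i < d)%N -> dot (q i) v = 0).
  rewrite /Uk big_add1/= big_mkord; split.
    move=> /memv_sumP[vs vsE ->] i /andP[ki id]; rewrite dot_sumr big1// => j _.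
    have := vsE j isT; rewrite memv_ker add_lfunE opp_lfunE scale_lfunE
      id_lfunE.
    rewrite lfunE/= subr_eq0 => /eqP/(congr1 (dot (q i))).
    have jk := ltn_ord j; have jd : (j < d)%N := ltn_trans jk kltd.
    have [_ ->] := absq i id; rewrite dotZr sigE// => /eqP.
    rewrite -subr_eq0 -mulrBl mulf_eq0 subr_eq0 => /orP[|/eqP//].
    rewrite lt_eqF// (le_lt_trans (sdec k i _))// ?ki//.
    rewrite (lt_le_trans gap1)// sdec// k1d andbT -ltnS prednK//.
    by case/andP: kd.
  move=> vq; rewrite (orthonormal_expand v qo); apply: memv_suml => i _.
  have [ik|ki] := ltnP i k; last by rewrite vq ?ki//= scale0r mem0v.
  apply: memvZ; apply: (subvP (sumv_sup (Ordinal ik) isT (subvv _))).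
  rewrite memv_ker add_lfunE opp_lfunE scale_lfunE id_lfunE lfunE/=.
  by rewrite (absq i (ltn_ord i)).1 sigE// subrr.
pose P : 'M[R]_d := \sum_(i < k) q i *m (q i)^T.
have PE v : P *m v = \sum_(i < k) c v i *: q i.
  rewrite mulmx_suml; apply: eq_bigr => i _; rewrite -mulmxA.
  by rewrite [(q i)^T *m v]mx11_scalar mul_mx_scalar.
have qP v i : (i < d)%N -> dot (q i) (P *m v) = if (i < k)%N then c v i else 0.
  move=> id; rewrite PE dot_sumr; case: ifPn => ik.
    rewrite (bigD1 (Ordinal ik))//= dotZr qo// eqxx mulr1 big1 ?addr0// => j ji.
    rewrite dotZr qo ?(ltn_trans (ltn_ord j))//.
    have -> : (i == j :> nat) = false by apply/negbTE; rewrite eq_sym;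
      exact: ji.
    by rewrite mulr0.
  rewrite big1// => j _; rewrite dotZr qo ?(ltn_trans (ltn_ord j))//.
  by rewrite gtn_eqF ?mulr0// (leq_trans (ltn_ord j))// leqNgt.
have PUk v : P *m v \in Uk k A.
  by apply/memUk => i /andP[ki id]; rewrite qP// ltnNge ki.
(* P is the orthogonal projection onto [Uk k A]. On the component e - P e the map A^-1 stretches at
   least by 1 / s_k, while by [Ae] it stretches e at most by eta / s_k. *)
have near_P e : e \in E -> N (e - P *m e) <= eta * N e.
  move=> eE; have orth i : (i < k)%N -> dot (q i) (e - P *m e) = 0.
    by move=> ik; rewrite dotDr dotNr qP ?ik ?subrr// (ltn_trans ik).
  rewrite -(@ler_pM2r _ (s k)^-1) ?invr_gt0// -mulrA.
  apply: le_trans (qlb k _ kltd orth) _; apply: le_trans (Ae _ eE).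
  rewrite -(@ler_pXn2r _ 2%N)// ?nnegrE ?euclid_norm_ge0// !qE.
  apply: ler_sum => i _; rewrite !exprMn ler_wpM2r ?sqr_ge0//.
  have [ik|ki] := ltnP i k; first by rewrite orth// expr0n/= sqr_ge0.
  by rewrite dotDr dotNr qP// ltnNge ki/= subr0.
(* As eta < 1, P is injective on E, so P E is all of [Uk k A] for reasons of dimension. *)
have Uk_le v : v \in Uk k A -> v \in (mxlin P @: E)%VS.
  have dUk : (\dim (Uk k A) <= k)%N.
    apply: (@leq_trans (\dim <<[seq q i | i <- iota 0 k]>>)).
      apply: dimvS; apply/subvP => u /memUk uq.
      rewrite (orthonormal_expand u qo); apply: memv_suml => i _.
      have [ik|ki] := ltnP i k; last by rewrite uq ?ki//= scale0r mem0v.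
      by apply/memvZ/memv_span/map_f; rewrite mem_iota.
    by apply: leq_trans (dim_span _) _; rewrite size_map size_iota.
  have dPE : \dim (mxlin P @: E) = k.
    rewrite limg_dim_eq//; apply/eqP; rewrite -subv0; apply/subvP => e.
    move=> /memv_capP[eE]; rewrite memv_ker lfunE/= memv0 => /eqP Pe.
    have := near_P e eE; rewrite Pe subr0 -euclid_norm_eq0.
    have := euclid_norm_ge0 e; case/andP: eta01; nra.
  suff -> : Uk k A = (mxlin P @: E)%VS by [].
  apply/esym/eqP; rewrite eqEdim dPE dUk andbT;
    apply/subvP => _ /memv_imgP[e eE ->].
  by rewrite lfunE/=.
split; first by rewrite sk sk1.
  by move=> e eE; exists (P *m e); rewrite ?near_P.
move=> u /Uk_le /memv_imgP[e eE]; rewrite lfunE/= => uE; exists e => //.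
have := near_P e eE; rewrite -uE euclid_distC.
have := ler_euclid_norm e u; rewrite (euclid_distC e).
case/andP: eta01 => eta0 eta1 ue ne.
(* Measuring the error against u = P e instead of e costs a factor 2, since eta <= 1/2. *)
have ege0 := euclid_norm_ge0 e; have e2 : N e <= 2 * N u by nra.
by apply: le_trans ne _; rewrite -mulrA mulrCA ler_wpM2l.
Qed.

End SVD.

(** * Contraction from dynamics on the Grassmannian *)

Section Contraction.
Context (R : realType) (d : nat).
Local Notation vec := 'cV[R]_d.
Local Notation N := (@euclid_norm R d).
Implicit Types (V W E F : {vspace vec}).

(** A vector within a factor 2 of the operator norm of A on W is enough for the tilting argument, so
    the supremum need not be attained. *)
Lemma exists_near_maximal_vector (A : 'M[R]_d) W : A \in unitmx -> (0 < \dim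
  W)%N ->
  exists h, [/\ h \in W, N h = 1 &
    forall h', h' \in W -> N (A *m h') <= 2 * N (A *m h) * N h'].
Proof.
move=> Au W0; have unitE h : h != 0 -> N ((N h)^-1 *: h) = 1.
  move=> h0; rewrite euclid_normZ ger0_norm ?invr_ge0 ?euclid_norm_ge0//.
  by rewrite mulVf// euclid_norm_eq0.
have [C C1 HC] := mulmx_bounded A.
pose X := [set N (A *m h) | h in [set h | h \in W /\ N h = 1]].
have [h0 [h0W h01]] : exists h, h \in W /\ N h = 1.
  exists ((N (vpick W))^-1 *: vpick W); rewrite memvZ ?memv_pick// unitE//.
  by rewrite vpick0 -dimv_eq0 -lt0n.
have supX : has_sup X.
  split; first by exists (N (A *m h0)), h0.
  by exists C => _ [h [_ h1] <-]; apply: le_trans (HC _) _; rewrite h1 mulr1.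
have s0 : 0 < sup X.
  apply: (@lt_le_trans _ _ (N (A *m h0))); last first.
    by apply: ub_le_sup; [exact: supX.2|exists h0].
  rewrite euclid_norm_gt0; apply: contra_eq_neq h01 => Ah0.
  rewrite -[h0](mulKmx Au) Ah0 mulmx0 euclid_norm0 eq_sym; exact: oner_neq0.
have [|_ [h [hW h1] <-] hX] := @sup_adherent R X (sup X / 2) _ supX.
  by rewrite divr_gt0.
exists h; split=> // h' h'W; have [->|h'0] := eqVneq h' 0.
  by rewrite mulmx0 euclid_norm0 mulr0.
have nh' : 0 < N h' by rewrite euclid_norm_gt0.
have : N (A *m ((N h')^-1 *: h')) <= sup X.
  apply: ub_le_sup; first exact: supX.2.
  by exists ((N h')^-1 *: h') => //; split; [exact: memvZ|exact: unitE].
rewrite -scalemxAr euclid_normZ ger0_norm ?invr_ge0 ?euclid_norm_ge0//.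
by rewrite ler_pdivrMl// mulrC => h2; apply: le_trans h2 _; rewrite ler_pM2r//;
  lra.
Qed.

(** One-sided closeness is what [vec_cvg_mem] takes: limits of vectors of the V_n lie in V. *)
Definition subspace_cvg (I : Type) (F : set_system I) (Vn : I -> {vspace vec})
  V :=
  forall eta : R, 0 < eta -> F [set i | subspace_within eta (Vn i) V].

Section UltrafilterArgument.
Context (I : Type) (F : set_system I) {FU : UltraFilter F}.
Context (k : nat) (A : I -> 'M[R]_d) (En Fn : I -> {vspace vec}) (E F' E1 F1 :
  {vspace vec}).
Local Notation sub_cvg := (subspace_cvg F).
Hypothesis kd : (k <= d)%N.
Hypothesis dE : \dim E = k.
Hypothesis dF : \dim F' = (d - k)%N.
Hypothesis dFn : forall i, \dim (Fn i) = (d - k)%N.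
Hypothesis EF : (E :&: F')%VS = 0%VS.
Hypothesis EF1 : (E1 :&: F1)%VS = 0%VS.
Hypothesis EnE : sub_cvg En E.
Hypothesis FnF : sub_cvg Fn F'.
Hypothesis AEn : sub_cvg (fun i => mxlin (A i) @: En i)%VS E1.
Hypothesis AFn : sub_cvg (fun i => mxlin (A i) @: Fn i)%VS F1.
Hypothesis AV : forall V, Grass k V -> transverse V F' ->
  sub_cvg (fun i => mxlin (A i) @: V)%VS E1.
Context (c : R) (v h : I -> vec).
Hypothesis A_unit : forall i, A i \in unitmx.
Hypothesis vE : forall i, v i \in En i /\ N (v i) = 1.
Hypothesis hF : forall i, h i \in Fn i /\ N (h i) = 1.
Hypothesis Avh : forall i, N (A i *m v i) <= c * N (A i *m h i).
Hypothesis hmax : forall i h', h' \in Fn i ->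
  N (A i *m h') <= 2 * N (A i *m h i) * N h'.

Lemma subspace_cvg_cst V : sub_cvg (fun=> V) V.
Proof.
have FF : ProperFilter F by exact: ultra_proper.
move=> eta eta0; apply: filterS filterT => i _ w wV; exists w => //.
by rewrite subrr euclid_norm0 mulr_ge0 ?euclid_norm_ge0// ltW.
Qed.

Lemma capv_eq0 (V W : {vspace vec}) u : (V :&: W)%VS = 0%VS -> u \in V -> u \in
  W -> u = 0.
Proof.
by move=> VW uV uW; apply/eqP; rewrite -memv0 -VW; apply/memv_capP.
Qed.

Lemma disjoint_fullv (V W : {vspace vec}) : \dim V = k -> \dim W = (d - k)%N ->
  (V :&: W)%VS = 0%VS -> (V + W)%VS = fullv.
Proof.
move=> dV dW VW; apply/eqP; rewrite eqEdim subvf/= dimvf dim_matrix mulr1.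
by rewrite dimv_disjoint_sum// dV dW subnKC.
Qed.

(* Tilt E by a map sending lim v_i to lim h_i.  As A_i does not contract h_i
   relatively to v_i, the image of the tilted space keeps a definite component
   along F1, while it should converge to E1. *)
Lemma tilted_subspace_contradiction : False.
Proof.
have FF : ProperFilter F by exact: ultra_proper.
have vB : F [set i | N (v i) <= 1] by apply: filterS filterT => i _ /=;
  rewrite (vE i).2.
have hB : F [set i | N (h i) <= 1] by apply: filterS filterT => i _ /=;
  rewrite (hF i).2.
have [v' vv'] := ultra_vec_cvg FU vB; have [h' hh'] := ultra_vec_cvg FU hB.
have v'1 : N v' = 1.
  by apply: (vec_cvg_norm vv'); apply: filterS filterT => i _; exact: (vE i).2.
have v'E : v' \in E.
  apply: (vec_cvg_mem vv' _ vB EnE); apply: filterS filterT => i _.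
  exact: (vE i).1.
have h'F : h' \in F'.
  apply: (vec_cvg_mem hh' _ hB FnF); apply: filterS filterT => i _.
  exact: (hF i).1.
(* T moves vectors along h' in F' only and sends the unit vector v' to v' + h'; hence T E is still
   transverse to F'. *)
pose T : 'End(vec) := mxlin (1%:M + h' *m v'^T).
have TE u : T u = u + dot v' u *: h'.
  rewrite lfunE/= mulmxDl mul1mx -mulmxA; congr (_ + _).
  by rewrite [v'^T *m u]mx11_scalar mul_mx_scalar.
have TF u : u \in E -> T u \in F' -> u = 0.
  move=> uE; rewrite TE => TuF; apply: (capv_eq0 EF uE).
  by rewrite -[u](addrK (dot v' u *: h')) memvB// memvZ.
pose V := (T @: E)%VS.
have dV : \dim V = k.
  rewrite -dE limg_dim_eq//; apply/eqP; rewrite -subv0; apply/subvP => u.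
  move=> /memv_capP[uE]; rewrite memv_ker memv0 => /eqP Tu.
  by apply/eqP/TF; rewrite ?Tu ?mem0v.
have VF : (V :&: F')%VS = 0%VS.
  apply/eqP; rewrite -subv0; apply/subvP => _ /memv_capP[/memv_imgP[u uE ->]
    uF].
  by rewrite (TF u uE uF) linear0 mem0v.
have Vtr : transverse V F' by split=> //; exact: disjoint_fullv.
(* Otherwise unit vectors of V and [Fn i] would converge to a unit vector common to V and F'. *)
have Vn0 : F [set i | (V :&: Fn i)%VS = 0%VS].
  case: (in_ultra_setVsetC [set i | (V :&: Fn i)%VS = 0%VS] FU) => // bad.
  have /choice[u uP] : forall i, exists u, N u <= 1 /\
      ((V :&: Fn i)%VS <> 0%VS -> [/\ u \in V, u \in Fn i & N u = 1]).
    move=> i; have [VFi|/eqP VFi] := pselect ((V :&: Fn i)%VS = 0%VS).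
      by exists 0; rewrite euclid_norm0 ler01.
    pose u := vpick (V :&: Fn i)%VS; have u0 : u != 0 by rewrite vpick0.
    have /memv_capP[uV uF] : u \in (V :&: Fn i)%VS by exact: memv_pick.
    have u1 : N ((N u)^-1 *: u) = 1.
      rewrite euclid_normZ ger0_norm ?invr_ge0 ?euclid_norm_ge0//.
      by rewrite mulVf// euclid_norm_eq0.
    by exists ((N u)^-1 *: u); rewrite u1; split=> // _; split=> //;
      exact: memvZ.
  have uB : F [set i | N (u i) <= 1].
    by apply: filterS filterT => i _; exact: (uP i).1.
  have [u' uu'] := ultra_vec_cvg FU uB.
  have u'1 : N u' = 1.
    by apply: (vec_cvg_norm uu'); apply: filterS bad => i /= /(uP i).2[].
  have u'V : u' \in V.
    apply: (vec_cvg_mem (V := fun=> V) uu' _ uB (@subspace_cvg_cst V)).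
    by apply: filterS bad => i /= /(uP i).2[].
  have u'F : u' \in F'.
    by apply: (vec_cvg_mem uu' _ uB FnF);
      apply: filterS bad => i /= /(uP i).2[].
  have u'0 := capv_eq0 VF u'V u'F.
  by move: u'1; rewrite u'0 euclid_norm0 => /esym/eqP; rewrite oner_eq0.
(* [w i] is the point of the fixed space V over [v i] along the moving fibre [Fn i]. *)
have /choice[w wP] : forall i, exists w, (V :&: Fn i)%VS = 0%VS ->
    w \in V /\ w - v i \in Fn i.
  move=> i; have [VFi|] := pselect ((V :&: Fn i)%VS = 0%VS); last by exists 0.
  have : v i \in (V + Fn i)%VS by rewrite disjoint_fullv ?memvf.
  move=> /memv_addP[w wV [b bF ->]]; exists w => _; split=> //.
  by rewrite opprD addrA subrr add0r memvN.
have wV : F [set i | w i \in V] by apply: filterS Vn0 => i /= /wP[].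
have wF : F [set i | w i - v i \in Fn i] by apply: filterS Vn0 => i /= /wP[].
(* If w were unbounded, v would become negligible after normalisation and the limit of w / N w would
   be a unit vector common to V and F'. *)
have [B wB] : exists B, F [set i | N (w i) <= B].
  apply: contrapT => unb.
  have {}unb (B : R) : F [set i | B < N (w i)].
    case: (in_ultra_setVsetC [set i | N (w i) <= B] FU) => [h1|].
      by case: unb; exists B.
    by apply: filterS => i /= /negP; rewrite -ltNge.
  pose u i := (N (w i))^-1 *: w i.
  have u1 i : 0 < N (w i) -> N (u i) = 1.
    by move=> wi; rewrite euclid_normZ gtr0_norm ?invr_gt0// mulVf// gt_eqF.
  have uB : F [set i | N (u i) <= 1] by apply: filterS (unb 0) => i /= /u1 ->.
  have [u' uu'] := ultra_vec_cvg FU uB.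
  have u'1 : N u' = 1 by apply: (vec_cvg_norm uu');
    apply: filterS (unb 0) => i /= /u1.
  have u'V : u' \in V.
    apply: (vec_cvg_mem (V := fun=> V) uu' _ uB (@subspace_cvg_cst V)).
    by apply: filterS wV => i /= wi; exact: memvZ.
  pose z i := (N (w i))^-1 *: (w i - v i).
  have zu : forall e : R, 0 < e -> F [set i | N (z i - u i) <= e].
    move=> e e0; apply: filterS2 (unb 0) (unb e^-1) => i /= w0 we.
    rewrite /z /u -scalerBr addrAC subrr add0r euclid_normZ euclid_normN (vE
      i).2.
    by rewrite mulr1 gtr0_norm ?invr_gt0// invf_ple ?posrE// ltW.
  have zF : F [set i | z i \in Fn i] by apply: filterS wF => i /= wi;
    exact: memvZ.
  have zB : F [set i | N (z i) <= 2].
    apply: filterS2 uB (zu 1 ltr01) => i /= h1 h2.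
    by apply: le_trans (ler_euclid_norm _ (u i)) _; rewrite -[2]/(1 + 1) lerD.
  have u'F : u' \in F' by exact: (vec_cvg_mem (vec_cvg_le uu' zu) zF zB FnF).
  have u'0 := capv_eq0 VF u'V u'F.
  by move: u'1; rewrite u'0 euclid_norm0 => /esym/eqP; rewrite oner_eq0.
have [w' ww'] := ultra_vec_cvg FU wB.
have w'V : w' \in V by exact: (vec_cvg_mem (V := fun=> V) ww' wV wB
  (@subspace_cvg_cst V)).
pose b i := w i - v i.
have bb : vec_cvg F b (w' - v') by exact: vec_cvgD ww' (vec_cvgN vv').
have bB : F [set i | N (b i) <= B + 1].
  apply: filterS2 wB vB => i /= h1 h2.
  by apply: le_trans (euclid_norm_triangle _ _) _; rewrite euclid_normN lerD.
have bF' : w' - v' \in F' by exact: (vec_cvg_mem bb wF bB FnF).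
(* Write w' = T e with e in E. Then e - v' lies in both E and F', so e = v' and w' = v' + h'. *)
have bh : w' - v' = h'.
  move/memv_imgP: w'V => [e eE w'E]; rewrite TE in w'E.
  have ev : e - v' = 0.
    apply: (capv_eq0 EF); first by rewrite memvB.
    have -> : e - v' = (w' - v') - dot v' e *: h'.
      by rewrite w'E [_ - v' in RHS]addrAC addrK.
    by rewrite memvB// memvZ.
  move/eqP: ev; rewrite subr_eq0 => /eqP ev.
  rewrite w'E ev addrAC subrr add0r -sqr_euclid_norm v'1 expr1n scale1r//.
pose r i := N (A i *m h i).
have r0 i : 0 < r i.
  rewrite euclid_norm_gt0; apply/eqP => Ah; have := (hF i).2.
  rewrite -[h i](mulKmx (A_unit i)) Ah mulmx0 euclid_norm0 => /esym/eqP.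
  by rewrite oner_eq0.
pose p i := (r i)^-1 *: (A i *m b i); pose s i := (r i)^-1 *: (A i *m v i).
pose p0 i := (r i)^-1 *: (A i *m h i).
have normr i u : N ((r i)^-1 *: u) = N u / r i.
  by rewrite euclid_normZ gtr0_norm ?invr_gt0// mulrC.
have pp0 : F [set i | N (p i - p0 i) <= 2^-1].
  have e0 : 0 < 8^-1 :> R by [].
  (* b_i and h_i are each within 1/8 of h', hence within 1/4 of each other; the factor 2 in [hmax]
     makes this 1/2 after rescaling. *)
  apply: filterS2 wF (filterI (bb _ e0) (hh' _ e0)) => i /= wi;
    rewrite bh => -[b1 h1].
  rewrite -scalerBr -mulmxBr normr ler_pdivrMr//.
  have bhF : b i - h i \in Fn i by rewrite memvB// (hF i).1.
  apply: le_trans (hmax bhF) _; rewrite -/(r i).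
  have := euclid_dist_triangle (b i) h' (h i); rewrite (euclid_distC h').
  by have := r0 i; nra.
have p01 i : N (p0 i) = 1 by rewrite normr -/(r i) divff// gt_eqF.
have pB : F [set i | N (p i) <= 2].
  apply: filterS pp0 => i /= H; apply: le_trans (ler_euclid_norm _ (p0 i)) _.
  by rewrite p01; lra.
have sB : F [set i | N (s i) <= c].
  by apply: filterS filterT => i _ /=; rewrite normr ler_pdivrMr// Avh.
have [p' pp'] := ultra_vec_cvg FU pB; have [s' ss'] := ultra_vec_cvg FU sB.
have p'F : p' \in F1.
  apply: (vec_cvg_mem pp' _ pB AFn); apply: filterS wF => i /= wi.
  by apply: memvZ; apply/memv_imgP; exists (b i); rewrite ?lfunE.
have s'E : s' \in E1.
  apply: (vec_cvg_mem ss' _ sB AEn); apply: filterS filterT => i _ /=.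
  by apply: memvZ; apply/memv_imgP; exists (v i); rewrite ?lfunE// (vE i).1.
(* The rescaled image of w_i is p_i + s_i. Its limit lies in E1 by the dynamics on V, and so does
   s'; thus p' lies in both E1 and F1, although its norm is at least 1/2. *)
have psE : p' + s' \in E1.
  apply: (vec_cvg_mem (B := 2 + c) (vec_cvgD pp' ss') _ _ (AV dV Vtr)).
    apply: filterS wV => i /= wi; rewrite -scalerDr -mulmxDr subrK memvZ//.
    by apply/memv_imgP; exists (w i); rewrite ?lfunE.
  apply: filterS2 pB sB => i /= h1 h2.
  by apply: le_trans (euclid_norm_triangle _ _) _; rewrite lerD.
have p'0 : p' = 0.
  by apply: (capv_eq0 EF1) => //; rewrite -[p'](addrK s') memvB.
have e0 : 0 < 4^-1 :> R by [].
have [i /= [h1 h2]] := filter_ex (filterI (pp' _ e0) pp0).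
have := ler_euclid_norm (p0 i) (p i); rewrite p01 euclid_distC.
by move: h1; rewrite p'0 subr0 => h1; lra.
Qed.

End UltrafilterArgument.
End Contraction.

(** * Stability of quasi-geodesics *)

Lemma linear_lt_expn (R : realType) (a b c : R) : 0 < c ->
  exists m : nat, a + b * m%:R < c * (2 ^ m)%:R.
Proof.
move=> c0; pose n := Num.truncn ((`|a| + 2 * `|b|) / c).
have n0 : (`|a| + 2 * `|b|) / c < n.+1%:R by exact: truncnS_gt.
(* With an even exponent, 2^m is the square of a number above n + 1, while c (n + 1) already exceeds
   [|a| + 2 |b|]. *)
exists (n.+1 * 2)%N; rewrite expnM natrM.
have : n.+1%:R ^+ 2 <= ((2 ^ n.+1) ^ 2)%:R :> R.
  by rewrite -natrX ler_nat leq_exp2r// ltnW// ltn_expl.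
have := ler_norm a; have := ler_norm b; have := normr_ge0 a;
  have := normr_ge0 b.
move: n0; rewrite ltr_pdivrMr//.
have : 1 <= n.+1%:R :> R by rewrite ler1n.
move: (n.+1%:R) => x x1 xc b0 a0 ba aa xe.
have xx : c * x * x <= c * ((2 ^ n.+1) ^ 2)%:R by rewrite -mulrA ler_pM2l//
  -expr2.
apply: lt_le_trans xx; nra.
Qed.

Section HyperbolicSpace.
Context (R : realType) (T : Type) (dist : T -> T -> R).

Definition gprod o a b : R := (dist a o + dist b o - dist a b) / 2.

Definition quasi_line (lambda eps : R) (l : R -> T) := forall s t : R,
  lambda^-1 * `|s - t| - eps <= dist (l s) (l t) /\
  dist (l s) (l t) <= lambda * `|s - t| + eps.

Context (delta : R).
Hypothesis dist0 : forall a, dist a a = 0.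
Hypothesis distC : forall a b, dist a b = dist b a.
Hypothesis dist_triangle : forall a b c, dist a c <= dist a b + dist b c.
Hypothesis four_point : forall o a b c,
  Num.min (gprod o a b) (gprod o b c) - delta <= gprod o a c.

Lemma delta_ge0 (o : T) : 0 <= delta.
Proof.
have := four_point o o o o; rewrite /gprod !dist0 minxx; lra.
Qed.

Lemma gprodC o a b : gprod o a b = gprod o b a.
Proof. by rewrite /gprod (distC a b) (addrC (dist a o)). Qed.

Lemma gprod_lip o a b a' b' :
  gprod o a b <= gprod o a' b' + dist a a' + dist b b'.
Proof.
rewrite /gprod; have := dist_triangle a a' o; have := dist_triangle b b' o.
have := dist_triangle a' a b'; have := dist_triangle a b b'.
rewrite (distC a' a); lra.
Qed.

Lemma gprod_lip_base o o' a b : gprod o a b <= gprod o' a b + dist o o'.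
Proof.
rewrite /gprod; have := dist_triangle a o' o; have := dist_triangle b o' o.
rewrite (distC o'); lra.
Qed.

(** Halving the chain uses the four-point inequality once on each of m levels, so 2^m links cost
    only m times delta. *)
Lemma gprod_chain m (q : nat -> T) o A :
  (forall i, (i < 2 ^ m)%N -> A <= gprod o (q i) (q i.+1)) ->
  A - m%:R * delta <= gprod o (q 0%N) (q (2 ^ m)%N).
Proof.
elim: m q => [|m IH] q qA; first by rewrite mul0r subr0 qA.
have h1 : A - m%:R * delta <= gprod o (q 0%N) (q (2 ^ m)%N).
  by apply: IH => i im; apply: qA; rewrite (leq_trans im)// leq_exp2l.
have h2 : A - m%:R * delta <= gprod o (q (2 ^ m)%N) (q (2 ^ m.+1)%N).
  have := IH (fun i => q (2 ^ m + i)%N); rewrite addn0 addnn -mul2n -expnS.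
  by apply=> i im; rewrite addnS qA// expnS mul2n -addnn ltn_add2l.
have := four_point o (q 0%N) (q (2 ^ m)%N) (q (2 ^ m.+1)%N).
have : A - m%:R * delta <= Num.min (gprod o (q 0%N) (q (2 ^ m)%N))
   (gprod o (q (2 ^ m)%N) (q (2 ^ m.+1)%N)) by rewrite le_min h1.
rewrite -(natr1 m) mulrDl mul1r; lra.
Qed.

(** By induction the product at x 2 of x 1 and the far point is small; as x 1 and x 2 are far apart,
    the product at x 1 of x 2 and the far point exceeds B + delta. So the minimum in the four-point
    inequality is the other product, and the bound does not deteriorate with n. *)
Lemma gprod_local_to_global B L (x : nat -> T) :
  2 * B + 2 * delta < L ->
  (forall i, gprod (x i.+1) (x i) (x i.+2) <= B) ->
  (forall i, L <= dist (x i) (x i.+1)) ->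
  forall n, gprod (x 1%N) (x 0%N) (x n.+2) <= B + delta.
Proof.
move=> BL xB xL n; have d0 := delta_ge0 (x 0%N).
elim: n x xB xL => [|n IH] x xB xL; first by have := xB 0%N; lra.
have h := IH (fun i => x i.+1) (fun i => xB i.+1) (fun i => xL i.+1).
have : gprod (x 1%N) (x n.+3) (x 2%N) = dist (x 1%N) (x 2%N) -
    gprod (x 2%N) (x 1%N) (x n.+3).
  by rewrite /gprod (distC (x 2%N) (x 1%N)) (distC (x n.+3) (x 1%N)); lra.
move: (xB 0%N) (xL 1%N) h (four_point (x 1%N) (x 0%N) (x n.+3) (x 2%N)) => /=.
rewrite minEle; case: ifP => ?; lra.
Qed.

(** Discrete connectedness; it locates on a geodesic a place close to both halves of a
    quasi-geodesic. *)
Lemma switch_index (P Q : nat -> Prop) n : P 0%N -> Q n ->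
  (forall j, (j <= n)%N -> P j \/ Q j) ->
  exists j j', [/\ P j, Q j' & (j' <= n)%N /\ (j' = j \/ j' = j.+1)].
Proof.
elim: n => [|n IH] P0 Qn PQ; first by exists 0%N, 0%N; split=> //; split=> //;
  left.
case: (PQ n (leqnSn n)) => [Pn|Qn'].
  by exists n, n.+1; split=> //; split=> //; right.
have [j [j' [Pj Qj [jn jj]]]] := IH P0 Qn' (fun j jn => PQ j (leqW jn)).
by exists j, j'; split=> //; split=> //; exact: leqW.
Qed.

Hypothesis geodesic : forall a b, exists n (p : nat -> T),
  [/\ p 0%N = a, p n = b,
      forall j, (j <= n)%N -> gprod (p j) a b = 0 &
      forall j, (j < n)%N -> dist (p j) (p j.+1) <= 1].

Section QuasiLine.
Context (lambda eps : R).
Hypothesis lambda_ge1 : 1 <= lambda.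
Hypothesis eps_ge0 : 0 <= eps.

(** [rad m] bounds the distance of a geodesic from 2^(m+1) unit-time steps: m + 1 halvings, half the
    length of a step, and 1 for strictness. [bnd m] then bounds the distance of the midpoint from
    the geodesic. Both are affine in m. *)
Let rad (m : nat) : R := m.+1%:R * delta + (lambda + eps) / 2 + 1.
Let bnd (m : nat) : R := rad m + lambda * (lambda * (2 * rad m + 1 + eps)) +
  eps.

(** A geodesic point far from all samples would see consecutive samples with large products, hence
    by chaining its own endpoints with a positive product, which is absurd. So each geodesic point
    has a sample nearby, in the first or the second half; where the halves switch, two samples on
    either side of the midpoint are close, and so are their times. *)
Lemma quasi_line_midpoint (l : R -> T) : quasi_line lambda eps l ->
  forall m s, gprod (l (s + (2 ^ m)%:R)) (l s) (l (s + (2 ^ m.+1)%:R)) <= bnd m.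
Proof.
move=> ql m s; have dl := delta_ge0 (l 0).
have lam1 := lambda_ge1; have ep0 := eps_ge0; set a := l s;
  set b := l (s + (2 ^ m.+1)%:R).
have [n [p [p0 pn pab pp]]] := geodesic a b.
pose q i := l (s + i%:R).
have q0 : q 0%N = a by rewrite /q addr0.
have qq i : dist (q i) (q i.+1) <= lambda + eps.
  have [_] := ql (s + i%:R) (s + i.+1%:R).
  have -> : s + i%:R - (s + i.+1%:R) = -1 by rewrite -(natr1 i); ring.
  by rewrite normrN normr1 mulr1.
have near_q j : (j <= n)%N -> exists2 i,
  (i <= 2 ^ m.+1)%N & dist (q i) (p j) <= rad m.
  move=> jn; apply: contrapT => far.
  have {}far i : (i <= 2 ^ m.+1)%N -> rad m < dist (q i) (p j).
    by move=> im; rewrite ltNge; apply/negP => h; apply: far; exists i.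
  have := @gprod_chain m.+1 q (p j) (rad m - (lambda + eps) / 2).
  rewrite q0 pab//; have -> : rad m - (lambda + eps) / 2 - m.+1%:R * delta = 1.
    by rewrite /rad; ring.
  move=> H; suff : 1 <= 0 :> R by rewrite ler10.
  apply: H => i im; rewrite /gprod.
  have := far i (ltnW im); have := far i.+1 im; have := qq i.
  by move: (rad m) => *; lra.
pose P j := exists2 i, (i <= 2 ^ m)%N & dist (q i) (p j) <= rad m.
pose Q j := exists i, [/\ (2 ^ m <= i)%N,
  (i <= 2 ^ m.+1)%N & dist (q i) (p j) <= rad m].
have r1 : 1 <= rad m.
  have : 0 <= m.+1%:R * delta by rewrite mulr_ge0.
  by rewrite /rad; lra.
have PQ j : (j <= n)%N -> P j \/ Q j.
  move=> /near_q[i im qp]; have [h|h] := leqP i (2 ^ m); [left|right].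
    by exists i.
  by exists i; rewrite (ltnW h).
have P0 : P 0%N by exists 0%N; rewrite // q0 p0 dist0 (le_trans ler01).
have Qn : Q n.
  by exists (2 ^ m.+1)%N; rewrite leq_exp2l// leqnSn /q pn dist0 (le_trans
    ler01).
have [j [j' [[i im qi] [i' [mi' _ qi']] [jn jj]]]] := switch_index P0 Qn PQ.
have pjj : dist (p j) (p j') <= 1.
  by case: jj => jj; rewrite jj ?dist0 ?ler01// pp// -jj.
have qii : dist (q i) (q i') <= 2 * rad m + 1.
  have := dist_triangle (q i) (p j) (q i');
    have := dist_triangle (p j) (p j') (q i').
  rewrite (distC (p j') (q i')); lra.
have imi : (i <= i')%N := leq_trans im mi'.
have ii' : (i'%:R - i%:R) <= lambda * (2 * rad m + 1 + eps).
  have [+ _] := ql (s + i%:R) (s + i'%:R); rewrite -/(q i) -/(q i').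
  have -> : s + i%:R - (s + i'%:R) = - (i'%:R - i%:R) by ring.
  rewrite normrN ger0_norm ?subr_ge0 ?ler_nat// => h.
  rewrite -ler_pdivrMl ?(lt_le_trans ltr01)//; lra.
have mi : (2 ^ m)%:R - i%:R <= lambda * (2 * rad m + 1 + eps).
  by apply: le_trans ii'; rewrite lerD2r ler_nat.
have dmi : dist (l (s + (2 ^ m)%:R)) (q i) <= lambda * (lambda * (2 * rad m + 1
  + eps)) + eps.
  have [_] := ql (s + (2 ^ m)%:R) (s + i%:R); rewrite -/(q i) => h.
  apply: le_trans h _; rewrite lerD2r ler_pM2l ?(lt_le_trans ltr01)//.
  have -> : s + (2 ^ m)%:R - (s + i%:R) = (2 ^ m)%:R - i%:R by ring.
  by rewrite ger0_norm ?subr_ge0 ?ler_nat.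
have := gprod_lip_base (l (s + (2 ^ m)%:R)) (p j) a b.
have jn' : (j <= n)%N by case: jj => jj; rewrite jj in jn; rewrite // ltnW.
rewrite pab//.
have := dist_triangle (l (s + (2 ^ m)%:R)) (q i) (p j).
by rewrite /bnd; move: (lambda * _) dmi => *; lra.
Qed.

(* Stability of quasi-geodesics (Morse lemma).  Subdividing dyadically, a
   geodesic between points of the quasi-geodesic at parameter distance 2^m
   passes within O(m) of the midpoint; as 2^m beats O(m), the local-to-global
   principle applies to the subdivision at one fixed scale. *)
Lemma morse : exists2 M, 0 <= M & forall l, quasi_line lambda eps l ->
  forall s t u, s <= t -> t <= u -> gprod (l t) (l s) (l u) <= M.
Proof.
have lam1 := lambda_ge1; have ep0 := eps_ge0.
have lam0 : 0 < lambda by exact: lt_le_trans lambda_ge1.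
(* The scale at which 2^m / lambda - eps exceeds 2 bnd m + 3 delta. The absolute value is taken
   because delta >= 0 is known only once a point is given. *)
have [m mP] := @linear_lt_expn R
  (eps + 3 * `|delta| + 2 * bnd 0) (2 * (1 + 2 * lambda * lambda) * `|delta|)
    lambda^-1
  (ltac:(by rewrite invr_gt0)).
pose h : R := (2 ^ m)%:R.
have h0 : 0 < h by rewrite ltr0n expn_gt0.
exists (`|bnd m| + 2 * `|delta| + 2 * (lambda * h + eps)).
  by rewrite !addr_ge0 ?mulr_ge0 ?addr_ge0 ?mulr_ge0// ltW.
move=> l ql s t u st tu; have dl := delta_ge0 (l 0).
pose L := lambda^-1 * h - eps.
have BL : 2 * bnd m + 3 * delta < L.
  rewrite ltrBrDr; apply: le_lt_trans mP.
  rewrite (ger0_norm dl) /bnd /rad -(natr1 m); set mm : R := m%:R.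
  by nra.
have mid x : gprod (l (x + h)) (l x) (l (x + h + h)) <= bnd m.
  have := quasi_line_midpoint ql m x.
  by rewrite -addrA /h expnS mul2n -addnn natrD.
have hL x : L <= dist (l x) (l (x + h)).
  have [+ _] := ql x (x + h); by rewrite opprD addNKr normrN gtr0_norm.
pose y (n : nat) := l (t + h *+ n); pose z (n : nat) := l (t - h *+ n).
have y0 : y 0%N = l t by rewrite /y addr0.
have z0 : z 0%N = l t by rewrite /z subr0.
have key a b : gprod (l t) (z a) (y b) <= `|bnd m| + 2 * delta.
  have bm := ler_norm (bnd m); have bm0 := normr_ge0 (bnd m).
  case: a => [|a]; first by rewrite z0 /gprod dist0 (distC (y b)); lra.
  case: b => [|b]; first by rewrite y0 /gprod dist0; lra.
  pose x i := if i is i'.+1 then y i' else z 1%N.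
  have xE i : x i = l (t - h + h *+ i).
    by case: i => [|i]; rewrite /x/= ?/z ?/y ?mulr1n ?addr0// mulrS addrA subrK.
  have zz i : z i = l (t - h *+ i) by [].
  have h1 : gprod (l t) (z 1%N) (y b.+1) <= bnd m + delta.
    suff : gprod (x 1%N) (x 0%N) (x b.+2) <= bnd m + delta by rewrite /x/= y0.
    apply: (@gprod_local_to_global _ L) => [|i|i]; first by lra.
      rewrite !xE; have := mid (t - h + h *+ i).
      by congr (gprod (l _) (l _) (l _) <= _); rewrite !mulrS; ring.
    rewrite !xE; have := hL (t - h + h *+ i).
    by congr (_ <= dist (l _) (l _)); rewrite mulrS; ring.
  case: a => [|a]; first by lra.
  have h2 : gprod (z 1%N) (z 0%N) (z a.+2) <= bnd m + delta.
    apply: (@gprod_local_to_global _ L) => [|i|i]; first by lra.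
    - have := mid (t - h *+ i.+2); rewrite gprodC /z.
      by congr (gprod (l _) (l _) (l _) <= _); rewrite !mulrS; ring.
    - have := hL (t - h *+ i.+1); rewrite distC /z.
      by congr (_ <= dist (l _) (l _)); rewrite !mulrS; ring.
  have h3 : gprod (l t) (z 1%N) (z a.+2) = dist (z 0%N) (z 1%N) -
      gprod (z 1%N) (z 0%N) (z a.+2).
    rewrite /gprod z0 (distC (z 1%N) (l t)) (distC (z a.+2) (l t)).
    by rewrite (distC (z a.+2) (z 1%N)); lra.
  have h4 : L <= dist (z 0%N) (z 1%N).
    by have := hL (t - h); rewrite subrK distC /z mulr1n subr0.
  (* At l t, the points z 1 and z a.+2 have product more than bnd m + 2 delta, so the bound for z 1
     and y passes to z a.+2 and y at the cost of one delta. *)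
  have := four_point (l t) (z 1%N) (z a.+2) (y b.+1).
  rewrite minEle; case: ifP => _; lra.
(* Moving s and u to the grid of mesh h based at t costs lambda h + eps for each. *)
have near_grid x : 0 <= x -> exists n : nat, `|x - h *+ n| <= h.
  move=> x0; exists (Num.truncn (x / h)); set n := Num.truncn _.
  have xh : 0 <= x / h by rewrite divr_ge0// ltW.
  have := truncn_itv xh; rewrite -/n => /andP[].
  rewrite ler_pdivlMr// ltr_pdivrMr// -mulr_natr -natr1 => h1 h2.
  by rewrite ler_norml; apply/andP; split; nra.
have [a ha] := near_grid (t - s) (ltac:(by rewrite subr_ge0)).
have [b hb] := near_grid (u - t) (ltac:(by rewrite subr_ge0)).
have ds : dist (l s) (z a) <= lambda * h + eps.
  have [_ +] := ql s (t - h *+ a); move/le_trans; apply;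
    rewrite lerD2r ler_pM2l//.
  by move: ha; rewrite distrC; congr (`|_| <= _); ring.
have du : dist (l u) (y b) <= lambda * h + eps.
  have [_ +] := ql u (t + h *+ b); move/le_trans; apply;
    rewrite lerD2r ler_pM2l//.
  by move: hb; congr (`|_| <= _); ring.
have := gprod_lip (l t) (l s) (l u) (z a) (y b); have := key a b.
by rewrite (ger0_norm dl); lra.
Qed.

End QuasiLine.
End HyperbolicSpace.

(** * The word metric and the boundary *)

Section WordGeometry.
Context (R : realType) (Gam : groupType) (S : gen_set Gam).

Lemma word_lengthP (g : Gam) : exists w : seq Gam,
  [/\ size w = word_length S g, all [in gens S] w & g = (\prod_(x <- w) x)%g].
Proof. by rewrite /word_length; case: ex_minnP => m /asboolP[w ?] _;
  exists w. Qed.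

Lemma word_length_le (w : seq Gam) :
  all [in gens S] w -> (word_length S (\prod_(x <- w) x)%g <= size w)%N.
Proof.
move=> wS; rewrite /word_length; case: ex_minnP => m _; apply.
by apply/asboolP; exists w.
Qed.

Lemma word_length_eq0 (g : Gam) : word_length S g = 0%N -> g = 1%g.
Proof.
by have [[|x w] [<- _ ->]//] := word_lengthP g; rewrite big_nil.
Qed.

Lemma word_lengthV (g : Gam) : word_length S g^-1%g = word_length S g.
Proof.
suff H h : (word_length S h^-1%g <= word_length S h)%N.
  by apply/eqP; rewrite eqn_leq H -{1}[g]invgK H.
have [w [<- wS ->]] := word_lengthP h.
have -> : ((\prod_(x <- w) x)^-1 = \prod_(x <- rev [seq y^-1 | y <- w]) x)%g.
  elim: w {wS} => [|x w IH]; first by rewrite /rev/= !big_nil invg1.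
  by rewrite big_cons invgM IH/= rev_cons -cats1 big_cat/= big_seq1.
apply: leq_trans (word_length_le _) _; last by rewrite size_rev size_map.
by rewrite all_rev all_map; apply: sub_all wS => x /=; exact: gens_sym.
Qed.

Definition wdist (g h : Gam) : R := (word_dist S g h)%:R.

Lemma wdistxx g : wdist g g = 0.
Proof. by rewrite /wdist word_distxx. Qed.

Lemma wdistC g h : wdist g h = wdist h g.
Proof. by rewrite /wdist /word_dist -word_lengthV invgM invgK. Qed.

Lemma wdist_triangle g h k : wdist g k <= wdist g h + wdist h k.
Proof. by rewrite /wdist -natrD ler_nat word_dist_triangle. Qed.

Lemma wdist_ge0 g h : 0 <= wdist g h.
Proof. exact: ler0n. Qed.

Lemma wdist_translate a g h : wdist (a * g)%g (a * h)%g = wdist g h.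
Proof. by rewrite /wdist word_dist_translate. Qed.

Lemma wdist_eq0 g h : wdist g h = 0 -> g = h.
Proof.
move=> /eqP; rewrite pnatr_eq0 => /eqP/word_length_eq0 gh.
by rewrite -[h](mulVKg g) gh mulg1.
Qed.

Lemma wdist_gen g s : s \in gens S -> wdist g (g * s)%g <= 1.
Proof.
move=> sS; rewrite /wdist /word_dist mulKg lern1.
by have := @word_length_le [:: s]; rewrite big_seq1/= sS; apply.
Qed.

Lemma wdist1 g : wdist 1%g g = (word_length S g)%:R.
Proof. by rewrite /wdist /word_dist invg1 mul1g. Qed.

(** The points are the prefixes of a shortest word; a shortcut between two of them would shorten the
    word. *)
Lemma wdist_geodesic (a b : Gam) : exists n (p : nat -> Gam),
  [/\ p 0%N = a, p n = b &
      forall j k, (j <= k)%N -> (k <= n)%N -> wdist (p j) (p k) = (k - j)%:R].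
Proof.
have [w [ws wS wE]] := word_lengthP (a^-1 * b)%g.
pose p j := (a * \prod_(x <- take j w) x)%g; exists (size w), p.
have le j k : (j <= k)%N -> (k <= size w)%N -> wdist (p j) (p k) <= (k - j)%:R.
  move=> jk kw; rewrite /wdist /word_dist ler_nat.
  have -> : ((p j)^-1 * p k)%g = (\prod_(x <- drop j (take k w)) x)%g.
    rewrite /p invgM -{1}(cat_take_drop j (take k w)) take_takel// big_cat/=.
    by rewrite -!mulgA mulKg mulKg.
  apply: leq_trans (word_length_le _) _; last by rewrite size_drop size_takel.
  by apply/allP => x /mem_drop/mem_take; apply/allP.
have p0 : p 0%N = a by rewrite /p take0 big_nil mulg1.
have pn : p (size w) = b by rewrite /p take_size -wE mulVKg.
split=> // j k jk kn; apply/eqP; rewrite eq_le le//=.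
have := wdist_triangle (p 0%N) (p j) (p (size w)).
have := wdist_triangle (p j) (p k) (p (size w)).
have -> : wdist (p 0%N) (p (size w)) = (size w)%:R by rewrite p0 pn ws.
have := le 0%N j (leq0n j) (leq_trans jk kn);
  have := le k (size w) kn (leqnn _).
by rewrite !natrB// subr0; lra.
Qed.

Lemma wdist_geodesic_steps (a b : Gam) : exists n (p : nat -> Gam),
  [/\ p 0%N = a, p n = b,
      forall j, (j <= n)%N -> gprod wdist (p j) a b = 0 &
      forall j, (j < n)%N -> wdist (p j) (p j.+1) <= 1].
Proof.
have [n [p [p0 pn pd]]] := wdist_geodesic a b; exists n, p; split=> // j jn.
  rewrite /gprod -p0 -pn (wdistC (p n)) !pd// -natrD subn0 subnKC// subn0.
  by rewrite subrr mul0r.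
by rewrite pd// subSnn.
Qed.

Local Notation cay := (cayley R S).

Lemma cay_posP (p : cay) : 0 <= pos p <= 1.
Proof. by case: p => a s t /= /orP[/andP[_ /eqP ->]|/and3P[]//];
  rewrite lexx ler01. Qed.

Lemma wdist_tgt (p : cay) : wdist (src p) (tgt p) <= 1.
Proof.
case: p => a s t h; rewrite /tgt/=.
case/orP: (h) => [/andP[/eqP -> _]|/and3P[sS _ _]]; last exact: wdist_gen.
by rewrite mulg1 wdistxx.
Qed.

Lemma cay_dist_vert2 a b : cay_dist (vert a : cay) (vert b) = wdist a b.
Proof.
rewrite cay_dist_vert /tgt/= mulg1 -/(wdist a b) add0r subr0.
by apply/min_idPl; rewrite lerDr.
Qed.

Lemma cay_distC (p q : cay) : cay_dist p q = cay_dist q p.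
Proof.
rewrite /cay_dist -!/(wdist _ _).
rewrite (eq_sym (src q)) (eq_sym (dir q)); case: ifP => _;
  first by rewrite distrC.
rewrite andbC (eq_sym (tgt p)) (eq_sym (src p)); case: ifP => _.
  by congr `|_|; lra.
rewrite (wdistC (src q)) (wdistC (tgt q) (tgt p)) (wdistC (src q)).
rewrite (wdistC (tgt q)) (wdistC (tgt p) (src q)).
by rewrite !minEle; repeat case: ifP; lra.
Qed.

Lemma cay_dist_src (p : cay) : cay_dist p (vert (src p)) <= 1.
Proof.
rewrite cay_dist_vert word_distxx addr0 ge_min.
by case/andP: (cay_posP p) => _ ->.
Qed.

Lemma cay_dist_src2 (p q : cay) :
  `|cay_dist p q - wdist (src p) (src q)| <= 2.
Proof.
have /andP[p0 p1] := cay_posP p; have /andP[q0 q1] := cay_posP q.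
rewrite /cay_dist -!/(wdist _ _) ler_norml.
have sp := wdist_tgt p; have sq := wdist_tgt q.
case: ifP => [/andP[/eqP -> _]|_].
  rewrite wdistxx subr0; apply/andP; split.
    by apply: le_trans (normr_ge0 _); rewrite lerNl oppr0.
  by rewrite ler_norml; apply/andP; split; lra.
case: ifP => [/andP[/eqP e _]|_].
  rewrite e wdistC; have := wdist_ge0 (src q) (tgt q).
  have := normr_ge0 (pos p - (1 - pos q)) => n0 w0.
  have : `|pos p - (1 - pos q)| <= 1 by rewrite ler_norml; apply/andP; split;
    lra.
  by move=> n1; apply/andP; split; lra.
have := wdist_triangle (src p) (tgt q) (src q).
have := wdist_triangle (src p) (tgt p) (src q).
have := wdist_triangle (src p) (tgt p) (tgt q).
rewrite (wdistC (tgt q) (src q)) => h1 h2 h3.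
have := wdist_ge0 (src p) (src q).
by rewrite !minEle; repeat case: ifP => //; move=> *; apply/andP; split; lra.
Qed.

Lemma gromov_product_vert o a b :
  gromov_product (vert o : cay) (vert a) (vert b) = gprod wdist o a b.
Proof. by rewrite /gromov_product !cay_dist_vert2. Qed.

Lemma gromov_productC (o p q : cay) : gromov_product o p q = gromov_product o q
  p.
Proof. by rewrite /gromov_product (cay_distC q p) (addrC (cay_dist p o)). Qed.

Lemma cay_dist_ge0 (p q : cay) : 0 <= cay_dist p q.
Proof.
have /andP[p0 p1] := cay_posP p; have /andP[q0 q1] := cay_posP q.
rewrite /cay_dist -!/(wdist _ _); case: ifP => _; first exact: normr_ge0.
case: ifP => _; first exact: normr_ge0.
have := wdist_ge0 (src p) (src q); have := wdist_ge0 (src p) (tgt q).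
have := wdist_ge0 (tgt p) (src q); have := wdist_ge0 (tgt p) (tgt q).
by rewrite !minEle; repeat case: ifP => //; move=> *; lra.
Qed.

Lemma word_ball_finite n : exists s : seq Gam,
  forall g, (word_length S g <= n)%N -> g \in s.
Proof.
elim: n => [|n [s IH]].
  by exists [:: 1%g] => g; rewrite leqn0 => /eqP/word_length_eq0 ->;
    rewrite inE.
exists (1%g :: [seq (g * x)%g | g <- s, x <- gens S]) => g gn; rewrite inE.
have [w [ws wS gE]] := word_lengthP g.
case/lastP: w ws wS gE => [_ _ ->|w x ws]; first by rewrite big_nil eqxx.
rewrite all_rcons => /andP[xS wS]; rewrite -cats1 big_cat/= big_seq1 => ->.
apply/orP; right; apply: allpairs_f => //; apply: IH.
apply: leq_trans (word_length_le wS) _.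
by rewrite -ltnS; apply: leq_trans gn; rewrite -ws size_rcons.
Qed.

End WordGeometry.

Arguments wdist R {Gam} S g h.

(** * Gromov products with boundary points and convergence at infinity *)

Section BoundaryPoints.
Context (R : realType) (Gam : groupType) (S : gen_set Gam) (delta : R).
Hypothesis hyp : forall o p q r : cayley R S,
  Num.min (gromov_product o p q) (gromov_product o q r) - delta <=
  gromov_product o p r.
Local Notation cay := (cayley R S).
Local Notation bd := (boundary R S).
Local Notation gp := (gromov_product (vert 1%g : cay)).

Lemma hyperbolic_delta_ge0 : 0 <= delta.
Proof.
have := hyp (vert 1%g) (vert 1%g) (vert 1%g) (vert 1%g).
by rewrite minxx lerBlDr lerDl.
Qed.

Lemma gp_step A (p q r : cay) : A <= gp p q -> A <= gp q r -> A - delta <= gp p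
  r.
Proof.
move=> pq qr; apply: le_trans (hyp (vert 1%g) p q r).
by rewrite lerD2r le_min pq qr.
Qed.

Lemma near_prodP (P : nat * nat -> Prop) :
  (\forall ij \near filter_prod \oo \oo, P ij) <->
  exists N, forall i j, (N <= i)%N -> (N <= j)%N -> P (i, j).
Proof.
split=> [[[Q1 Q2] /= [[N1 _ H1] [N2 _ H2]] H]|[N H]].
  exists (maxn N1 N2) => i j; rewrite !geq_max => /andP[i1 i2] /andP[j1 j2].
  by apply: H; split=> /=; [exact: H1|exact: H2].
exists ([set i | (N <= i)%N], [set i | (N <= i)%N]) => /=.
  by split; exists N.
by move=> [i j] /= [/= ? ?]; exact: H.
Qed.

Lemma asymptoticP (u v : nat -> cay) : asymptotic u v <->
  forall A, exists N, forall i j,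
    (N <= i)%N -> (N <= j)%N -> A <= gp (u i) (v j).
Proof.
rewrite /asymptotic cvgryPge; split=> H A.
  by have /near_prodP[N HN] := H A; exists N => i j; exact: HN.
by apply/near_prodP; exact: H.
Qed.

Lemma asymptotic_sym (u v : nat -> cay) : asymptotic u v -> asymptotic v u.
Proof.
move=> /asymptoticP uv; apply/asymptoticP => A; have [N H] := uv A.
by exists N => i j Ni Nj; rewrite gromov_productC H.
Qed.

Lemma asymptotic_trans (u v w : nat -> cay) :
  asymptotic u v -> asymptotic v w -> asymptotic u w.
Proof.
move=> /asymptoticP uv /asymptoticP vw; apply/asymptoticP => A.
have [N H] := uv (A + delta); have [N' H'] := vw (A + delta).
exists (maxn N N') => i j; rewrite !geq_max => /andP[Ni _] /andP[_ Nj].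
rewrite -[A](addrK delta); apply: (@gp_step _ _ (v (maxn N N'))).
  by rewrite H// leq_maxl.
by rewrite H'// leq_maxr.
Qed.

Lemma bclassE (x : bd) :
  exists2 u, converges_at_infinity u & bclass x = asymptotic_class u.
Proof. by case: x. Qed.

Lemma bclass_nonempty (x : bd) : exists u, bclass x u.
Proof. by have [u uc ->] := bclassE x; exists u. Qed.

Lemma bclass_converges (x : bd) u : bclass x u -> converges_at_infinity u.
Proof. by have [u' u'c ->] := bclassE x; case. Qed.

Lemma bclass_asymptotic (x : bd) u v : bclass x u -> bclass x v -> asymptotic u
  v.
Proof.
have [u' u'c ->] := bclassE x => -[_ uu] [_ uv].
by apply: asymptotic_trans uv; exact: asymptotic_sym.
Qed.

Lemma asymptotic_bclass (x : bd) u v : bclass x u -> asymptotic u v -> bclass x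
  v.
Proof.
move=> xu uv; have vv : converges_at_infinity v.
  exact: asymptotic_trans (asymptotic_sym uv) uv.
move: xu; have [u' u'c ->] := bclassE x => -[_ uu].
by split=> //; exact: asymptotic_trans uv.
Qed.

Lemma boundary_eq (x y : bd) u : bclass x u -> bclass y u -> x = y.
Proof.
move=> xu yu; have xy : bclass x = bclass y.
  apply/seteqP; split=> v h.
    exact: asymptotic_bclass yu (bclass_asymptotic xu h).
  exact: asymptotic_bclass xu (bclass_asymptotic yu h).
case: x y xy {xu yu} => [c cP] [c' c'P] /= cc; subst c'.
by congr Boundary; exact: Prop_irrelevance.
Qed.

Definition mk_boundary (u : nat -> cay) (uc : converges_at_infinity u) : bd :=
  @Boundary _ _ _ (asymptotic_class u) (ex_intro2 _ _ u uc erefl).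

Lemma mk_boundaryP u (uc : converges_at_infinity u) : bclass (mk_boundary uc) u.
Proof. by []. Qed.

(* (p . x) >= A, the product being the infimum over representatives of x *)
Definition gp_ge (A : R) (p : cay) (x : bd) :=
  forall u, bclass x u -> exists N, forall j, (N <= j)%N -> A <= gp p (u j).

(** Passing from one representative of x to all of them costs a single delta. *)
Lemma gp_ge_ex A p (x : bd) u N : bclass x u ->
  (forall j, (N <= j)%N -> A <= gp p (u j)) -> gp_ge (A - delta) p x.
Proof.
move=> xu pu v xv; have /asymptoticP/(_ A)[N' H] := bclass_asymptotic xu xv.
exists N' => j jN'; apply: (@gp_step _ _ (u (maxn N N'))).
  by rewrite pu// leq_maxl.
by rewrite H// leq_maxr.
Qed.

Lemma gp_ge_le A A' p (x : bd) : A' <= A -> gp_ge A p x -> gp_ge A' p x.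
Proof.
by move=> AA H u /H[N uN]; exists N => j /uN; exact: le_trans.
Qed.

Lemma gp_ge_step A p q (x : bd) :
  A <= gp p q -> gp_ge A q x -> gp_ge (A - delta) p x.
Proof.
by move=> pq qx u /qx[N uN]; exists N => j /uN; exact: gp_step.
Qed.

Lemma bclass_gp_ge (x : bd) u A : bclass x u ->
  exists N, forall n, (N <= n)%N -> gp_ge A (u n) x.
Proof.
move=> xu; have /asymptoticP/(_ (A + delta))[N H] := bclass_asymptotic xu xu.
exists N => n Nn; rewrite -[A](addrK delta).
by apply: (@gp_ge_ex _ _ _ u N) => // j Nj; exact: H.
Qed.

Lemma gp_ge_bclass (x : bd) (u : nat -> cay) :
  (forall A, exists N, forall n, (N <= n)%N -> gp_ge A (u n) x) -> bclass x u.
Proof.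
move=> H; have [v xv] := bclass_nonempty x; apply: (asymptotic_bclass xv).
apply/asymptoticP => A; have [N HN] := H (A + delta).
have /asymptoticP/(_ (A + delta))[N' H'] := bclass_asymptotic xv xv.
exists (maxn N N') => i j; rewrite !geq_max => /andP[_ Ni] /andP[Nj _].
have [M HM] := HN j Nj v xv.
rewrite -[A](addrK delta); apply: (@gp_step _ _ (v (maxn M N'))).
  by rewrite H'// leq_maxr.
by rewrite gromov_productC HM// leq_maxl.
Qed.

Lemma boundary_gp_lb (x y : bd) u v A N : bclass x u -> bclass y v ->
  (forall i j, (N <= i)%N -> (N <= j)%N -> A <= gp (u i) (v j)) ->
  (A%:E <= boundary_gromov_product x y)%E.
Proof.
move=> xu yv H; apply: ereal_sup_ge; eexists; first by exists (u, v).
rewrite /limf_einf /= limf_esupE leeNr; apply: ereal_inf_le.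
exists (ereal_sup ((\- (fun ij : nat * nat => (gp (u ij.1) (v ij.2))%:E))%E @`
   [set ij | (N <= ij.1)%N && (N <= ij.2)%N])).
  eexists; last by [].
  by apply/near_prodP; exists N => i j /= -> ->.
apply: ge_ereal_sup => _ [[i j] /= /andP[Ni Nj] <-].
by rewrite lee_fin lerN2 H.
Qed.

(** The product is a supremum over representatives; replacing the near-optimal pair by u and v takes
    two four-point steps, hence 2 delta. *)
Lemma boundary_gp_gt (x y : bd) u v A : (A%:E < boundary_gromov_product x y)%E
  ->
  bclass x u -> bclass y v ->
  exists N, forall i j, (N <= i)%N -> (N <= j)%N -> A - 2 * delta <= gp (u i)
    (v j).
Proof.
move=> /ereal_sup_gt[_ [[u' v'] [/= xu' yv'] <-]].
rewrite /limf_einf limf_esupE lteNr => /ereal_inf_lt[_ [Q QF <-]] QA xu yv.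
have [N NP] := (near_prodP _).1 QF.
have /asymptoticP/(_ A)[N1 H1] := bclass_asymptotic xu xu'.
have /asymptoticP/(_ (A - delta))[N2 H2] := bclass_asymptotic yv' yv.
exists (maxn N1 N2) => i j; rewrite !geq_max => /andP[i1 _] /andP[_ j2].
have -> : A - 2 * delta = A - delta - delta by ring.
pose M := maxn N (maxn N1 N2).
have MN : (N <= M)%N by rewrite leq_maxl.
have MN1 : (N1 <= M)%N by rewrite /M leq_max leq_maxl orbT.
have MN2 : (N2 <= M)%N by rewrite /M leq_max leq_maxr orbT.
apply: (@gp_step _ _ (v' M)); last exact: H2.
apply: (@gp_step _ _ (u' M)); first exact: H1.
have : (- (gp (u' M) (v' M))%:E <= ereal_sup
  ((\- (fun ij : nat * nat => (gp (u' ij.1) (v' ij.2))%:E))%E @` Q))%E.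
  by apply: ereal_sup_ubound; exists (M, M) => //; exact: NP.
move=> /le_lt_trans/(_ QA); rewrite lte_fin ltrN2; exact: ltW.
Qed.

Lemma gp_ge_boundary A p (x y : bd) : gp_ge A p x -> gp_ge A p y ->
  ((A - delta)%:E <= boundary_gromov_product x y)%E.
Proof.
have [[u xu] [v yv]] := (bclass_nonempty x, bclass_nonempty y).
move=> /(_ u xu)[N HN] /(_ v yv)[N' HN'];
  apply: (@boundary_gp_lb _ _ u v _ (maxn N N')) => //.
move=> i j; rewrite !geq_max => /andP[Ni _] /andP[_ Nj].
by apply: (@gp_step _ _ p); [rewrite gromov_productC; exact: HN|exact: HN'].
Qed.

Lemma bclass_round (x : bd) (u : nat -> cay) (g : nat -> Gam) :
  bclass x u -> (forall n, cay_dist (u n) (vert (g n)) <= 1) ->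
  bclass x (fun n => vert (g n)).
Proof.
move=> xu ug; apply: (asymptotic_bclass xu).
have /asymptoticP uu := bclass_asymptotic xu xu.
(* The product of a point with itself is essentially its distance to the base point, and this tends
   to infinity along u. *)
have half n : gp (u n) (u n) - 1 <= gp (u n) (vert (g n)).
  rewrite /gromov_product cay_dist_vert2.
  have := cay_dist_vert_lip (u n) (g n) 1%g; rewrite -/(wdist R S _ _).
  have := ug n; have := cay_dist_ge0 (u n) (u n); lra.
apply/asymptoticP => A; have [N H] := uu (A + delta + 1).
have d0 := hyperbolic_delta_ge0.
exists N => i j Ni Nj; rewrite -[A](addrK delta).
apply: (@gp_step _ _ (u j)); first by have := H i j Ni Nj; lra.
by apply: le_trans (half j); have := H j j Nj Nj; lra.
Qed.

Lemma boundary_gp_ge0 (x y : bd) : (0%:E <= boundary_gromov_product x y)%E.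
Proof.
have [[u xu] [v yv]] := (bclass_nonempty x, bclass_nonempty y).
have xu' := bclass_round xu (fun n => cay_dist_src (u n)).
have yv' := bclass_round yv (fun n => cay_dist_src (v n)).
apply: (@boundary_gp_lb _ _ _ _ _ 0 xu' yv') => i j _ _.
rewrite gromov_product_vert /gprod divr_ge0// subr_ge0.
by rewrite [wdist R S (src (v j)) _]wdistC; exact: wdist_triangle.
Qed.

Lemma boundary_cvg (I : Type) (F : set_system I) (xs : I -> bd) (x : bd) :
  Filter F ->
  (forall A, F [set i | (A%:E < boundary_gromov_product x (xs i))%E]) ->
  xs i @[i --> F] --> x.
Proof.
move=> FF H U /=; rewrite nbhsE => -[V [Vo Vx] VU].
have [r rV] : exists r : R, forall y,
  (r%:E < boundary_gromov_product x y)%E -> V y.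
  exact: (Vo x Vx).
by apply: (@filterS _ F _ _ _ _ (H r)) => i /= /rV/VU.
Qed.

End BoundaryPoints.

(** * Pointwise limits of maps into the group *)

Section Ultralimits.
Context (I : Type) (F : set_system I) (FU : UltraFilter F).

Lemma ultra_pigeonhole (T : eqType) (s : seq T) (f : I -> T) :
  F [set i | f i \in s] -> exists x, F [set i | f i = x].
Proof.
have FF : ProperFilter F by exact: ultra_proper.
elim: s => [|x s IH] fs; first by have [i] := filter_ex fs.
case: (in_ultra_setVsetC [set i | f i = x] FU) => [?|fx]; first by exists x.
apply: IH; apply: filterS2 fs fx => i /= + /eqP; rewrite inE => /orP[->//|//].
Qed.

(** Balls are finite, so for each t a single value of l i t is taken on a set of the ultrafilter:
    the limit is an equality, not an approximation. *)
Lemma ultra_pointwise_limit (R : realType) (Gam : groupType) (S : gen_set Gam)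
    (A : Type) (l : I -> A -> Gam) :
  (forall t, exists B : R, F [set i | wdist R S 1%g (l i t) <= B]) ->
  exists l', forall t, F [set i | l i t = l' t].
Proof.
have FF : ProperFilter F by exact: ultra_proper.
move=> lB; suff /choice[l' ?] : forall t, exists g, F [set i | l i t = g].
  by exists l'.
move=> t; have [B HB] := lB t.
have [s sP] := word_ball_finite S (Num.truncn B).
apply: (@ultra_pigeonhole _ s); apply: filterS HB => i /=; rewrite wdist1 => HB.
by apply: sP; rewrite truncn_ge_nat// (le_trans _ HB).
Qed.

End Ultralimits.

(** * Endpoints and limits of vertex-valued quasi-geodesics *)

Section QuasiLines.
Context (R : realType) (Gam : groupType) (S : gen_set Gam) (delta : R).
Hypothesis hyp : forall o p q r : cayley R S,
  Num.min (gromov_product o p q) (gromov_product o q r) - delta <=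
  gromov_product o p r.
Local Notation cay := (cayley R S).
Local Notation bd := (boundary R S).
Local Notation gp := (gromov_product (vert 1%g : cay)).
Local Notation wd := (wdist R S).
Local Notation ql := (quasi_line wd).
Implicit Types (l : R -> Gam).

Definition vpath l : R -> cay := fun t => vert (l t).

Lemma word_morse (lambda eps : R) : 1 <= lambda -> 0 <= eps ->
  exists2 M, 0 <= M & forall l, ql lambda eps l ->
    forall s t u, s <= t -> t <= u -> gprod wd (l t) (l s) (l u) <= M.
Proof.
apply: (@morse R Gam wd delta).
- exact: wdistxx.
- exact: wdistC.
- exact: wdist_triangle.
- by move=> o a b c; rewrite -!gromov_product_vert; exact: hyp.
- exact: wdist_geodesic_steps.
Qed.

Lemma ql_opp lambda eps l : ql lambda eps l -> ql lambda eps (fun t => l (- t)).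
Proof. by move=> h s t; have := h (- s) (- t); rewrite -opprD normrN. Qed.

Lemma ql_shift lambda eps l a : ql lambda eps l -> ql lambda eps (fun t => l (t
  + a)).
Proof.
move=> h s t; have := h (s + a) (t + a).
by have -> : s + a - (t + a) = s - t by ring.
Qed.

Lemma ql_translate lambda eps l g :
  ql lambda eps l -> ql lambda eps (fun t => (g * l t)%g).
Proof. by move=> h s t; rewrite wdist_translate. Qed.

Lemma endpoint_gp_ge (l : R -> cay) (x : bd) :
  (forall A, exists T, forall t, T <= t -> gp_ge A (l t) x) -> endpoint_pinfty
    l x.
Proof.
move=> H t /cvgryPge tA; apply: (gp_ge_bclass hyp) => A.
have [T HT] := H A; have [N _ HN] := tA T.
by exists N => n Nn; apply: HT; exact: HN.
Qed.

Lemma endpoint_ninftyE (l : R -> cay) (x : bd) :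
  endpoint_ninfty l x <-> endpoint_pinfty (fun t => l (- t)) x.
Proof.
split=> H t.
  move=> /cvgryPge tA; apply: (H (fun n => - t n)); apply/cvgrNyPle => A.
  by apply: filterS (tA (- A)) => n /=; rewrite lerNl.
move=> /cvgrNyPle tA; have : (fun n => - t n) @ \oo --> +oo.
  by apply/cvgryPge => A; apply: filterS (tA (- A)) => n /=; rewrite lerNr.
by move=> /H; congr (bclass x _); apply/funext => n /=; rewrite opprK.
Qed.

Lemma cvg_natr : (fun n : nat => n%:R : R) @ \oo --> +oo.
Proof.
apply/cvgryPge => A; exists (Num.truncn A).+1 => // n /= An.
by apply: ltW; apply: lt_le_trans (truncnS_gt A) _; rewrite ler_nat.
Qed.

Lemma endpoint_unique (l : R -> cay) (x y : bd) :
  endpoint_pinfty l x -> endpoint_pinfty l y -> x = y.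
Proof. by move=> /(_ _ cvg_natr) + /(_ _ cvg_natr);
  exact: (boundary_eq hyp). Qed.

Lemma endpoint_translate (l : R -> Gam) (x : bd) g :
  endpoint_pinfty (vpath l) x ->
  endpoint_pinfty (vpath (fun t => (g * l t)%g)) (act g x).
Proof.
move=> lx t tA; exists (vpath l \o t); first exact: lx.
by apply/funext => n /=; exact: cayley_eq.
Qed.

Lemma endpoint_shift (l : R -> Gam) (x : bd) a :
  endpoint_pinfty (vpath l) x -> endpoint_pinfty (vpath (fun t => l (t + a))) x.
Proof.
move=> lx t /cvgryPge tA; apply: (lx (fun n => t n + a)); apply/cvgryPge => A.
by apply: filterS (tA (A - a)) => n /=; rewrite lerBlDr.
Qed.

Section Morse.
Context (lambda eps M : R).
Hypothesis lambda_ge1 : 1 <= lambda.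
Hypothesis morseM : forall l, ql lambda eps l ->
  forall s t u, s <= t -> t <= u -> gprod wd (l t) (l s) (l u) <= M.

(** The product at l 0 is the distance from l 0 to l s, which grows like s / lambda, minus the
    product at l s, which the Morse bound keeps below M; moving the base point to 1 costs b. *)
Lemma ql_gprod l b (s t : R) : ql lambda eps l -> wd 1%g (l 0) <= b ->
  0 <= s -> s <= t -> s / lambda - (eps + M + b) <= gprod wd 1%g (l s) (l t).
Proof.
move=> ll lb s0 st.
have := gprod_lip_base (wdistC R S) (@wdist_triangle R _ S) (l 0) 1%g (l s) (l
  t).
have : gprod wd (l 0) (l s) (l t) = wd (l s) (l 0) - gprod wd (l s) (l 0) (l t).
  rewrite /gprod (wdistC R S (l t) (l 0)) (wdistC R S (l t) (l s)).
  by rewrite (wdistC R S (l s) (l 0)); lra.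
have := morseM ll s0 st; have [+ _] := ll s 0; rewrite subr0 ger0_norm// mulrC.
rewrite (wdistC R S (l 0)); lra.
Qed.

Lemma ql_gp l b (s t : R) : ql lambda eps l -> wd 1%g (l 0) <= b ->
  0 <= s -> s <= t -> s / lambda - (eps + M + b) <= gp (vert (l s)) (vert (l
    t)).
Proof. by rewrite gromov_product_vert; exact: ql_gprod. Qed.

Lemma ql_endpoint l : ql lambda eps l -> exists x, endpoint_pinfty (vpath l) x.
Proof.
move=> ll; have lam0 : 0 < lambda by exact: lt_le_trans lambda_ge1.
have [b lb] : exists b, wd 1%g (l 0) <= b by exists (wd 1%g (l 0)).
have asym (s t : nat -> R) : s @ \oo --> +oo -> t @ \oo --> +oo ->
    asymptotic (vpath l \o s) (vpath l \o t).
  move=> /cvgryPge sA /cvgryPge tA; apply/asymptoticP => A.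
  pose B := Num.max 0 (lambda * (A + (eps + M + b))).
  have [N1 _ H1] := sA B; have [N2 _ H2] := tA B.
  exists (maxn N1 N2) => i j; rewrite !geq_max => /andP[i1 _] /andP[_ j2].
  have := H1 i i1; have := H2 j j2;
    rewrite /= !ge_max => /andP[tj0 tjB] /andP[si0 siB].
  have AB x : lambda * (A + (eps + M + b)) <= x -> A <= x / lambda - (eps + M +
    b).
    by rewrite lerBrDr ler_pdivlMr// mulrC.
  have [st|ts] := leP (s i) (t j).
    by apply: le_trans (ql_gp ll lb si0 st); exact: AB.
  rewrite gromov_productC; apply: le_trans (ql_gp ll lb tj0 (ltW ts));
    exact: AB.
exists (mk_boundary (asym _ _ cvg_natr cvg_natr)) => t tA.
apply: (asymptotic_bclass hyp (mk_boundaryP _)); exact: asym cvg_natr tA.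
Qed.

Lemma endpoint_gp_ge_path l b x t : ql lambda eps l -> wd 1%g (l 0) <= b ->
  endpoint_pinfty (vpath l) x -> 0 <= t ->
  gp_ge (t / lambda - (eps + M + b) - delta) (vert (l t)) x.
Proof.
move=> ll lb lx t0; have xl := lx _ cvg_natr.
apply: (gp_ge_ex (N := (Num.truncn t).+1) hyp xl) => j tj.
apply: ql_gp => //; apply: ltW; apply: lt_le_trans (truncnS_gt t) _.
by rewrite ler_nat.
Qed.

(** The Morse bound at time 0 keeps the products of l n and l (- n) bounded, so the two ends are not
    asymptotic. *)
Lemma endpoints_neq l x y : ql lambda eps l ->
  endpoint_pinfty (vpath l) x -> endpoint_ninfty (vpath l) y -> x != y.
Proof.
move=> ll lx ly; apply/eqP => xy; subst y; move/endpoint_ninftyE in ly.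
have /asymptoticP/(_ (M + wd 1%g (l 0) + 1))[N H] :=
  bclass_asymptotic hyp (lx _ cvg_natr) (ly _ cvg_natr).
have := H N N (leqnn _) (leqnn _); rewrite /= gromov_product_vert.
have N0 : 0 <= N%:R :> R by [].
have := morseM ll (ltac:(by rewrite oppr_le0) : - N%:R <= 0) N0.
rewrite (gprodC (wdistC R S)).
have := gprod_lip_base (wdistC R S) (@wdist_triangle R _ S) 1%g (l 0) (l N%:R)
  (l (- N%:R)).
lra.
Qed.

Section Limit.
Context (I : Type) (F : set_system I) (b : R) (ls : I -> R -> Gam) (l : R ->
  Gam).
Context {FF : Filter F}.
Hypothesis qls : forall i, ql lambda eps (ls i).
Hypothesis lsb : forall i, wd 1%g (ls i 0) <= b.
Hypothesis ll : ql lambda eps l.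
Hypothesis lb : wd 1%g (l 0) <= b.
Hypothesis lim : forall t, F [set i | ls i t = l t].

(** A nonnegative time at which the linear lower bound of [ql_gp] has reached A. *)
Let scale A : R := Num.max 0 (lambda * (A + (eps + M + b))).

Let scaleP A : 0 <= scale A /\ A <= scale A / lambda - (eps + M + b).
Proof.
have lam0 : 0 < lambda by exact: lt_le_trans lambda_ge1.
rewrite le_max lexx; split=> //.
by rewrite lerBrDr ler_pdivlMr// mulrC le_max lexx orbT.
Qed.

(** Agreement with l at one sufficiently late time is enough: the common point has large products
    with both endpoints. *)
Lemma limit_endpoint x xs : endpoint_pinfty (vpath l) x ->
  (forall i, endpoint_pinfty (vpath (ls i)) (xs i)) ->
  forall A, F [set i | (A%:E < boundary_gromov_product x (xs i))%E].
Proof.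
move=> lx lsx A; have [t0 tA] := scaleP (A + 1 + delta + delta).
apply: filterS (lim (scale (A + 1 + delta + delta))) => i /= lst.
have H1 := endpoint_gp_ge_path ll lb lx t0.
have := endpoint_gp_ge_path (qls i) (lsb i) (lsx i) t0; rewrite lst => H2.
apply: lt_le_trans (gp_ge_boundary hyp H1 H2).
rewrite lte_fin; lra.
Qed.

(** The times s i may vary with the line: beyond the time where line and limit agree, the point at s
    i still has a large product with the common point. *)
Lemma limit_path x (s : I -> R) : endpoint_pinfty (vpath l) x ->
  (forall A, F [set i | A <= s i]) ->
  forall A, F [set i | gp_ge A (vert (ls i (s i))) x].
Proof.
move=> lx sA A; have [t0 tA] := scaleP (A + delta + delta).
apply: filterS2 (lim (scale (A + delta + delta)))
  (sA (scale (A + delta + delta))) => i /= lst si.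
have := ql_gp (qls i) (lsb i) t0 si; rewrite lst => H1.
rewrite -[A](addrK delta); apply: (@gp_ge_step _ _ _ _ hyp _ _ (vert (l (scale
  (A + delta + delta))))).
  rewrite gromov_productC; apply: le_trans H1;
    have := hyperbolic_delta_ge0 hyp; lra.
apply: gp_ge_le (endpoint_gp_ge_path ll lb lx t0); lra.
Qed.

End Limit.

Lemma ql_ultralimit (I : Type) (F : set_system I) (FU : UltraFilter F) (b : R)
    (ls : I -> R -> Gam) :
  (forall i, ql lambda eps (ls i)) -> (forall i, wd 1%g (ls i 0) <= b) ->
  exists l, [/\ ql lambda eps l, wd 1%g (l 0) <= b &
    forall t, F [set i | ls i t = l t]].
Proof.
move=> qls lsb; have FF : ProperFilter F by exact: ultra_proper.
have [t|l lP] := ultra_pointwise_limit (R := R) (S := S) FU (l := ls).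
  exists (b + (lambda * `|t| + eps)); apply: filterS filterT => i _ /=.
  have := wdist_triangle R S 1%g (ls i 0) (ls i t); have := lsb i.
  have [_] := qls i 0 t; rewrite sub0r normrN; lra.
exists l; split=> //.
  move=> s t; have [i [/= <- <-]] := filter_ex (filterI (lP s) (lP t)).
  exact: qls.
by have [i /= <-] := filter_ex (lP 0).
Qed.

End Morse.
End QuasiLines.

(** * Rounding, recentring and existence of lines with endpoints in P *)

Section LinesInP.
Context (R : realType) (Gam : groupType) (S : gen_set Gam) (delta : R).
Hypothesis hyp : forall o p q r : cayley R S,
  Num.min (gromov_product o p q) (gromov_product o q r) - delta <=
  gromov_product o p r.
Local Notation cay := (cayley R S).
Local Notation bd := (boundary R S).
Local Notation gp := (gromov_product (vert 1%g : cay)).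
Local Notation wd := (wdist R S).
Local Notation ql := (quasi_line wd).
Implicit Types (l : R -> Gam) (P : set (bd * bd)).

(** The vertex-valued form of [QP], with the two endpoints as arguments. *)
Definition qline P (lambda eps b : R) l (x y : bd) :=
  [/\ ql lambda eps l, wd 1%g (l 0) <= b, endpoint_pinfty (vpath S l) x,
      endpoint_ninfty (vpath S l) y & P (x, y)].

Lemma qline_QP P lambda eps b l x y :
  qline P lambda eps b l x y -> QP P lambda eps b (vpath S l).
Proof.
case=> ll lb lx ly xy; split; last by exists x, y.
  by move=> s t; rewrite /vpath cay_dist_vert2.
by rewrite /vpath cay_dist_vert2 wdistC.
Qed.

Lemma qline_Gamma_plus P lambda eps b l x y t :
  qline P lambda eps b l x y -> 0 < t -> Gamma_plus P lambda eps b (l t).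
Proof.
move=> /qline_QP lQ t0; exists (vpath S l), t; split=> //.
by rewrite cay_dist_vert2 wdistxx.
Qed.

Lemma qline_QP_pinfty P lambda eps b l x y :
  qline P lambda eps b l x y -> QP_pinfty P lambda eps b x.
Proof. by move=> h; exists (vpath S l); [exact: qline_QP h|case: h]. Qed.

Lemma qline_move P lambda eps b l x y g (a : R) b' : group_invariant P ->
  qline P lambda eps b l x y -> wd 1%g (g * l a)%g <= b' ->
  qline P lambda eps b' (fun t => g * l (t + a))%g (act g x) (act g y).
Proof.
move=> Pg [ll lb lx ly xy] gl; split.
- exact/ql_translate/ql_shift.
- by rewrite add0r.
- exact/endpoint_translate/(endpoint_shift (l := l)).
- apply/endpoint_ninftyE; move/endpoint_ninftyE: ly => ly.
  have := endpoint_translate g (endpoint_shift (l := fun t => l (- t)) (- a)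
    ly).
  congr (endpoint_pinfty _ _); apply/funext => t; rewrite /vpath.
  by rewrite opprD opprK.
- exact: Pg.
Qed.

Lemma qline_opp P lambda eps b l x y : qline P lambda eps b l x y ->
  qline [set z | P (z.2, z.1)] lambda eps b (fun t => l (- t)) y x.
Proof.
case=> ll lb lx ly xy; split=> //; first exact: ql_opp.
- by rewrite oppr0.
- exact: (endpoint_ninftyE (vpath S l) y).1 ly.
- apply/endpoint_ninftyE; move: lx; congr (endpoint_pinfty _ _).
  by apply/funext => t; rewrite /vpath opprK.
Qed.

Lemma wdist_src_le (p : cay) a : wd (src p) a <= cay_dist p (vert a) + 1.
Proof.
rewrite cay_dist_vert -!/(wdist R S _ _); have /andP[p0 p1] := cay_posP p.
have := wdist_triangle R S (src p) (tgt p) a; have := wdist_tgt p.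
by rewrite minEle; case: ifP => _; lra.
Qed.

(* Rounding to vertices moves points by at most 1; the additive losses 6 and 1
   are not optimal. *)
Lemma QP_round P lambda eps b (l : R -> cay) (r : R -> Gam) x y :
  QP P lambda eps b l -> endpoint_pinfty l x -> endpoint_ninfty l y -> P (x,
    y) ->
  r 0 = src (l 0) ->
  (forall t, cay_dist (l t) (vert (r t)) <= 1) ->
  qline P lambda (eps + 6) (b + 1) r x y.
Proof.
move=> [ll lb _] lx ly xy r0 lr; split=> //.
- move=> s t; have [h1 h2] := ll s t; have := cay_dist_src2 (l s) (l t).
  have := wdist_src_le (l s) (r s); have := wdist_src_le (l t) (r t).
  have := lr s; have := lr t.
  have := wdist_triangle R S (src (l s)) (r s) (src (l t)).
  have := wdist_triangle R S (r s) (r t) (src (l t)).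
  have := wdist_triangle R S (r s) (src (l s)) (r t).
  have := wdist_triangle R S (src (l s)) (src (l t)) (r t).
  rewrite (wdistC R S (r s) (src (l s))) (wdistC R S (r t) (src (l t))).
  rewrite ler_norml => *; split; lra.
- rewrite r0 wdistC; apply: le_trans (wdist_src_le _ _) _; lra.
- by move=> t tA; apply: (bclass_round hyp (lx t tA)) => n /=.
- by move=> t tA; apply: (bclass_round hyp (ly t tA)) => n /=.
Qed.

Lemma Gamma_plus_qline P lambda eps b g : Gamma_plus P lambda eps b g ->
  exists l t x y, [/\ qline P lambda (eps + 6) (b + 1) l x y, 0 < t & l t = g].
Proof.
case=> l [t [lQ t0 ltg]]; have [_ _ [x [y [lx ly xy]]]] := lQ.
(* The value at t is set to g by hand: a representative of the vertex g may have its source at the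
   other end of an edge. *)
exists (fun s => if s == t then g else src (l s)), t, x, y; split=> //.
  apply: (QP_round lQ lx ly) => //; first by rewrite lt_eqF.
  move=> s; case: eqVneq => [->|_]; first by rewrite ltg.
  exact: cay_dist_src.
by rewrite eqxx.
Qed.

Lemma QP_pinfty_qline P lambda eps b x : QP_pinfty P lambda eps b x ->
  exists l y, qline P lambda (eps + 6) (b + 1) l x y.
Proof.
case=> l lQ lx; have [_ _ [x' [y [lx' ly xy]]]] := lQ.
have xx := endpoint_unique hyp lx lx'; subst x'.
exists (fun s => src (l s)), y; apply: (QP_round lQ lx ly) => // t.
exact: cay_dist_src.
Qed.

(** P is closed only off the diagonal, so the limits must be known to differ; for limits of lines
    this comes from [endpoints_neq]. *)
Lemma closed_limit P (I : Type) (F : set_system I) (xs ys : I -> bd) x y :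
  ProperFilter F -> closed_in_boundary2 P -> (forall i, P (xs i, ys i)) ->
  xs i @[i --> F] --> x -> ys i @[i --> F] --> y -> x != y -> P (x, y).
Proof.
move=> FF [C Cc PC] xsys xsx ysy xy; rewrite PC; split=> //=.
apply: (@closed_cvg _ _ F _ (fun i => (xs i, ys i)) C Cc).
  by apply: filterS filterT => i _; have := xsys i; rewrite PC => -[].
exact: (@cvg_pair _ _ _ F (nbhs x) (nbhs y)).
Qed.

(* Geodesic segments joining sequences tending to x and y pass near the
   identity, since (x.y) is bounded; an ultralimit of them is the line. *)
Lemma exists_geodesic_line (c : R) : exists b, forall x y : bd,
  (boundary_gromov_product x y < c%:E)%E ->
  exists l, [/\ ql 1 1 l, wd 1%g (l 0) <= b, endpoint_pinfty (vpath S l) x &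
    endpoint_ninfty (vpath S l) y].
Proof.
have d0 := hyperbolic_delta_ge0 hyp.
pose b : R := c + 1 + 2 * delta; exists b => x y xyc.
have [[u' xu'] [v' yv']] := (bclass_nonempty x, bclass_nonempty y).
have [u xu] : exists u, bclass x (fun n => vert (u n) : cay).
  by exists (fun n => src (u' n)); apply: (bclass_round hyp xu') => n;
    exact: cay_dist_src.
have [v yv] : exists v, bclass y (fun n => vert (v n) : cay).
  by exists (fun n => src (v' n)); apply: (bclass_round hyp yv') => n;
    exact: cay_dist_src.
have /choice[ij ijP] : forall N, exists ij : nat * nat,
    [/\ (N <= ij.1)%N, (N <= ij.2)%N & gprod wd 1%g (u ij.1) (v ij.2) <= c].
  move=> N; apply: contrapT => H.
  have : (c%:E <= boundary_gromov_product x y)%E.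
    apply: (boundary_gp_lb (N := N) xu yv) => i j Ni Nj;
      rewrite gromov_product_vert.
    by rewrite leNgt; apply/negP => h; apply: H; exists (i, j); split=> //;
      exact: ltW.
  by rewrite leNgt xyc.
have /choice[q qP] : forall N, exists q : nat * nat * (nat -> Gam),
    [/\ q.2 0%N = v (ij N).2, q.2 q.1.1 = u (ij N).1, (q.1.2 <= q.1.1)%N,
        wd 1%g (q.2 q.1.2) <= b &
        forall j k, (j <= k)%N -> (k <= q.1.1)%N -> wd (q.2 j) (q.2 k) = (k -
          j)%:R].
  move=> N; set a := u _; set a' := v _; have [_ _ ijN] := ijP N.
  have [n [p [p0 pn pd]]] := wdist_geodesic R S a' a.
  have dn : wd a' a = n%:R by rewrite -p0 -pn pd// subn0.
  (* The product of a and 1 based at a'. The point at this distance from a' on the geodesic is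
     within (a.a') + 2 delta of 1, and truncation adds 1; hence the value of b. *)
  pose s0 : R := (wd a' 1%g + n%:R - wd a 1%g) / 2.
  have s00 : 0 <= s0.
    rewrite divr_ge0// -dn; have := wdist_triangle R S a a' 1%g.
    rewrite (wdistC R S a a'); lra.
  have s0n : s0 <= n%:R.
    rewrite ler_pdivrMr// -dn; have := wdist_triangle R S a' a 1%g; lra.
  pose s := Num.truncn s0; have /andP[ss sS] : s%:R <= s0 < s.+1%:R by exact:
    truncn_itv.
  have sn : (s <= n)%N by rewrite -(ler_nat R) (le_trans ss).
  exists ((n, s), p); split=> //=.
  have := hyp (vert 1%g) (vert a) (vert (p s)) (vert a').
  have a's : wd a' (p s) = s%:R by rewrite -p0 pd// subn0.
  have sa : wd (p s) a = n%:R - s%:R by rewrite -pn pd// natrB.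
  rewrite !gromov_product_vert; move: ijN; rewrite -/a -/a' /gprod.
  rewrite (wdistC R S a a') dn (wdistC R S a (p s)) sa (wdistC R S (p s) a')
    a's.
  rewrite (wdistC R S 1%g (p s)) /b; move: sS ss; rewrite /s0 -(natr1 s).
  by rewrite minEle; case: ifP => _; lra.
have u_far (A : R) : exists N0, forall N,
  (N0 <= N)%N -> A <= wd 1%g (u (ij N).1).
  have /asymptoticP/(_ A)[N0 H] := bclass_converges xu; exists N0 => N NN.
  have [i1 _ _] := ijP N; have := H _ _ (leq_trans NN i1) (leq_trans NN i1).
  by rewrite /= gromov_product_vert /gprod wdistxx (wdistC R S _ 1%g); lra.
have v_far (A : R) : exists N0, forall N,
  (N0 <= N)%N -> A <= wd 1%g (v (ij N).2).
  have /asymptoticP/(_ A)[N0 H] := bclass_converges yv; exists N0 => N NN.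
  have [_ i1 _] := ijP N; have := H _ _ (leq_trans NN i1) (leq_trans NN i1).
  by rewrite /= gromov_product_vert /gprod wdistxx (wdistC R S _ 1%g); lra.
have window (A : R) : exists N0, forall N, (N0 <= N)%N ->
    A <= (q N).1.2%:R /\ A <= (q N).1.1%:R - (q N).1.2%:R.
  have [N1 H1] := u_far (A + b); have [N2 H2] := v_far (A + b).
  exists (maxn N1 N2) => N; rewrite geq_max => /andP[N1N N2N].
  have [q0 qn qs qb qd] := qP N; have := H1 N N1N; have := H2 N N2N.
  have := qd 0%N (q N).1.2 (leq0n _) qs; have := qd _ _ qs (leqnn _).
  rewrite q0 qn subn0 natrB// => e1 e2.
  have := wdist_triangle R S 1%g ((q N).2 (q N).1.2) (u (ij N).1).
  have := wdist_triangle R S 1%g ((q N).2 (q N).1.2) (v (ij N).2).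
  rewrite (wdistC R S ((q N).2 _) (v _)) e1 e2 => *; split; lra.
have [F [FU oF]] := ultraFilterLemma eventually_filter.
have FF : ProperFilter F by exact: ultra_proper.
(* Time 0 is placed at the point near 1. Truncating times to integers is the source of the additive
   constant 1. *)
pose idx N (t : R) := Num.truncn ((q N).1.2%:R + t).
pose ls N (t : R) := (q N).2 (idx N t).
have Fwin (A : R) : F [set N | A <= (q N).1.2%:R /\ A <= (q N).1.1%:R - (q
  N).1.2%:R].
  by apply: oF; have [N0 H] := window A; exists N0.
have idxP N (t : R) : `|t| <= (q N).1.2%:R -> `|t| <= (q N).1.1%:R - (q
  N).1.2%:R ->
    [/\ (idx N t)%:R <= (q N).1.2%:R + t, (q N).1.2%:R + t < (idx N t)%:R + 1 &
      (idx N t <= (q N).1.1)%N].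
  rewrite !ler_norml => /andP[t1 _] /andP[_ t2].
  have t0 : 0 <= (q N).1.2%:R + t by lra.
  have /andP[h1 h2] := truncn_itv t0; rewrite natr1; split=> //.
  by rewrite -(ler_nat R); apply: le_trans h1 _; lra.
have ls_dist N (s t : R) : `|s| <= (q N).1.2%:R -> `|s| <= (q N).1.1%:R - (q
  N).1.2%:R ->
    `|t| <= (q N).1.2%:R -> `|t| <= (q N).1.1%:R - (q N).1.2%:R ->
    `|s - t| - 1 <= wd (ls N s) (ls N t) /\ wd (ls N s) (ls N t) <= `|s - t| +
      1.
  move=> s1 s2 t1 t2; have [q0 qn qs qb qd] := qP N.
  have [i1 i2 i3] := idxP N s s1 s2; have [j1 j2 j3] := idxP N t t1 t2.
  have [ij_|/ltnW ji] := leqP (idx N s) (idx N t).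
    have ij_R : (idx N s)%:R <= (idx N t)%:R :> R by rewrite ler_nat.
    rewrite /ls qd// natrB//; case: (lerP 0 (s - t)) => st.
      by rewrite ger0_norm//; split; lra.
    by rewrite ltr0_norm//; split; lra.
  have ji_R : (idx N t)%:R <= (idx N s)%:R :> R by rewrite ler_nat.
  rewrite /ls wdistC qd// natrB//; case: (lerP 0 (s - t)) => st.
    by rewrite ger0_norm//; split; lra.
  by rewrite ltr0_norm//; split; lra.
have ls0 N : ls N 0 = (q N).2 (q N).1.2 by rewrite /ls /idx addr0 natrK.
have ls0b N : wd 1%g (ls N 0) <= b by rewrite ls0; have [] := qP N.
have [t|l lP] := ultra_pointwise_limit (R := R) (S := S) FU (l := ls).
  exists (b + (`|t| + 1)); apply: filterS (Fwin `|t|) => N /= [t1 t2].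
  have [||_] := ls_dist N 0 t _ _ t1 t2;
    rewrite ?normr0// ?(le_trans _ t1)// ?(le_trans _ t2)//.
  rewrite sub0r normrN; have := ls0b N.
  have := wdist_triangle R S 1%g (ls N 0) (ls N t); lra.
exists l; split.
- move=> s t; rewrite invr1 !mul1r.
  have [N [/= [<- <-] [[/= s1 s2] [t1 t2]]]] := filter_ex (filterI
    (filterI (lP s) (lP t)) (filterI (Fwin `|s|) (Fwin `|t|))).
  exact: ls_dist.
- by have [N /= <-] := filter_ex (lP 0).
- apply: (endpoint_gp_ge hyp) => A.
  pose T : R := `|A| + delta + b + 1; exists T => t Tt.
  have b0 : 0 <= b by apply: le_trans (ls0b 0%N); exact: wdist_ge0.
  have t1 : 1 <= t by have := normr_ge0 A; rewrite /T in Tt; lra.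
  have [N1 H1] := bclass_gp_ge hyp (A + delta) xu.
  have FN1 : F [set N | (N1 <= N)%N] by apply: oF; exists N1.
  have [N [/= lt [/= N1N [w1 w2]]]] := filter_ex (filterI (lP t)
    (filterI FN1 (Fwin `|t|))).
  have [q0 qn qs qb qd] := qP N; have [iN _ _] := ijP N.
  have H := H1 _ (leq_trans N1N iN); rewrite -[A](addrK delta).
  apply: (gp_ge_step hyp _ H); rewrite /vpath -lt gromov_product_vert -qn /ls.
  have [i1 i2 i3] := idxP N t w1 w2.
  have si : ((q N).1.2 <= idx N t)%N by rewrite -(ler_nat R); lra.
  have := gprod_lip_base (wdistC R S) (@wdist_triangle R _ S) ((q N).2 (q
    N).1.2) 1%g
    ((q N).2 (idx N t)) ((q N).2 (q N).1.1).
  rewrite {1}/gprod (wdistC R S _ ((q N).2 (q N).1.2)) (wdistC R S _ ((q N).2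
    (q N).1.2)).
  rewrite (wdistC R S _ 1%g) !qd// !natrB// => h.
  have := ler_norm A; rewrite /T in Tt; lra.
- apply/endpoint_ninftyE/(endpoint_gp_ge hyp) => A.
  pose T : R := `|A| + delta + b + 1; exists T => t Tt.
  have b0 : 0 <= b by apply: le_trans (ls0b 0%N); exact: wdist_ge0.
  have t1 : 1 <= t by have := normr_ge0 A; rewrite /T in Tt; lra.
  have [N1 H1] := bclass_gp_ge hyp (A + delta) yv.
  have FN1 : F [set N | (N1 <= N)%N] by apply: oF; exists N1.
  have [N [/= lt [/= N1N [w1 w2]]]] := filter_ex (filterI (lP (- t))
    (filterI FN1 (Fwin `|- t|))).
  have [q0 qn qs qb qd] := qP N; have [_ iN _] := ijP N.
  have H := H1 _ (leq_trans N1N iN); rewrite -[A](addrK delta).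
  apply: (gp_ge_step hyp _ H); rewrite /vpath -lt gromov_product_vert -q0 /ls.
  have [i1 i2 i3] := idxP N (- t) w1 w2.
  have si : (idx N (- t) <= (q N).1.2)%N by rewrite -(ler_nat R); lra.
  have := gprod_lip_base (wdistC R S) (@wdist_triangle R _ S) ((q N).2 (q
    N).1.2) 1%g
    ((q N).2 (idx N (- t))) ((q N).2 0%N).
  rewrite {1}/gprod (wdistC R S ((q N).2 (idx _ _)) ((q N).2 0%N)).
  rewrite (wdistC R S ((q N).2 (q N).1.2) 1%g) !qd// !subn0 !natrB// => h.
  have := ler_norm A; rewrite /T in Tt; lra.
Qed.

End LinesInP.

(** * Fellow travelling of quasi-geodesics with close endpoints *)

Section FellowTravel.
Context (R : realType) (Gam : groupType) (S : gen_set Gam) (delta : R).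
Hypothesis hyp : forall o p q r : cayley R S,
  Num.min (gromov_product o p q) (gromov_product o q r) - delta <=
  gromov_product o p r.
Local Notation wd := (wdist R S).
Local Notation ql := (quasi_line wd).

(** t' is a time at which l' is about as far from 1 as l t, namely r. Far out on the lines, the
    products of l t with l m, of l m with l' m and of l' m with l' t' are all at least r up to a
    constant, the middle one because r <= A; two four-point steps then bring l t and l' t'
    together. *)
Lemma fellow_travel (lambda eps b : R) : 1 <= lambda -> 0 <= eps ->
  exists C : R, forall l l' (x x' : boundary R S) (A : R),
    ql lambda eps l -> ql lambda eps l' ->
    wd 1%g (l 0) <= b -> wd 1%g (l' 0) <= b ->
    endpoint_pinfty (vpath S l) x -> endpoint_pinfty (vpath S l') x' ->
    (A%:E < boundary_gromov_product x x')%E ->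
    forall t, 0 <= t -> lambda * t + eps + b <= A ->
    exists2 t', 0 <= t' & wd (l t) (l' t') <= C.
Proof.
move=> lam1 eps0; have lam0 : 0 < lambda by exact: lt_le_trans lam1.
have d0 := hyperbolic_delta_ge0 hyp.
have [M M0 MP] := word_morse hyp lam1 eps0.
exists (`|lambda + eps + 2 * (2 * b + M) + 8 * delta| + 2 * b).
move=> l l' x x' A ll ll' lb lb' lx lx' Axx t t0 tA.
have b0 : 0 <= b by apply: le_trans lb; exact: wdist_ge0.
set r := wd 1%g (l t).
have rA : r <= A.
  apply: le_trans tA; have [_] := ll 0 t; rewrite sub0r normrN ger0_norm//.
  have := wdist_triangle R S 1%g (l 0) (l t); rewrite -/r; lra.
have far p s s' : ql lambda eps p -> wd 1%g (p 0) <= b -> 0 <= s -> s <= s' ->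
    wd 1%g (p s) - (2 * b + M) <= gprod wd 1%g (p s) (p s').
  move=> lp pb s0 ss; have := MP p lp 0 s s' s0 ss.
  have := gprod_lip_base (wdistC R S) (@wdist_triangle R _ S) (p 0) 1%g (p s)
    (p s').
  rewrite /gprod (wdistC R S (p 0) 1%g) (wdistC R S (p s') (p s)).
  rewrite (wdistC R S (p s') (p 0)) (wdistC R S (p s) (p 0)).
  have := wdist_triangle R S 1%g (p 0) (p s); lra.
have [rl|lr] := leP r (wd 1%g (l' 0)).
  exists 0; rewrite ?lexx//.
  have := wdist_triangle R S (l t) 1%g (l' 0);
    rewrite (wdistC R S (l t) 1%g) -/r.
  have := normr_ge0 (lambda + eps + 2 * (2 * b + M) + 8 * delta); lra.
have ex : exists n, r <= wd 1%g (l' n%:R).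
  pose n := (Num.truncn (lambda * (r + eps + b))).+1; exists n.
  have : lambda * (r + eps + b) < n%:R by exact: truncnS_gt.
  rewrite -ltr_pdivlMl// mulrC => h.
  have [+ _] := ll' 0 n%:R; rewrite sub0r normrN ger0_norm// mulrC.
  have := wdist_triangle R S (l' 0) 1%g (l' n%:R);
    rewrite (wdistC R S (l' 0) 1%g); lra.
have [n nr nmin] := ex_minnP ex.
have n0 : (0 < n)%N by rewrite lt0n; apply: contraTneq nr => ->; rewrite -ltNge.
have rn : wd 1%g (l' n%:R) <= r + (lambda + eps).
  have pr : wd 1%g (l' n.-1%:R) < r.
    by rewrite ltNge; apply/negP => /nmin; rewrite leqNgt prednK// leqnn.
  have [_] := ll' n.-1%:R n%:R.
  have -> : n.-1%:R - n%:R = -1 :> R by rewrite -{2}(prednK n0) -natr1; ring.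
  rewrite normrN normr1.
  have := wdist_triangle R S 1%g (l' n.-1%:R) (l' n%:R); lra.
exists n%:R => //.
have [N HN] := boundary_gp_gt hyp Axx (lx _ (@cvg_natr R)) (lx' _ (@cvg_natr
  R)).
pose m := maxn N (maxn n (Num.truncn t).+1).
have Nm : (N <= m)%N by rewrite leq_maxl.
have nm : n%:R <= m%:R :> R by rewrite ler_nat /m !leq_max leqnn orbT.
have tm : t <= m%:R.
  apply: ltW; apply: lt_le_trans (truncnS_gt t) _.
  by rewrite ler_nat /m !leq_max leqnn !orbT.
have h1 := far l t m%:R ll lb t0 tm.
have h2 := HN m m Nm Nm; rewrite /= gromov_product_vert in h2.
have h3 := far l' n%:R m%:R ll' lb' (ler0n _ _) nm.
have := hyp (vert 1%g) (vert (l t)) (vert (l m%:R)) (vert (l' m%:R)).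
have := hyp (vert 1%g) (vert (l t)) (vert (l' m%:R)) (vert (l' n%:R)).
rewrite !gromov_product_vert (gprodC (wdistC R S) _ (l' m%:R) (l' n%:R)).
have : gprod wd 1%g (l t) (l' n%:R) = (r + wd 1%g (l' n%:R) - wd (l t) (l'
  n%:R)) / 2.
  by rewrite /gprod (wdistC R S (l t) 1%g) (wdistC R S (l' n%:R) 1%g).
have := ler_norm (lambda + eps + 2 * (2 * b + M) + 8 * delta).
rewrite -/r in h1; rewrite !minEle; do 2 case: ifP => _; lra.
Qed.

End FellowTravel.

(** * Domination along quasi-geodesics *)

Section Representation.
Context (R : realType) (Gam : groupType) (S : gen_set Gam) (d : nat).
Context (rho : Gam -> 'M[R]_d).
Hypothesis rep : is_representation rho.
Local Notation N := (@euclid_norm R d).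

Lemma rho_unit g : rho g \in unitmx. Proof. by case: rep. Qed.

Lemma rhoM g h : rho (g * h)%g = rho g *m rho h. Proof. by case: rep. Qed.

Lemma rhoV g : rho g^-1%g = invmx (rho g).
Proof.
have [_ r1 rM] := rep; rewrite -[LHS]mulmx1 -(mulmxV (rho_unit g)) mulmxA.
by rewrite -rM mulVg r1 mul1mx.
Qed.

Lemma rhoK g (v : 'cV[R]_d) : rho g^-1%g *m (rho g *m v) = v.
Proof. by rewrite rhoV mulKmx ?rho_unit. Qed.

Lemma rhoVK g (v : 'cV[R]_d) : rho g *m (rho g^-1%g *m v) = v.
Proof. by rewrite rhoV mulKVmx ?rho_unit. Qed.

Lemma rho_bounded : exists2 L : R, 1 <= L & forall g v,
  N (rho g *m v) <= L ^+ word_length S g * N v.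
Proof.
have [_ r1 rM] := rep.
have [L L1 LP] : exists2 L : R, 1 <= L & forall g, g \in gens S -> forall v,
    N (rho g *m v) <= L * N v.
  elim: (gens S) => [|g s [L L1 IH]]; first by exists 1.
  have [C C1 HC] := mulmx_bounded (rho g); exists (Num.max C L).
    by rewrite le_max C1.
  move=> h; rewrite inE => /orP[/eqP ->|hs] v.
    by apply: le_trans (HC v) _; rewrite ler_wpM2r ?euclid_norm_ge0// le_max
      lexx.
  apply: le_trans (IH h hs v) _; rewrite ler_wpM2r ?euclid_norm_ge0//.
  by rewrite le_max lexx orbT.
exists L => // g; have [w [<- wS ->]] := word_lengthP S g.
elim: w wS => [_ v|h w IH /= /andP[hS wS] v].
  by rewrite big_nil r1 mul1mx expr0 mul1r.
rewrite big_cons rM -mulmxA; apply: le_trans (LP h hS _) _.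
by rewrite exprS -mulrA ler_wpM2l ?(le_trans ler01)// IH.
Qed.

Lemma rho_bounded_ball (b : R) : exists2 L : R, 1 <= L & forall g,
  wdist R S 1%g g <= b ->
  forall v, N (rho g *m v) <= L * N v /\ N v <= L * N (rho g *m v).
Proof.
have [L L1 LP] := rho_bounded; exists (L ^+ (Num.truncn b));
  first exact: exprn_ege1.
move=> g; rewrite wdist1 => gb.
have nb : (word_length S g <= Num.truncn b)%N.
  by rewrite truncn_ge_nat// (le_trans _ gb).
have le h v : (word_length S h <= Num.truncn b)%N ->
    N (rho h *m v) <= L ^+ Num.truncn b * N v.
  move=> hb; apply: le_trans (LP h v) _; rewrite ler_wpM2r ?euclid_norm_ge0//.
  exact: ler_weXn2l.
move=> v; split; first exact: le.
by rewrite -{1}(rhoK g v); apply: le; rewrite word_lengthV.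
Qed.

Lemma mxlin_rhoK g (V : {vspace 'cV[R]_d}) :
  (mxlin (rho g) @: (mxlin (rho g^-1%g) @: V))%VS = V.
Proof.
rewrite -limg_comp; have -> : (mxlin (rho g) \o mxlin (rho g^-1%g))%VF = \1%VF.
  by apply/lfunP => v; rewrite comp_lfunE id_lfunE !lfunE/= rhoVK.
exact: lim1g.
Qed.

End Representation.

(** * Uniform contraction from the dynamics of the limit maps *)

Section Dynamics.
Context (R : realType) (Gam : groupType) (S : gen_set Gam) (delta : R).
Hypothesis hyp : forall o p q r : cayley R S,
  Num.min (gromov_product o p q) (gromov_product o q r) - delta <=
  gromov_product o p r.
Context (P : set (boundary R S * boundary R S)) (d k : nat) (rho : Gam ->
  'M[R]_d).
Context (xi1 xi2 : boundary R S -> {vspace 'cV[R]_d}).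
Hypothesis Pc : closed_in_boundary2 P.
Hypothesis Pinv : group_invariant P.
Hypothesis kd : (1 <= k <= d.-1)%N.
Hypothesis rep : is_representation rho.
Hypothesis lim : limit_maps k P rho xi1 xi2.
Local Notation bd := (boundary R S).
Local Notation wd := (wdist R S).
Local Notation N := (@euclid_norm R d).

Lemma xi1_dim x y : P (x, y) -> \dim (xi1 x) = k.
Proof. by move=> xy; case: lim => -[+ _] _ _ _ _; apply; exists y. Qed.

Lemma xi2_dim x y : P (x, y) -> \dim (xi2 y) = (d - k)%N.
Proof. by move=> xy; case: lim => -[_ +] _ _ _ _; apply; exists x. Qed.

Lemma xi1_act g x y : P (x, y) -> xi1 (act g x) = (mxlin (rho g) @: xi1 x)%VS.
Proof. by move=> xy; case: lim => _ [+ _] _ _ _; apply; exists y. Qed.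

Lemma xi2_act g x y : P (x, y) -> xi2 (act g y) = (mxlin (rho g) @: xi2 y)%VS.
Proof. by move=> xy; case: lim => _ [_ +] _ _ _; apply; exists x. Qed.

Lemma xi1_mem g x y e : P (x, y) -> e \in xi1 x -> rho g *m e \in xi1 (act g x).
Proof.
by move=> xy ex; rewrite (xi1_act g xy); apply/memv_imgP; exists e;
  rewrite ?lfunE.
Qed.

Lemma xi2_mem g x y e : P (x, y) -> e \in xi2 y -> rho g *m e \in xi2 (act g y).
Proof.
by move=> xy ey; rewrite (xi2_act g xy); apply/memv_imgP; exists e;
  rewrite ?lfunE.
Qed.

Lemma xi_disjoint x y : P (x, y) -> (xi1 x :&: xi2 y)%VS = 0%VS.
Proof. by move=> xy; case: lim => _ _ _ + _ => /(_ x y xy)[]. Qed.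

Lemma k_gt0 : (0 < k)%N. Proof. by case/andP: kd. Qed.

Lemma dk_gt0 : (0 < d - k)%N. Proof. by case/andP: kd => k0 kd1; lia. Qed.

(** Continuity concerns the pair of maps on P, so the two endpoints converge together and inside
    P. *)
Lemma xi_dist_cvg (I : Type) (F : set_system I) (xs ys : I -> bd) x y :
  Filter F -> (forall i, P (xs i, ys i)) -> P (x, y) ->
  xs i @[i --> F] --> x -> ys i @[i --> F] --> y ->
  forall eta : R, 0 < eta -> F [set i | grass_dist (xi1 (xs i)) (xi1 x) < eta /\
    grass_dist (xi2 (ys i)) (xi2 y) < eta].
Proof.
move=> FF xsys xy xsx ysy eta eta0; have [_ _ cont _ _] := lim.
have cw : (fun i => (xs i, ys i)) @ F --> within P (nbhs (x, y)).
  move=> U UP; have : F ((fun i => (xs i, ys i)) @^-1` [set z | P z -> U z]).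
    exact: (@cvg_pair _ _ _ F (nbhs x) (nbhs y) _ _ _ _ _ xsx ysy) UP.
  by apply: (@filterS _ F _) => i /= h; exact: h (xsys i).
have cm := cvg_comp _ _ cw (cont (x, y) xy).
have := @cvgr0_norm_lt _ _ _ F FF _ cm eta eta0.
apply: (@filterS _ F _) => i /=; rewrite ger0_norm.
  by rewrite gt_max => /andP[].
by rewrite le_max grass_dist_ge0.
Qed.

Lemma xi_cvg (I : Type) (F : set_system I) (xs ys : I -> bd) x y :
  Filter F -> (forall i, P (xs i, ys i)) -> P (x, y) ->
  xs i @[i --> F] --> x -> ys i @[i --> F] --> y ->
  subspace_cvg F (fun i => xi1 (xs i)) (xi1 x) /\
  subspace_cvg F (fun i => xi2 (ys i)) (xi2 y).
Proof.
move=> FF xsys xy xsx ysy; have H := xi_dist_cvg FF xsys xy xsx ysy.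
split=> eta eta0; apply: filterS (H eta eta0) => i /= [h1 h2].
  by have [] := grass_dist_lt _ _ h1;
    rewrite ?(xi1_dim (xsys i)) ?(xi1_dim xy) ?k_gt0.
by have [] := grass_dist_lt _ _ h2;
  rewrite ?(xi2_dim (xsys i)) ?(xi2_dim xy) ?dk_gt0.
Qed.

(** The dynamics are given for sequences: if convergence failed along F, indices picked from sets of
    F would form a sequence violating them. The partner y' of x provides the dimension of [xi1 x]; y
    need not form a pair with x. *)
Lemma dynamics_ultrafilter (I : Type) (F : set_system I) (lambda eps b : R)
    (gam : I -> Gam) (x y y' : bd) :
  UltraFilter F -> 1 <= lambda -> 0 <= eps -> 0 <= b -> P (x, y') ->
  (forall i, Gamma_plus P lambda eps b (gam i)) ->
  (forall A, F [set i | gp_ge A (vert (gam i)) x]) ->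
  (forall A, F [set i | gp_ge A (vert (gam i)^-1%g) y]) ->
  forall V, Grass k V -> transverse V (xi2 y) ->
  subspace_cvg F (fun i => mxlin (rho (gam i)) @: V)%VS (xi1 x).
Proof.
move=> FU lam1 eps0 b0 xy' gamP gx gy V Vk Vy eta eta0.
have FF : ProperFilter F by exact: ultra_proper.
case: (in_ultra_setVsetC [set i | subspace_within eta (mxlin (rho (gam i)) @:
  V)%VS
  (xi1 x)] FU) => // bad; exfalso.
have /choice[s sP] : forall n : nat, exists i, [/\ gp_ge n%:R (vert (gam i)) x,
    gp_ge n%:R (vert (gam i)^-1%g) y &
    ~ subspace_within eta (mxlin (rho (gam i)) @: V)%VS (xi1 x)].
  move=> n; have [i [/= h1 [h2 h3]]] := filter_ex (filterI bad (filterI (gx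
    n%:R) (gy n%:R))).
  by exists i.
have cls (g : I -> Gam) (z : bd) : (forall n : nat,
  gp_ge n%:R (vert (g (s n))) z) ->
    bclass z (fun n => vert (g (s n))).
  move=> gz; apply: (gp_ge_bclass hyp) => A; exists (Num.truncn A).+1 => n An.
  apply: gp_ge_le (gz n); apply: ltW; apply: lt_le_trans (truncnS_gt A) _.
  by rewrite ler_nat.
have [_ _ _ _ dyn] := lim.
have := dyn lambda eps b lam1 eps0 b0 x y (gam \o s) (fun n => gamP (s n)).
move=> /(_ (cls gam x (fun n => let: And3 h _ _ := sP n in h))).
move=> /(_ (cls (fun i => (gam i)^-1%g) y (fun n => let: And3 _ h _ := sP n in
  h))).
move=> /(_ V Vk Vy)/cvgr0_norm_lt/(_ eta eta0)/filter_ex[n /=].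
rewrite ger0_norm ?grass_dist_ge0// => h.
have [_ _] := sP n; apply; apply: (grass_dist_lt _ _ h).1.
  rewrite limg_dim_eq ?Vk ?k_gt0//; apply/eqP; rewrite -subv0; apply/subvP => v.
  move=> /memv_capP[_]; rewrite memv_ker lfunE/= memv0 => /eqP rv.
  by rewrite -[v](rhoK rep (gam (s n))) rv mulmx0.
by rewrite (xi1_dim xy') k_gt0.
Qed.

(** Compactness of the lines in P that pass near the identity. The last clause says that points
    escaping along the lines tend to the limit endpoints. *)
Lemma qline_ultralimit (lambda eps b : R) (I : Type) (F : set_system I)
    (ls : I -> R -> Gam) (xs ys : I -> bd) :
  UltraFilter F -> 1 <= lambda -> 0 <= eps ->
  (forall i, qline P lambda eps b (ls i) (xs i) (ys i)) ->
  exists l x y, [/\ qline P lambda eps b l x y,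
    xs i @[i --> F] --> x, ys i @[i --> F] --> y &
    forall s : I -> R, (forall A, F [set i | A <= s i]) -> forall A,
      F [set i | gp_ge A (vert (ls i (s i))) x] /\
      F [set i | gp_ge A (vert (ls i (- s i))) y]].
Proof.
move=> FU lam1 eps0 lsq; have FF : ProperFilter F by exact: ultra_proper.
have [M M0 MP] := word_morse hyp lam1 eps0.
have qls i : quasi_line wd lambda eps (ls i) by case: (lsq i).
have lsb i : wd 1%g (ls i 0) <= b by case: (lsq i).
have [l [ll lb lsl]] := ql_ultralimit FU qls lsb.
have [x lx] := ql_endpoint hyp lam1 MP ll.
have [y ly] := ql_endpoint hyp lam1 MP (ql_opp ll).
have qls' i := ql_opp (qls i).
have lsb' i : wd 1%g (ls i (- 0)) <= b by rewrite oppr0.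
have lb' : wd 1%g (l (- 0)) <= b by rewrite oppr0.
have lsl' t : F [set i | ls i (- t) = l (- t)] by exact: lsl.
have xsx : xs i @[i --> F] --> x.
  apply: boundary_cvg; apply: (limit_endpoint hyp lam1 MP qls lsb ll lb lsl lx)
    => i.
  by case: (lsq i).
have ysy : ys i @[i --> F] --> y.
  apply: boundary_cvg.
  apply: (limit_endpoint hyp lam1 MP qls' lsb' (ql_opp ll) lb' lsl' ly) => i.
  by case: (lsq i) => _ _ _ h _; exact: (endpoint_ninftyE (vpath S (ls i)) (ys
    i)).1 h.
have ly' : endpoint_ninfty (vpath S l) y by exact: (endpoint_ninftyE (vpath S
  l) y).2 ly.
exists l, x, y; split=> //.
  split=> //; have xy := endpoints_neq hyp MP ll lx ly'.
  by apply: (closed_limit FF Pc _ xsx ysy xy) => i; case: (lsq i).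
move=> s sF A; split; first exact: (limit_path hyp lam1 MP qls lsb ll lb lsl lx
  sF).
exact: (limit_path hyp lam1 MP qls' lsb' (ql_opp ll) lb' lsl' ly sF).
Qed.

(** Otherwise there are lines l_n with bad vectors at times t_n > n. Put g_n = l_n(t_n) and let m_n
    be l_n recentred there. Both families have ultralimits, g_n and g_n^-1 tend to endpoints of the
    two limits, and rho(g_n) carries the fibres of m_n to those of l_n, so the tilting argument
    applies. *)
Lemma contraction (lambda eps c : R) : 1 <= lambda -> 0 <= eps -> 0 < c ->
  exists T : R, forall l x y t, qline P lambda eps 0 l x y -> T <= t ->
    forall e f, e \in xi1 x -> f \in xi2 y ->
    N (rho (l t)^-1%g *m e) * N f <= c * (N (rho (l t)^-1%g *m f) * N e).
Proof.
move=> lam1 eps0 c0; apply: contrapT => noT.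
have [M M0 MP] := word_morse hyp lam1 eps0.
have /choice[q qP] : forall n : nat, exists q : (R -> Gam) * bd * bd * R,
    let: (l, x, y, t) := q in
    [/\ qline P lambda eps 0 l x y, n%:R < t &
    exists e f, [/\ e \in xi1 x, f \in xi2 y &
    c * (N (rho (l t)^-1%g *m f) * N e) < N (rho (l t)^-1%g *m e) * N f]].
  move=> n; apply: contrapT => H; apply: noT;
    exists (n%:R + 1) => l x y t lq nt e f ex fy.
  rewrite leNgt; apply/negP => h; apply: H; exists (l, x, y, t); split=> //.
    by apply: lt_le_trans nt; rewrite ltrDl.
  by exists e, f.
pose l n := (q n).1.1.1; pose x n := (q n).1.1.2; pose y n := (q n).1.2;
  pose t n := (q n).2.
have {}qP n : [/\ qline P lambda eps 0 (l n) (x n) (y n), n%:R < t n &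
    exists e f, [/\ e \in xi1 (x n), f \in xi2 (y n) &
    c * (N (rho (l n (t n))^-1%g *m f) * N e) <
      N (rho (l n (t n))^-1%g *m e) * N f]].
  by have := qP n; rewrite /l /x /y /t; case: (q n) => [[[]]].
have lq n : qline P lambda eps 0 (l n) (x n) (y n) by case: (qP n).
pose g n := l n (t n); pose m n (s : R) := ((g n)^-1 * l n (s + t n))%g.
pose x' n := act (g n)^-1%g (x n); pose y' n := act (g n)^-1%g (y n).
have mq n : qline P lambda eps 0 (m n) (x' n) (y' n).
  by apply: (qline_move Pinv (lq n)); rewrite mulVg wdistxx.
have l0 n : l n 0 = 1%g.
  by have [_ + _ _ _] := lq n => h;
    apply/esym/(wdist_eq0 (R := R) (S := S))/eqP;
     rewrite eq_le h wdist_ge0.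
have [F [FU oF]] := ultraFilterLemma eventually_filter.
have FF : ProperFilter F by exact: ultra_proper.
have tF A : F [set n | A <= t n].
  apply: oF; exists (Num.truncn A).+1 => // n /= An; apply: ltW.
  have [_ + _] := qP n; apply: le_lt_trans; apply: ltW.
  by apply: lt_le_trans (truncnS_gt A) _; rewrite ler_nat.
have [l' [x1 [y1 [lq' xx1 yy1 lF]]]] := qline_ultralimit FU lam1 eps0 lq.
have [m' [x2 [y2 [mq' xx2 yy2 mF]]]] := qline_ultralimit FU lam1 eps0 mq.
have P1 : P (x1, y1) by case: lq'.
have P2 : P (x2, y2) by case: mq'.
have Pn n : P (x n, y n) by case: (lq n).
have Pn' n : P (x' n, y' n) by exact: Pinv.
have gx A : F [set n | gp_ge A (vert (g n)) x1] by have [] := lF t tF A.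
have gy A : F [set n | gp_ge A (vert (g n)^-1%g) y2].
  have [_] := mF t tF A; apply: filterS => n /=.
  by rewrite /m addNr l0 mulg1.
have gP n : Gamma_plus P lambda eps 0 (g n).
  apply: (qline_Gamma_plus (lq n)); have [_ + _] := qP n.
  by apply: le_lt_trans.
have dyn := dynamics_ultrafilter FU lam1 eps0 (lexx 0) P1 gP gx gy.
have [Ex1 Fx1] := xi_cvg _ Pn P1 xx1 yy1.
have [Ex2 Fx2] := xi_cvg _ Pn' P2 xx2 yy2.
have xiK n : (mxlin (rho (g n)) @: xi1 (x' n))%VS = xi1 (x n).
  by rewrite (xi1_act _ (Pn n)) mxlin_rhoK.
have yiK n : (mxlin (rho (g n)) @: xi2 (y' n))%VS = xi2 (y n).
  by rewrite (xi2_act _ (Pn n)) mxlin_rhoK.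
(* The bad pair is pulled back to the fibres of m_n. Replacing the pulled-back f by a near-maximal
   vector costs the factor 2, and the failure of contraction contributes 1 / c. *)
have /choice[vh vhP] : forall n, exists vh : 'cV[R]_d * 'cV[R]_d,
    [/\ vh.1 \in xi1 (x' n) /\ N vh.1 = 1, vh.2 \in xi2 (y' n) /\ N vh.2 = 1,
      N (rho (g n) *m vh.1) <= 2 / c * N (rho (g n) *m vh.2) &
      forall h, h \in xi2 (y' n) ->
        N (rho (g n) *m h) <= 2 * N (rho (g n) *m vh.2) * N h].
  move=> n; have [_ _ [e [f [ex fy]]]] := qP n; rewrite -/(g n) => ef.
  have [|h [hy h1 hmax]] := @exists_near_maximal_vector R d (rho (g n)) (xi2
    (y' n)) (rho_unit rep _).
    by rewrite (xi2_dim (Pn' n)) dk_gt0.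
  pose v := rho (g n)^-1%g *m e; pose z := rho (g n)^-1%g *m f.
  have vx : v \in xi1 (x' n) by exact: xi1_mem (Pn n) ex.
  have zy : z \in xi2 (y' n) by exact: xi2_mem (Pn n) fy.
  have ev : e = rho (g n) *m v by rewrite /v rhoVK.
  have fz : f = rho (g n) *m z by rewrite /z rhoVK.
  have v0 : v != 0.
    apply: contraTneq ef; rewrite -leNgt -/v => ->; rewrite euclid_norm0 mul0r.
    by rewrite !mulr_ge0 ?euclid_norm_ge0// ltW.
  have nv : 0 < N v by rewrite euclid_norm_gt0.
  exists ((N v)^-1 *: v, h); split=> //=.
    rewrite memvZ//; split=> //.
    by rewrite euclid_normZ gtr0_norm ?invr_gt0// mulVf// gt_eqF.
  have := hmax z zy; move: ef; rewrite -/v -/z -fz => ef fh.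
  rewrite -scalemxAr -ev euclid_normZ gtr0_norm ?invr_gt0// ler_pdivrMl//.
  have nz : 0 < N z.
    rewrite euclid_norm_gt0; apply: contraTneq ef => z0.
    by rewrite -leNgt fz z0 mulmx0 euclid_norm0 !mul0r !mulr0.
  rewrite -(ler_pM2l c0) -(ler_pM2l nz).
  have -> : N z * (c * (N v * (2 / c * N (rho (g n) *m h)))) =
    N v * (2 * N (rho (g n) *m h) * N z) by field; rewrite gt_eqF.
  apply: le_trans (_ : N v * N f <= _); last by rewrite ler_pM2l.
  by apply: ltW; apply: le_lt_trans ef; rewrite mulrCA.
apply: (@tilted_subspace_contradiction R d nat F FU k (fun n => rho (g n))
  (fun n => xi1 (x' n)) (fun n => xi2 (y' n)) (xi1 x2) (xi2 y2) (xi1 x1) (xi2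
    y1)
  _ _ _ _ _ _ _ _ _ _ dyn (2 / c) (fun n => (vh n).1) (fun n => (vh n).2)) =>
    //.
- by case/andP: kd => _ kd1; rewrite (leq_trans kd1)// leq_pred.
- exact: xi1_dim P2.
- exact: xi2_dim P2.
- by move=> n; exact: xi2_dim (Pn' n).
- exact: xi_disjoint.
- exact: xi_disjoint.
- by under eq_fun do rewrite xiK.
- by under eq_fun do rewrite yiK.
- by move=> n; exact: rho_unit.
- by move=> n; case: (vhP n).
- by move=> n; case: (vhP n).
- by move=> n; case: (vhP n).
- by move=> n; case: (vhP n).
Qed.

End Dynamics.

(** * From one contraction to an exponential rate, for every base point and both directions *)

Section ExponentialDomination.
Context (R : realType) (Gam : groupType) (S : gen_set Gam) (d : nat).
Context (rho : Gam -> 'M[R]_d).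
Hypothesis rep : is_representation rho.
Local Notation bd := (boundary R S).
Local Notation wd := (wdist R S).
Local Notation N := (@euclid_norm R d).
Implicit Types (P : set (bd * bd)) (xi : bd -> {vspace 'cV[R]_d}).

(** Invariance alone is recorded, so that the same lemmas serve for the reversed set with xi1 and
    xi2 exchanged. *)
Definition invariant_bundle P (xi1 xi2 : bd -> {vspace 'cV[R]_d}) :=
  forall g x y, P (x, y) ->
    (forall e, e \in xi1 x -> rho g *m e \in xi1 (act g x)) /\
    (forall f, f \in xi2 y -> rho g *m f \in xi2 (act g y)).

(** The ratio is written as a product to avoid dividing by norms, and for the inverse matrix because
    this is the hypothesis of [singular_gap]. *)
Definition exp_dominated P xi1 xi2 (lambda eps b : R) := exists C mu : R,
  [/\ 0 < C, 0 < mu & forall l x y t, qline P lambda eps b l x y -> 0 <= t ->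
    forall e f, e \in xi1 x -> f \in xi2 y ->
    N (rho (l t)^-1%g *m e) * N f <=
    C * expR (- (mu * t)) * (N (rho (l t)^-1%g *m f) * N e)].

Section Bundle.
Context (P : set (bd * bd)) (xi1 xi2 : bd -> {vspace 'cV[R]_d}).
Hypothesis Pinv : group_invariant P.
Hypothesis xiP : invariant_bundle P xi1 xi2.
Context (lambda eps : R).
Hypothesis lambda_ge1 : 1 <= lambda.

(* The domination ratio is submultiplicative along quasi-geodesics. *)
Lemma exp_dominated_of_contraction :
  (exists T : R, forall l x y t, qline P lambda eps 0 l x y -> T <= t ->
    forall e f, e \in xi1 x -> f \in xi2 y ->
    N (rho (l t)^-1%g *m e) * N f <= 2^-1 * (N (rho (l t)^-1%g *m f) * N e)) ->
  exp_dominated P xi1 xi2 lambda eps 0.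
Proof.
move=> [T0 T0P]; pose T : R := Num.max T0 1.
have T1 : 1 <= T by rewrite /T le_max lexx orbT.
have Tgt0 : 0 < T by exact: lt_le_trans T1.
have lam0 : 0 < lambda by exact: lt_le_trans lambda_ge1.
have [L L1 LP] := rho_bounded_ball S rep (lambda * T + eps).
have L0 : 0 <= L by exact: le_trans L1.
have claim n l x y t : qline P lambda eps 0 l x y -> n%:R * T <= t -> t <=
  n.+1%:R * T ->
    forall e f, e \in xi1 x -> f \in xi2 y ->
    N (rho (l t)^-1%g *m e) * N f <=
    L * L * 2^-1 ^+ n * (N (rho (l t)^-1%g *m f) * N e).
  elim: n l x y t => [|n IH] l x y t lq nt tn e f ex fy.
    rewrite mul0r in nt; rewrite mul1r in tn.
    have ltb : wd 1%g (l t) <= lambda * T + eps.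
      have [ll l0 _ _ _] := lq; have [_] := ll 0 t.
      rewrite sub0r normrN ger0_norm// => h.
      have := wdist_triangle R S 1%g (l 0) (l t).
      have : lambda * t <= lambda * T by rewrite ler_pM2l.
      lra.
    have [_] := LP (l t) ltb (rho (l t)^-1%g *m e); rewrite (rhoVK rep) => he.
    have [+ _] := LP (l t) ltb (rho (l t)^-1%g *m f); rewrite (rhoVK rep) => hf.
    apply: le_trans (ler_pM (euclid_norm_ge0 _) (euclid_norm_ge0 _) he hf) _.
    by rewrite expr0 mulr1 mulrACA [N e * _]mulrC.
  have T0n : T0 <= T by rewrite /T le_max lexx.
  (* Recentring at l T splits off one block of length T, which contributes the factor 1/2; the
     initial block, shorter than T, costs L * L. *)
  pose g := l T; pose m s := (g^-1 * l (s + T))%g.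
  have mq : qline P lambda eps 0 m (act g^-1%g x) (act g^-1%g y).
    by apply: (qline_move Pinv lq); rewrite mulVg wdistxx.
  have xy : P (x, y) by case: lq.
  have [h1 h2] := xiP g^-1%g xy.
  have mt : m (t - T) = (g^-1 * l t)%g by rewrite /m subrK.
  have rm (v : 'cV[R]_d) : rho (m (t - T))^-1%g *m (rho g^-1%g *m v) = rho (l
    t)^-1%g *m v.
    by rewrite mt invgM invgK (rhoM rep) -mulmxA (rhoVK rep).
  have nt' : n%:R * T <= t - T by move: nt; rewrite -(natr1 n) mulrDl mul1r;
    lra.
  have tn' : t - T <= n.+1%:R * T by move: tn;
    rewrite -(natr1 n.+1) mulrDl mul1r; lra.
  have := IH m _ _ (t - T) mq nt' tn' _ _ (h1 e ex) (h2 f fy); rewrite !rm.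
  have := T0P l x y T lq T0n e f ex fy; rewrite -/g.
  set X := N (rho (l t)^-1%g *m e); set Y := N (rho (l t)^-1%g *m f).
  set e' := N (rho g^-1%g *m e); set f' := N (rho g^-1%g *m f) => ef XY.
  have [->|f0] := eqVneq f 0.
    rewrite euclid_norm0 mulr0 mulr_ge0//;
      last by rewrite mulr_ge0 ?euclid_norm_ge0.
    by rewrite mulr_ge0 ?exprn_ge0// mulr_ge0.
  have f'0 : 0 < f'.
    rewrite euclid_norm_gt0; apply: contra_neq f0 => h.
    by rewrite -[f](rhoVK rep g) h mulmx0.
  set K := L * L * 2^-1 ^+ n in XY.
  have K0 : 0 <= K by rewrite mulr_ge0 ?exprn_ge0// mulr_ge0.
  rewrite exprSr [L * L * (_ * _)]mulrA -/K -(ler_pM2r f'0).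
  have h3 : X * f' * N f <= K * (Y * e') * N f by rewrite ler_wpM2r
    ?euclid_norm_ge0.
  have h4 : K * Y * (e' * N f) <= K * Y * (2^-1 * (f' * N e)).
    by rewrite ler_wpM2l// mulr_ge0// euclid_norm_ge0.
  have -> : X * N f * f' = X * f' * N f by ring.
  apply: le_trans h3 _.
  have -> : K * (Y * e') * N f = K * Y * (e' * N f) by ring.
  apply: le_trans h4 _.
  have -> : K * Y * (2^-1 * (f' * N e)) = K * 2^-1 * (Y * N e) * f' by ring.
  exact: lexx.
(* One halving per time T. The constant has a factor 2 because t <= (n + 1) T, whereas only n
   halvings are available. *)
pose mu : R := ln 2 / T.
have ln2 : 0 < ln 2 :> R by rewrite ln_gt0// ltr1n.
exists (2 * (L * L)), mu; split.
- by rewrite !mulr_gt0// (lt_le_trans _ L1).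
- by rewrite divr_gt0.
move=> l x y t lq t0 e f ex fy; pose n := Num.truncn (t / T).
have /andP[n1 n2] : n%:R <= t / T < n.+1%:R by apply: truncn_itv;
  rewrite divr_ge0// ltW.
apply: le_trans (claim n l x y t lq _ _ e f ex fy) _.
- by rewrite -ler_pdivlMr.
- by rewrite -ler_pdivrMr// ltW.
rewrite ler_wpM2r ?mulr_ge0 ?euclid_norm_ge0//.
rewrite -[2 * _ * _]mulrA mulrCA ler_wpM2l ?mulr_ge0//.
have : expR (- ln 2) ^+ n.+1 <= expR (- (mu * t)).
  rewrite -expRM_natr ler_expR mulNr lerN2 /mu mulrAC -mulrA ler_pM2l//.
  exact: ltW.
rewrite expRN lnK ?posrE// exprS => h.
by rewrite -ler_pdivrMl// .
Qed.

(** Translating the line so that it starts at the identity distorts each of the two norms at most by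
    L, the distortion over the ball of radius b. *)
Lemma exp_dominated_base b : exp_dominated P xi1 xi2 lambda eps 0 ->
  exp_dominated P xi1 xi2 lambda eps b.
Proof.
move=> [C [mu [C0 mu0 H]]].
have [L L1 LP] := rho_bounded_ball S rep b.
have L0 : 0 < L by exact: lt_le_trans L1.
exists (L * L * C), mu; split=> //; first by rewrite !mulr_gt0.
move=> l x y t lq t0 e f ex fy; pose g := l 0; pose m s := (g^-1 * l (s + 0))%g.
have mq : qline P lambda eps 0 m (act g^-1%g x) (act g^-1%g y).
  by apply: (qline_move Pinv lq); rewrite mulVg wdistxx.
have gb : wd 1%g g <= b by case: lq.
have xy : P (x, y) by case: lq.
have [h1 h2] := xiP g^-1%g xy.
have rm (v : 'cV[R]_d) : rho (m t)^-1%g *m (rho g^-1%g *m v) = rho (l t)^-1%g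
  *m v.
  by rewrite /m addr0 invgM invgK (rhoM rep) -mulmxA (rhoVK rep).
have := H m _ _ t mq t0 _ _ (h1 e ex) (h2 f fy); rewrite !rm.
have [_] := LP g gb (rho g^-1%g *m e); rewrite (rhoVK rep) => he.
have [+ _] := LP g gb (rho g^-1%g *m f); rewrite (rhoVK rep) => hf.
set c := C * _; have c0 : 0 <= c by rewrite mulr_ge0 ?expR_ge0// ltW.
have -> : L * L * C * expR (- (mu * t)) = L * L * c by rewrite mulrA.
set X := N (rho (l t)^-1%g *m e); set Y := N (rho (l t)^-1%g *m f) => XY.
have X0 : 0 <= X by exact: euclid_norm_ge0.
have Y0 : 0 <= Y by exact: euclid_norm_ge0.
apply: (@le_trans _ _ (X * (L * N (rho g^-1%g *m f))));
  first by rewrite ler_wpM2l.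
rewrite mulrCA -mulrA -mulrA ler_pM2l// [L * _]mulrCA.
apply: le_trans XY _; rewrite ler_wpM2l// mulrCA ler_wpM2l//.
Qed.

(** Recentred at l t and run backwards, the line reaches (l t)^-1 at time t. The estimate there,
    applied to the images of e and f under rho(l t)^-1, is the desired one with the two fibres
    exchanged. *)
Lemma exp_dominated_opp : exp_dominated P xi1 xi2 lambda eps 0 ->
  exp_dominated [set z | P (z.2, z.1)] xi2 xi1 lambda eps 0.
Proof.
move=> [C [mu [C0 mu0 H]]]; exists C, mu; split=> // l y x t lq t0 f e fy ex.
have /= lq' := qline_opp lq; pose g := l t.
pose m s := (g^-1 * l (- (s - t)))%g.
have mq : qline P lambda eps 0 m (act g^-1%g x) (act g^-1%g y).
  apply: (qline_move (l := fun t => l (- t)) (a := - t) Pinv).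
    by move: lq'; congr (qline _ _ _ _ _ _ _); apply/seteqP; split=> -[].
  by rewrite opprK mulVg wdistxx.
have l0 : l 0 = 1%g.
  have [_ h _ _ _] := lq; apply/esym/(wdist_eq0 (R := R) (S := S))/eqP.
  by rewrite eq_le h wdist_ge0.
have xy : P (x, y) by case: lq.
have [h1 h2] := xiP g^-1%g xy.
have rm (v : 'cV[R]_d) : rho (m t)^-1%g *m (rho g^-1%g *m v) = v.
  by rewrite /m subrr oppr0 l0 mulg1 invgK (rhoVK rep).
have := H m _ _ t mq t0 _ _ (h1 e ex) (h2 f fy); rewrite !rm -/g.
by rewrite [N e * _]mulrC [N f * _]mulrC.
Qed.

End Bundle.
End ExponentialDomination.

(** * Hölder continuity *)

Section VisualMetric.
Context (R : realType) (Gam : groupType) (S : gen_set Gam) (delta : R).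
Hypothesis hyp : forall o p q r : cayley R S,
  Num.min (gromov_product o p q) (gromov_product o q r) - delta <=
  gromov_product o p r.
Local Notation bd := (boundary R S).
Context (kappa nu : R) (D : bd -> bd -> R).
Hypothesis kappa0 : 0 < kappa.
Hypothesis nu01 : 0 < nu <= 1.
Hypothesis visual : visual_metric kappa nu D.

Lemma visual_ge0 x y : 0 <= D x y.
Proof.
have [D0 Dsym Dtri _] := visual; have := Dtri x y x.
by rewrite (D0 x x).2// (Dsym y x); lra.
Qed.

Lemma visual_ub x y (s : R) :
  (s%:E <= boundary_gromov_product x y)%E -> D x y <= expR (- (kappa * s)).
Proof.
have [_ _ _ /(_ x y)[_ Dle]] := visual => sxy; rewrite -lee_fin.
apply: le_trans Dle _; rewrite -[X in (_ <= X)%E]/(expeR (- (kappa * s))%:E).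
by rewrite lee_expeR EFinN leeN2 EFinM lee_pmul2l// lte_fin.
Qed.

Lemma visual_le1 x y : D x y <= 1.
Proof.
have := visual_ub (boundary_gp_ge0 hyp x y).
by rewrite mulr0 oppr0 expR0.
Qed.

Lemma visual_lb x y : x <> y -> exists r : R,
  [/\ boundary_gromov_product x y = r%:E,
    0 <= r & nu * expR (- (kappa * r)) <= D x y].
Proof.
have [D0 _ _ /(_ x y)[leD Dle]] := visual => xy.
have := boundary_gp_ge0 hyp x y; move: leD Dle.
case: (boundary_gromov_product x y) => [r| |] // leD Dle r0.
  by exists r; split=> //; rewrite -lee_fin.
exfalso; apply/xy/D0/eqP; rewrite eq_le visual_ge0 andbT.
by move: Dle; rewrite gt0_muley ?lte_fin// /= lee_fin.
Qed.

Lemma visual_ball_nbhs x (r : R) : 0 < r -> nbhs x [set y | D x y < r].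
Proof.
move=> r0; rewrite nbhsE; exists [set y | D x y < r]; last by [].
have [D0 _ Dtri _] := visual; split; last by rewrite /= (D0 x x).2.
suff : boundary_open [set y | D x y < r] by [].
move=> w /= xw; have e0 : 0 < (r - D x w) / 2 by rewrite divr_gt0// subr_gt0.
exists (- ln ((r - D x w) / 2) / kappa) => y wy /=.
have := visual_ub (ltW wy); rewrite mulrC divfK ?gt_eqF// opprK lnK ?posrE//.
have := Dtri x w y; lra.
Qed.

(* D is continuous, hence bounded away from 0 on K. *)
Lemma compact_gp_bounded (K : set (bd * bd)) : compact K ->
  (forall z, K z -> z.1 != z.2) ->
  exists c : R, forall z, K z -> (boundary_gromov_product z.1 z.2 < c%:E)%E.
Proof.
move=> Kc Kneq; apply: contrapT => H.
have /choice[z zP] : forall n : nat, exists z, K z /\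
    (n%:R%:E <= boundary_gromov_product z.1 z.2)%E.
  move=> n; apply: contrapT => H'; apply: H; exists n%:R => z Kz.
  by rewrite ltNge; apply/negP => h; apply: H'; exists z.
have [p [Kp clp]] : exists p, (K `&` cluster (z @ \oo)) p.
  apply: (Kc (z @ \oo) _); exists 0%N => // n _; exact: (zP n).1.
have [D0 Dsym Dtri _] := visual.
have Dp : 0 < D p.1 p.2.
  rewrite lt_def visual_ge0 andbT; apply/eqP => /(D0 _ _).1 p12.
  by have := Kneq p Kp; rewrite p12 eqxx.
(* Thirds, because p.1 is joined to p.2 through the two coordinates of a nearby term of the
   sequence, whose mutual distance tends to 0. *)
have r0 : 0 < D p.1 p.2 / 3 by rewrite divr_gt0.
pose n := (Num.truncn (- ln (D p.1 p.2 / 3) / kappa)).+1.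
have zn : (z @ \oo) [set w | D w.1 w.2 <= D p.1 p.2 / 3].
  exists n => // m /= nm; apply: le_trans (visual_ub (zP m).2) _.
  rewrite -[leRHS]lnK ?posrE// ler_expR lerNl [kappa * _]mulrC -ler_pdivrMr//.
  by apply: ltW; apply: lt_le_trans (truncnS_gt _) _; rewrite ler_nat.
have nb : nbhs p [set w | D p.1 w.1 < D p.1 p.2 / 3 /\ D p.2 w.2 < D p.1 p.2 /
  3].
  exists ([set w | D p.1 w < D p.1 p.2 / 3], [set w | D p.2 w < D p.1 p.2 / 3]).
    by split; exact: visual_ball_nbhs.
  by move=> [w1 w2] [].
have [w [/= w12 [w1 w2]]] := clp _ _ zn nb.
have := Dtri p.1 w.1 p.2; have := Dtri w.1 w.2 p.2.
by rewrite (Dsym w.2 p.2); lra.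
Qed.

End VisualMetric.

(** * Exponential closeness of the limit subspaces *)

Section Holder.
Context (R : realType) (Gam : groupType) (S : gen_set Gam) (delta : R).
Hypothesis hyp : forall o p q r : cayley R S,
  Num.min (gromov_product o p q) (gromov_product o q r) - delta <=
  gromov_product o p r.
Local Notation bd := (boundary R S).
Local Notation wd := (wdist R S).
Context (d k : nat) (rho : Gam -> 'M[R]_d).
Hypothesis rep : is_representation rho.
Hypothesis kd : (1 <= k <= d.-1)%N.
Local Notation N := (@euclid_norm R d).
Context (P : set (bd * bd)) (xi1 xi2 : bd -> {vspace 'cV[R]_d}).
Hypothesis xi_dim : forall x y, P (x,
  y) -> \dim (xi1 x) = k /\ \dim (xi2 y) = (d - k)%N.
Context (lambda eps b : R).
Hypothesis lambda_ge1 : 1 <= lambda.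
Hypothesis eps_ge0 : 0 <= eps.
Hypothesis dom : exp_dominated rho P xi1 xi2 lambda eps b.

Lemma ratio_gap g (E F : {vspace 'cV[R]_d}) (eta : R) :
  \dim E = k -> \dim F = (d - k)%N -> 0 <= eta <= 2^-1 ->
  (forall e f, e \in E -> f \in F ->
     N (rho g^-1%g *m e) * N f <= eta * (N (rho g^-1%g *m f) * N e)) ->
  [/\ sigma k.+1 (rho g) < sigma k (rho g),
    subspace_within eta E (Uk k (rho g)) &
      subspace_within (2 * eta) (Uk k (rho g)) E].
Proof.
move=> dE dF eta01 EF; apply: (singular_gap (rho_unit rep g) kd dE dF eta01).
by move=> e f eE fF; rewrite -(rhoV rep); exact: EF.
Qed.

(** Composing the errors gives eta + 2 eta' (1 + eta); as eta <= 1/2, the coefficient 3 suffices. *)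
Lemma grass_dist_pivot (E E' U : {vspace 'cV[R]_d}) (eta eta' : R) :
  0 <= eta <= 2^-1 -> 0 <= eta' <= 2^-1 ->
  subspace_within eta E U -> subspace_within (2 * eta) U E ->
  subspace_within eta' E' U -> subspace_within (2 * eta') U E' ->
  grass_dist E E' <= 3 * (eta + eta').
Proof.
move=> /andP[h1 h2] /andP[h3 h4] EU UE E'U UE'.
apply: grass_dist_le; first by rewrite mulr_ge0// addr_ge0.
  apply: (@subspace_within_le _ _ (eta + 2 * eta' * (1 + eta))); first by nra.
  by apply: subspace_within_trans EU UE' => //; rewrite mulr_ge0.
apply: (@subspace_within_le _ _ (eta' + 2 * eta * (1 + eta'))); first by nra.
by apply: subspace_within_trans E'U UE => //; rewrite mulr_ge0.
Qed.

(** The pivot is U_k(rho(l t)) with t of order A / lambda. It approximates [xi1 x] by domination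
    along l, and [xi1 x'] by domination along l' at the fellow-travelling time t', the bounded
    discrepancy of the two points costing L * L. *)
Lemma grass_dist_exp_gp : exists C mu : R, [/\ 0 < C, 0 < mu &
  forall l l' x x' y y' (A : R),
    qline P lambda eps b l x y -> qline P lambda eps b l' x' y' ->
    (A%:E < boundary_gromov_product x x')%E ->
    grass_dist (xi1 x) (xi1 x') <= C * expR (- (mu * A))].
Proof.
have lam1 := lambda_ge1; have ep0 := eps_ge0.
have lam0 : 0 < lambda by exact: lt_le_trans lambda_ge1.
have [C0 [mu0 [C00 mu00 H]]] := dom.
have [C1 HC1] := fellow_travel hyp b lambda_ge1 eps_ge0.
have [L L1 LP] := rho_bounded_ball S rep C1.
have L0 : 0 < L by exact: lt_le_trans L1.
(* Comparing distances along the two lines gives t' >= t / lambda^2 - c3; hence the rate [mu1], and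
   one more division by lambda when t is expressed through A. *)
pose c3 : R := (2 * eps + 2 * b + C1) / lambda.
pose mu1 : R := mu0 / (lambda * lambda).
have mu10 : 0 < mu1 by rewrite divr_gt0// mulr_gt0.
pose K : R := 3 * (C0 + L * L * (C0 * expR (mu0 * c3))).
have K0 : 0 < K by rewrite !(mulr_gt0, addr_gt0)// expR_gt0.
pose mu : R := mu1 / lambda.
have mu_gt0 : 0 < mu by rewrite divr_gt0.
exists ((K + 1) * expR (mu * (eps + b))), mu; split=> //.
  by rewrite mulr_gt0 ?expR_gt0// addr_gt0.
move=> l l' x x' y y' A lq lq' Axx; rewrite -mulrA -expRD.
have -> : mu * (eps + b) + - (mu * A) = mu * (eps + b - A) by ring.
(* For small A no positive time is available; the distance is at most 1, and so is 1 at most the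
   exponential, by the factor expR (mu * (eps + b)) of the constant. *)
have [At|tA] := ltP A (eps + b).
  apply: le_trans (grass_dist_le1 _ _) _.
  have : 1 <= expR (mu * (eps + b - A)).
    by rewrite -expR0 ler_expR mulr_ge0 ?subr_ge0// ltW.
  have := K0; nra.
pose t : R := (A - eps - b) / lambda.
have t0 : 0 <= t by rewrite divr_ge0// ?(ltW lam0)//; lra.
have tA' : lambda * t + eps + b <= A by rewrite mulrC divfK ?gt_eqF//; lra.
have xy : P (x, y) by case: lq.
have xy' : P (x', y') by case: lq'.
have [ll lb lx ly _] := lq; have [ll' lb' lx' ly' _] := lq'.
have [t' t'0 ltt'] := HC1 l l' x x' A ll ll' lb lb' lx lx' Axx t t0 tA'.
pose X := expR (- (mu1 * t)).
have XE : expR (mu * (eps + b - A)) = X.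
  by rewrite /X /mu /t; congr expR; field; rewrite gt_eqF.
rewrite XE.
have X0 : 0 < X by exact: expR_gt0.
have tt' : t / (lambda * lambda) - c3 <= t'.
  have : t / lambda - 2 * eps - 2 * b - C1 <= lambda * t'.
    have [+ _] := ll 0 t; rewrite sub0r normrN ger0_norm// [_ * t]mulrC => h1.
    have [_ +] := ll' 0 t'; rewrite sub0r normrN ger0_norm// => h2.
    have := wdist_triangle R S (l 0) 1%g (l t); rewrite (wdistC R S (l 0) 1%g).
    have := wdist_triangle R S 1%g (l' 0) (l' t').
    have := wdist_triangle R S 1%g (l' t') (l t);
      rewrite (wdistC R S (l' t') (l t)).
    lra.
  rewrite -ler_pdivrMl// => h; apply: le_trans h.
  rewrite le_eqVlt; apply/orP; left; apply/eqP; rewrite /c3; field.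
  by rewrite gt_eqF.
pose eta := C0 * expR (- (mu0 * t));
  pose eta' := L * L * (C0 * expR (- (mu0 * t'))).
have eta0 : 0 <= eta by rewrite mulr_ge0 ?expR_ge0// ltW.
have eta'0 : 0 <= eta' by rewrite !mulr_ge0 ?expR_ge0// ltW.
have etaX : eta <= C0 * X.
  rewrite ler_pM2l// ler_expR lerN2 /mu1 mulrAC -mulrA ler_pM2l//.
  by rewrite ler_pdivrMr ?mulr_gt0// ler_peMr// mulr_ege1.
have eta'X : eta' <= L * L * (C0 * expR (mu0 * c3)) * X.
  rewrite /eta' -!mulrA ler_pM2l// ler_pM2l// ler_pM2l// -expRD ler_expR.
  have : mu0 * (t / (lambda * lambda) - c3) <= mu0 * t' by rewrite ler_pM2l.
  rewrite /mu1; lra.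
have etaK : 3 * (eta + eta') <= K * X by rewrite /K; lra.
have KX : K * X <= (K + 1) * X by rewrite ler_pM2r// lerDl.
apply: le_trans KX; apply: le_trans etaK.
(* If eta or eta' exceeds 1/2, the bound 3 (eta + eta') exceeds 1 and holds trivially. *)
have [etah|etah] := leP eta 2^-1; last first.
  by apply: le_trans (grass_dist_le1 _ _) _; lra.
have [etah'|etah'] := leP eta' 2^-1; last first.
  by apply: le_trans (grass_dist_le1 _ _) _; lra.
have [dE dF] := xi_dim xy; have [dE' dF'] := xi_dim xy'.
have [|_ w1 w2] := @ratio_gap (l t) _ _ eta dE dF _ (H l x y t lq t0).
  by rewrite eta0 etah.
have [||_ w3 w4] := @ratio_gap (l t) _ _ eta' dE' dF' _ _.
- by rewrite eta'0 etah'.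
- move=> e f ex fy; have := H l' x' y' t' lq' t'0 e f ex fy.
  pose h := ((l t)^-1 * l' t')%g.
  have hb : wd 1%g h <= C1 by move: ltt';
    rewrite /h /wdist /word_dist invg1 mul1g.
  have rh (v : 'cV[R]_d) : rho (l t)^-1%g *m v = rho h *m (rho (l' t')^-1%g *m
    v).
    by rewrite /h (rhoM rep) -mulmxA (rhoVK rep).
  rewrite !rh.
  have [+ _] := LP h hb (rho (l' t')^-1%g *m e).
  have [_ +] := LP h hb (rho (l' t')^-1%g *m f).
  set Z := C0 * _; have Z0 : 0 <= Z by rewrite mulr_ge0 ?expR_ge0// ltW.
  rewrite /eta' -/Z; set e' := N (rho (l' t')^-1%g *m e).
  set f' := N (rho (l' t')^-1%g *m f).
  set eh := N (rho h *m (rho _ *m e)); set fh := N (rho h *m (rho _ *m f)).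
  move=> ff' ee' ef; have nf := euclid_norm_ge0 f; have ne := euclid_norm_ge0 e.
  apply: (@le_trans _ _ (L * e' * N f)); first by rewrite ler_wpM2r.
  have -> : L * L * Z * (fh * N e) = L * (Z * (L * fh * N e)) by ring.
  rewrite -[L * e' * _]mulrA ler_pM2l//; apply: le_trans ef _.
  by rewrite ler_wpM2l// ler_wpM2r.
by apply: (grass_dist_pivot _ _ w1 w2 w3 w4); rewrite ?eta0 ?eta'0.
Qed.

End Holder.

Lemma holder_limit_map (R : realType) (Gam : groupType) (S : gen_set Gam)
  (delta : R)
    (d k : nat) (rho : Gam -> 'M[R]_d) (P : set (boundary R S * boundary R S))
    (xi1 xi2 : boundary R S -> {vspace 'cV[R]_d}) (lambda eps b kappa nu : R)
    (D : boundary R S -> boundary R S -> R) :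
  (forall o p q r : cayley R S,
    Num.min (gromov_product o p q) (gromov_product o q r) - delta <=
    gromov_product o p r) ->
  is_representation rho -> (1 <= k <= d.-1)%N ->
  (forall x y, P (x, y) -> \dim (xi1 x) = k /\ \dim (xi2 y) = (d - k)%N) ->
  1 <= lambda -> 0 <= eps ->
  exp_dominated rho P xi1 xi2 lambda (eps + 6) (b + 1) ->
  0 < kappa -> 0 < nu <= 1 -> visual_metric kappa nu D ->
  holder_on (QP_pinfty P lambda eps b) D (fun x y => grass_dist (xi1 x) (xi1
    y)).
Proof.
move=> hyp rep kd dims lam1 eps0 dom kappa0 /andP[nu0 nu1] visual.
have eps6 : 0 <= eps + 6 by rewrite addr_ge0.
have [C [mu [C0 mu0 H]]] := grass_dist_exp_gp hyp rep kd dims lam1 eps6 dom.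
(* The subspaces are close at rate mu in the product and D decays at rate kappa; the minimum keeps
   the exponent at most 1. *)
pose alpha := Num.min 1 (mu / kappa).
have a0 : 0 < alpha by rewrite lt_min ltr01 divr_gt0.
have a1 : alpha <= 1 by rewrite ge_min lexx.
have amu : alpha * kappa <= mu by rewrite -ler_pdivlMr// ge_min lexx orbT.
have K0 : 0 < C * expR mu * nu^-1 `^ alpha.
  by rewrite !mulr_gt0 ?expR_gt0// powR_gt0 ?invr_gt0.
exists (C * expR mu * nu^-1 `^ alpha), alpha; split=> //.
move=> x x' /(QP_pinfty_qline hyp)[l [y lq]] /(QP_pinfty_qline hyp)[l' [y'
  lq']].
have [->|/eqP xx'] := eqVneq x x'.
  by rewrite grass_distxx mulr_ge0 ?powR_ge0// ltW.
have [r [rE r0 rD]] := visual_lb hyp kappa0 visual xx'.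
(* A strict lower bound for the product is required, so r - 1 is taken; this is the factor expR mu
   in the constant. *)
have := H l l' x x' y y' (r - 1) lq lq'; rewrite rE lte_fin ltrBlDr ltrDl.
move=> /(_ ltr01) h; apply: le_trans h _.
have -> : - (mu * (r - 1)) = mu + - (mu * r) by ring.
rewrite expRD -[leRHS]mulrA mulrA ler_pM2l ?mulr_gt0 ?expR_gt0//.
rewrite -powRM ?invr_ge0 ?(visual_ge0 visual) ?(ltW nu0)//.
apply: (@le_trans _ _ (expR (- (kappa * r)) `^ alpha)).
  by rewrite -expRM ler_expR mulNr lerN2 mulrAC ler_wpM2r// mulrC.
apply: ge0_ler_powR; rewrite ?nnegrE ?expR_ge0 ?(ltW a0)//.
  by rewrite mulr_ge0 ?invr_ge0 ?(visual_ge0 visual)// ltW.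
by rewrite ler_pdivlMl.
Qed.

(** The lines carrying the gam n have varying endpoints. Along bad indices, U_k(rho(gam n)) is close
    to the xi1 of the n-th endpoint by domination, and these endpoints converge to x together with
    their partners, so continuity on P applies. *)
Lemma limit_of_Uk (R : realType) (Gam : groupType) (S : gen_set Gam) (delta : R)
    (d k : nat) (rho : Gam -> 'M[R]_d) (P : set (boundary R S * boundary R S))
    (xi1 xi2 : boundary R S -> {vspace 'cV[R]_d}) (lambda eps b : R)
    (gam : nat -> Gam) (x : boundary R S) :
  (forall o p q r : cayley R S,
    Num.min (gromov_product o p q) (gromov_product o q r) - delta <=
    gromov_product o p r) ->
  closed_in_boundary2 P -> is_representation rho -> (1 <= k <= d.-1)%N ->
  limit_maps k P rho xi1 xi2 ->
  1 <= lambda -> 0 <= eps ->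
  exp_dominated rho P xi1 xi2 lambda (eps + 6) (b + 1) ->
  bclass x (fun n => vert (gam n)) ->
  (forall n, Gamma_plus P lambda eps b (gam n)) ->
  forall e : R, 0 < e ->
  \forall n \near \oo, sigma k.+1 (rho (gam n)) < sigma k (rho (gam n)) /\
    grass_dist (Uk k (rho (gam n))) (xi1 x) <= e.
Proof.
move=> hyp Pc rep kd lim lam1 eps0 [C [mu [C0 mu0 H]]] gx gP e e0.
have eps6 : 0 <= eps + 6 by rewrite addr_ge0.
have lam0 : 0 < lambda by exact: lt_le_trans lam1.
apply: contrapT => bad.
have /choice[s sP] : forall n : nat, exists m, (n <= m)%N /\
    ~ (sigma k.+1 (rho (gam m)) < sigma k (rho (gam m)) /\
    grass_dist (Uk k (rho (gam m))) (xi1 x) <= e).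
  move=> n; apply: contrapT => noex; apply: bad; exists n => // m /= nm.
  by apply: contrapT => h; apply: noex; exists m.
have /choice[q qP] : forall n, exists q : (R -> Gam) * boundary R S * boundary
  R S * R,
    [/\ qline P lambda (eps + 6) (b + 1) q.1.1.1 q.1.1.2 q.1.2, 0 < q.2 &
      q.1.1.1 q.2 = gam (s n)].
  move=> n; have [l [t [x' [y' [lq t0 lt]]]]] := Gamma_plus_qline hyp (gP (s
    n)).
  by exists (l, x', y', t).
pose ls n := (q n).1.1.1; pose xs n := (q n).1.1.2; pose ys n := (q n).1.2.
pose t n := (q n).2.
have lsq n : qline P lambda (eps + 6) (b + 1) (ls n) (xs n) (ys n) by case: (qP
  n).
have lst n : ls n (t n) = gam (s n) by case: (qP n).
have t0 n : 0 < t n by case: (qP n).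
have [F [FU oF]] := ultraFilterLemma eventually_filter.
have FF : ProperFilter F by exact: ultra_proper.
have tF (A : R) : F [set n | A <= t n].
  have /asymptoticP/(_ (lambda * A + (eps + 6) + (b + 1)))[N HN] :=
    bclass_converges gx.
  apply: oF; exists N => // n /= Nn; have [sn _] := sP n.
  have := HN (s n) (s n) (leq_trans Nn sn) (leq_trans Nn sn).
  rewrite gromov_product_vert /gprod wdistxx -lst (wdistC R S (ls n (t n)) 1%g).
  have [ll lb _ _ _] := lsq n; have [_] := ll 0 (t n).
  rewrite sub0r normrN gtr0_norm// => h1 h2; rewrite -(ler_pM2l lam0).
  have := wdist_triangle R S 1%g (ls n 0) (ls n (t n)); lra.
have [l [x1 [y1 [lq xsx ysy lF]]]] := qline_ultralimit hyp Pc FU lam1 eps6 lsq.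
(* The points of the lines at times t n tend to x1 along F, and they are terms of gam, which tends
   to x. *)
have xx1 : x = x1.
  have /choice[u uP] : forall n : nat, exists m, (n <= m)%N /\
      gp_ge n%:R (vert (gam (s m))) x1.
    move=> n; have [+ _] := lF t tF n%:R; rewrite -/(ls _).
    have Fn : F [set m | (n <= m)%N] by apply: oF; exists n.
    by move=> /(filterI Fn)/filter_ex[m /= [nm]]; rewrite lst => h; exists m.
  apply: (boundary_eq hyp (u := fun n => vert (gam (s (u n))))).
    apply: (gp_ge_bclass hyp) => A; have [N HN] := bclass_gp_ge hyp A gx.
    exists N => n Nn; apply: HN; apply: leq_trans Nn _.
    exact: leq_trans (uP n).1 (sP (u n)).1.
  apply: (gp_ge_bclass hyp) => A; exists (Num.truncn A).+1 => n An.
  apply: gp_ge_le (uP n).2; apply: ltW; apply: lt_le_trans (truncnS_gt A) _.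
  by rewrite ler_nat.
subst x1; have xy : P (x, y1) by case: lq.
have xsys n : P (xs n, ys n) by case: (lsq n).
(* With z <= 1/2 the composed error 2 z + z (1 + 2 z) is at most 4 z <= e. *)
pose z : R := Num.min 2^-1 (e / 4).
have z0 : 0 < z by rewrite lt_min invr_gt0 ltr0n/= divr_gt0.
have z2 : z <= 2^-1 by rewrite ge_min lexx.
have z4 : z <= e / 4 by rewrite ge_min lexx orbT.
have [n /= [[h1 _] tz]] := filter_ex (filterI
  (xi_dist_cvg lim _ xsys xy xsx ysy z0) (tF (- ln (z / C) / mu))).
have etaz : C * expR (- (mu * t n)) <= z.
  rewrite -ler_pdivlMl// [C^-1 * z]mulrC -[leRHS]lnK ?posrE ?divr_gt0//
    ler_expR.
  by rewrite lerNl [mu * _]mulrC -ler_pdivrMr.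
have [sn] := sP n; apply; rewrite -lst.
have dE := xi1_dim lim (xsys n); have dF := xi2_dim lim (xsys n).
have [||gap EU UE] := ratio_gap rep kd dE dF (eta := z) (g := ls n (t n)).
- by rewrite (ltW z0).
- move=> v f vx fy; apply: le_trans (H _ _ _ _ (lsq n) (ltW (t0 n)) v f vx fy)
  _.
  by rewrite ler_wpM2r// mulr_ge0// euclid_norm_ge0.
split=> //; have dx := xi1_dim lim xy.
have [xsE Exs] : subspace_within z (xi1 (xs n)) (xi1 x) /\
    subspace_within z (xi1 x) (xi1 (xs n)).
  by apply: grass_dist_lt => //; rewrite ?dE ?dx; case/andP: kd.
apply: grass_dist_le; first exact: ltW.
  apply: (@subspace_within_le _ _ (2 * z + z * (1 + 2 * z))); first by nra.
  by apply: subspace_within_trans UE xsE; rewrite ?mulr_ge0// ltW.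
apply: (@subspace_within_le _ _ (z + z * (1 + z))); first by nra.
by apply: subspace_within_trans Exs EU; rewrite ltW.
Qed.

Theorem theorem1p2 (R : realType) (Gam : groupType) (S : gen_set Gam)
  (P : set (boundary R S * boundary R S)) (d k : nat) (rho : Gam -> 'M[R]_d)
  (xi1 xi2 : boundary R S -> {vspace 'cV[R]_d}) :
  hyperbolic R S ->
  closed_in_boundary2 P -> group_invariant P ->
  (1 <= k <= d.-1)%N ->
  is_representation rho ->
  dominated S k rho (Gamma_plus P 1 0 0) ->
  limit_maps k P rho xi1 xi2 ->
  (forall (gam : nat -> Gam) (x : boundary R S),
     proj1_set P x -> bclass x (fun n => vert (gam n)) ->
     (exists lambda eps b : R, [/\ 1 <= lambda, 0 <= eps, 0 <= b &
        forall n, Gamma_plus P lambda eps b (gam n)]) ->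
     (\forall n \near \oo, sigma k.+1 (rho (gam n)) < sigma k (rho (gam n))) /\
     grass_cvg (fun n => Uk k (rho (gam n))) (xi1 x)) /\
  (forall (kappa nu : R) (D : boundary R S -> boundary R S -> R),
     0 < kappa -> 0 < nu <= 1 -> visual_metric kappa nu D ->
     (forall lambda eps b : R, 1 <= lambda -> 0 <= eps -> 0 <= b ->
        holder_on (QP_pinfty P lambda eps b) D
          (fun x y => grass_dist (xi1 x) (xi1 y))) /\
     (forall K : set (boundary R S * boundary R S), compact K -> K `<=` P ->
        holder_on K
          (fun z w => Num.max (D z.1 w.1) (D z.2 w.2))
          (fun z w => Num.max (grass_dist (xi1 z.1) (xi1 w.1))
                              (grass_dist (xi2 z.2) (xi2 w.2))))).
Proof.
move=> [delta hyp] Pc Pinv kd rep _ lim.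
have xiP : invariant_bundle rho P xi1 xi2.
  by move=> g x y xy; split=> e ex; [exact: (xi1_mem lim g xy ex)|exact: (xi2_mem lim g xy ex)].
have dom0 (lambda eps : R) : 1 <= lambda -> 0 <= eps ->
    exp_dominated rho P xi1 xi2 lambda eps 0.
  move=> lam1 eps0; apply: (exp_dominated_of_contraction rep Pinv xiP lam1).
  by apply: (contraction hyp Pc Pinv kd rep lim lam1 eps0).
(* On P' the first bundle is xi2, of dimension d - k, so the Hölder bound for xi1 can be repeated
   verbatim for xi2. *)
pose P' := [set z : boundary R S * boundary R S | P (z.2, z.1)].
have Pinv' : group_invariant P' by move=> g x y; exact: Pinv.
have xiP' : invariant_bundle rho P' xi2 xi1.
  by move=> g x y /= /(xiP g)[].
have dims x y : P (x, y) -> \dim (xi1 x) = k /\ \dim (xi2 y) = (d - k)%N.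
  by move=> xy; rewrite (xi1_dim lim xy) (xi2_dim lim xy).
have dims' x y : P' (x, y) -> \dim (xi2 x) = (d - k)%N /\ \dim (xi1 y) = (d - (d - k))%N.
  by move=> /= /dims[-> ->]; case/andP: kd => *; split=> //; lia.
have kd' : (1 <= d - k <= d.-1)%N by lia.
split=> [gam x _ gx [lambda [eps [b [lam1 eps0 b0 gP]]]]|kappa nu D kappa0 nu01 visual].
  have eps6 : 0 <= eps + 6 by rewrite addr_ge0.
  have dom := exp_dominated_base rep Pinv xiP (b + 1) (dom0 _ _ lam1 eps6).
  have H := limit_of_Uk hyp Pc rep kd lim lam1 eps0 dom gx gP.
  split; first by apply: filterS (H 1 ltr01) => n [].
  apply/cvgrPdist_le => e e0; apply: filterS (H e e0) => n [_].
  by rewrite sub0r normrN ger0_norm// grass_dist_ge0.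
have holder1 lambda eps b : 1 <= lambda -> 0 <= eps ->
    holder_on (QP_pinfty P lambda eps b) D (fun x y => grass_dist (xi1 x) (xi1 y)).
  move=> lam1 eps0; have eps6 : 0 <= eps + 6 by rewrite addr_ge0.
  apply: (holder_limit_map hyp rep kd dims lam1 eps0 _ kappa0 nu01 visual).
  exact: (exp_dominated_base rep Pinv xiP _ (dom0 _ _ lam1 eps6)).
have holder2 lambda eps b : 1 <= lambda -> 0 <= eps ->
    holder_on (QP_pinfty P' lambda eps b) D (fun x y => grass_dist (xi2 x) (xi2 y)).
  move=> lam1 eps0; have eps6 : 0 <= eps + 6 by rewrite addr_ge0.
  apply: (holder_limit_map hyp rep kd' dims' lam1 eps0 _ kappa0 nu01 visual).
  apply: (exp_dominated_base rep Pinv' xiP').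
  exact: (exp_dominated_opp rep Pinv xiP (dom0 _ _ lam1 eps6)).
split=> [lambda eps b lam1 eps0 _|K Kc KP]; first exact: holder1.
have Kneq z : K z -> z.1 != z.2.
  by move=> /KP; case: Pc => C _ -> [].
(* Bounded products let every pair in K be joined by a (1,1)-quasi-geodesic passing within a uniform
   b of 1, so both projections of K lie in sets on which Hölder continuity is known. *)
have [c cP] := compact_gp_bounded kappa0 visual Kc Kneq.
have [b bP] := exists_geodesic_line hyp c.
have KQ z : K z -> QP_pinfty P 1 1 b z.1 /\ QP_pinfty P' 1 1 b z.2.
  case: z => x y Kz; have [l [ll lb lx ly]] := bP x y (cP _ Kz).
  have lq : qline P 1 1 b l x y by split=> //; exact: KP.
  by split; [exact: qline_QP_pinfty lq|exact: qline_QP_pinfty (qline_opp lq)].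
have [C1 [a1 [C10 a10 a11 H1]]] := holder1 1 1 b (lexx _) ler01.
have [C2 [a2 [C20 a20 a21 H2]]] := holder2 1 1 b (lexx _) ler01.
pose a := Num.min a1 a2; pose C := Num.max C1 C2.
have a0 : 0 < a by rewrite lt_min a10.
have C0 : 0 < C by rewrite lt_max C10.
exists C, a; split=> //; first by rewrite ge_min a11.
(* Since D is at most 1, lowering the two exponents to their minimum only increases the bounds. *)
have bound (C' a' x0 m : R) : 0 < C' -> C' <= C -> 0 < a' -> a <= a' ->
    0 <= x0 -> x0 <= 1 -> x0 <= m -> C' * x0 `^ a' <= C * m `^ a.
  move=> C'0 C'C a'0 aa' x00 x01 xm; rewrite ler_pM ?powR_ge0 ?(ltW C'0)//.
  apply: (@le_trans _ _ (x0 `^ a)); last first.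
    by apply: ge0_ler_powR; rewrite ?nnegrE ?(ltW a0) ?(le_trans x00).
  move: x00; rewrite le_eqVlt => /predU1P[<-|x00].
    by rewrite !powR0 ?gt_eqF.
  by rewrite ger_powR// x00.
move=> z w /KQ[z1 z2] /KQ[w1 w2]; rewrite ge_max; apply/andP; split.
  apply: le_trans (H1 _ _ z1 w1) _; apply: bound; rewrite ?(visual_ge0 visual)//.
  - by rewrite le_max lexx.
  - by rewrite ge_min lexx.
  - exact: (visual_le1 hyp kappa0 visual).
  - by rewrite le_max lexx.
apply: le_trans (H2 _ _ z2 w2) _; apply: bound; rewrite ?(visual_ge0 visual)//.
- by rewrite le_max lexx orbT.
- by rewrite ge_min lexx orbT.
- exact: (visual_le1 hyp kappa0 visual).
- by rewrite le_max lexx orbT.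
Qed.
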